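(* There are constants $c, d_0>0$ for which the following holds. Let $d\ge d_0$ be an integer, let $L\ge 4$ be an even integer, let $\lambda$ be a real number with $\lambda\ge c\,d^{-1/4}\log^{3/4}d$, and let $\rho\ge 0$ be a real number satisfying $$\rho+\frac{1}{2d^{1/2}}\le\frac{\lambda}{1+\lambda}$$ and $$H\left(\frac{1}{2d^{1/2}}\right)+H\left(\rho+\frac{1}{2d^{1/2}}\right)+\left(\frac{1}{d^{1/2}}+\rho\right)\log_2\lambda+\frac{10}{d^4L\log^2L}\le\log_2(1+\lambda).$$ If $\mathcal{M}$ is an ergodic $\rho$-local Markov chain on state space $\mathcal{I}(T_{L,d})$ with stationary distribution $\pi_\lambda$, then $$\tau_{\mathcal{M}(T_{L,d})}\ \ge\ \exp\left\{\frac{L^{d-1}}{d^4\log^2L}\right\}.$$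
   Context: For $L$ even, $T_{L,d}$ (the even discrete torus) is the graph on vertex set $V=\{0,\dots,L-1\}^d$ in which two vertices are adjacent if they differ on exactly one coordinate and differ by $1\pmod L$ on that coordinate. $\mathcal{I}(T_{L,d})$ is the set of independent sets of $T_{L,d}$. For $\lambda>0$ the hard-core measure $\pi_\lambda$ on $\mathcal{I}(T_{L,d})$ is given by $\pi_\lambda(\{I\})=\lambda^{|I|}/Z_\lambda$ with $Z_\lambda=\sum_{I\in\mathcal{I}(T_{L,d})}\lambda^{|I|}$. $H(\alpha)=-\alpha\log_2\alpha-(1-\alpha)\log_2(1-\alpha)$ is the binary entropy function; $\log$ is the natural logarithm. A Markov chain $\mathcal{M}$ on state space $\mathcal{I}(T_{L,d})$ with transition probabilities $P_{\mathcal{M}}$ is $\rho$-local if in each step the states of at most $\rho|V|$ vertices are changed: $P_{\mathcal{M}}(I_1,I_2)\neq0\Rightarrow|I_1\triangle I_2|\le\rho|V|$. The mixing time of an ergodic chain $\mathcal{M}$ with stationary distribution $\pi$ on $\mathcal{I}(T_{L,d})$ is $$\tau_{\mathcal{M}(T_{L,d})}=\max_{I}\min\left\{t_0:\ \tfrac12\sum_{J}|P^t(I,J)-\pi(J)|\le\tfrac1e\ \ \forall t>t_0\right\},$$ where $I,J$ range over $\mathcal{I}(T_{L,d})$ and $P^t(I,\cdot)$ is the distribution of the chain at time $t$ when started at $I$. *)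

(* Defs.v *)
From HB Require Import structures.
From mathcomp Require Import all_boot all_order all_algebra.
From mathcomp Require Import all_classical all_reals all_analysis.

Set Implicit Arguments.
Unset Strict Implicit.
Unset Printing Implicit Defensive.

Import Order.TTheory GRing.Theory Num.Theory.

Local Open Scope classical_set_scope.
Local Open Scope ring_scope.

Definition torus (L d : nat) := {ffun 'I_d -> 'I_L}.
HB.instance Definition _ L d := Finite.on (torus L d).

(* [i] is the unique coordinate at which [x] and [y] differ. *)
Definition torus_adj (L d : nat) : rel (torus L d) := fun x y =>
  [exists i : 'I_d,
     [forall j : 'I_d, (x j != y j) == (j == i)]
     && (((x i).+1 == y i %[mod L])%N || ((y i).+1 == x i %[mod L])%N)].

Definition independent (V : finType) (e : rel V) (I : {set V}) : bool :=
  [forall x in I, forall y in I, ~~ e x y].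

Definition indep_set (V : finType) (e : rel V) :=
  {I : {set V} | independent e I}.
HB.instance Definition _ V e := Finite.on (@indep_set V e).

Definition torus_indep (L d : nat) := indep_set (@torus_adj L d).
HB.instance Definition _ L d := Finite.on (torus_indep L d).

Section HardCore.
Variables (R : realType) (V : finType) (e : rel V) (lambda : R).

Definition hardcore_partition : R :=
  \sum_(I : indep_set e) lambda ^+ #|val I|.

Definition hardcore (I : indep_set e) : R :=
  lambda ^+ #|val I| / hardcore_partition.

End HardCore.

Definition log2 (R : realType) (x : R) : R := ln x / ln 2.

(* [ln 0 = 0] gives the usual convention [H 0 = H 1 = 0]. *)
Definition binary_entropy (R : realType) (a : R) : R :=
  - a * log2 a - (1 - a) * log2 (1 - a).

Section MarkovChain.
Variables (R : realType) (S : finType) (P : S -> S -> R).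

Definition stochastic : Prop :=
  (forall x y, 0 <= P x y) /\ (forall x, \sum_(y : S) P x y = 1).

Fixpoint step_prob (t : nat) (x y : S) : R :=
  if t is t'.+1 then \sum_(z : S) P x z * step_prob t' z y
  else (x == y)%:R.

Definition irreducible : Prop :=
  forall x y, exists t, 0 < step_prob t x y.

(* For each state the gcd of its possible return times is 1. *)
Definition aperiodic : Prop :=
  forall x (k : nat),
    (forall t : nat, (0 < t)%N -> 0 < step_prob t x x -> (k %| t)%N) ->
    k = 1%N.

Definition ergodic : Prop := irreducible /\ aperiodic.

Definition stationary (pi : S -> R) : Prop :=
  forall y, \sum_(x : S) pi x * P x y = pi y.

Definition mixed_from (pi : S -> R) (x : S) (t0 : nat) : Prop :=
  forall t : nat, (t0 < t)%N ->
    2^-1 * \sum_(y : S) `|step_prob t x y - pi y| <= (expR 1)^-1.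

(* The infimum of a nonempty set of natural numbers is its minimum; the set is
   nonempty for an ergodic chain with stationary distribution [pi], and the
   value for an empty set is [+oo]. *)
Definition mixing_time (pi : S -> R) : \bar R :=
  \big[maxe/-oo%E]_(x : S)
    ereal_inf [set (t0%:R)%:E | t0 in [set t0 | mixed_from pi x t0]].

End MarkovChain.

Definition local_chain (R : realType) (V : finType) (e : rel V) (rho : R)
    (P : indep_set e -> indep_set e -> R) : Prop :=
  forall I J : indep_set e, P I J != 0 ->
    #|(val I :\: val J) :|: (val J :\: val I)|%:R <= rho * #|V|%:R.

(* Main.v *)
(* The chain must cross the set of independent sets whose even and odd parts differ by at most
   [rho N / 2]; locality makes this set a bottleneck, so it suffices to bound its weight. If one
   of the two parts is small, the entropy hypothesis does it. Otherwise both parts exceed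
   [N / (4 sqrt d)], and one works with the cubes [x + {0,1}^d]. A container argument in the
   hypercube shows that a cube is bad (two large parts, or a nearly empty face) with very small
   probability; reflection positivity (the chessboard estimate) turns this into an exponential
   moment for the number of bad cubes of any set of cubes. Good cubes have a type, even or odd,
   and opposite types cannot be adjacent, so by an isoperimetric inequality the interface
   between the two types contains bad cubes. Since [L] is unbounded in terms of [d], types are
   defined on boxes of side [2^j], with the bad boxes becoming rarer with [j] until their density
   at the top level is far below the [1 / (d L)] imposed by the isoperimetric inequality. *)
Require Import Defs.
From HB Require Import structures.
From mathcomp Require Import all_boot all_order all_algebra.
From mathcomp Require Import all_classical all_reals all_analysis.
From mathcomp Require Import ring lra zify fintype finset.

Set Implicit Arguments.
Unset Strict Implicit.
Unset Printing Implicit Defensive.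

Import Order.TTheory GRing.Theory Num.Theory.

Local Open Scope ring_scope.

(** * Isoperimetry in products of cyclic sets *)

(** The lower bound on [lambda] balances two costs. An even set of gap [g] is located by vertex sets
    of size about [g * sqrt (ln d / d)], which costs a factor [exp (C * g * (ln d)^(3/2) / sqrt d)];
    revealing the set inside its container gains [exp (- c * min 1 (lambda^2) * g)]. The gain wins
    once [lambda^2] exceeds a multiple of [d^(-1/2) * (ln d)^(3/2)]. The chessboard estimate sees
    all translates of the cube, which overlap, so a bad cube only gets the weight [exp (1 / d^2)],
    whose power [2^d] the single-cube bound just pays. This controls densities above order [d^(-3)]
    only. A bad box of the next level contains a fraction [1 / (20 * sqrt d)] of bad sub-boxes, so
    each level multiplies the cost of a bad box by about [2^d / (20 * sqrt d)]. Levels are climbed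
    until this cost reaches [2 * d * ln L], when the positions of bad boxes carry no entropy any
    more. These bounds need disjoint boxes, and passing to a grid of them loses a power of [2^d];
    the factor [ln^2 L] in the final exponent pays for what the cost does not recover. *)

Lemma sqrt_lower_tangent (R : rcfType) (J g D : R) :
  0 <= J -> J <= 4^-1 -> 0 <= g -> 0 <= D -> D <= 1 ->
  J + (D * g - 3 / 4 * D ^+ 2) <= Num.sqrt (J ^+ 2 + g ^+ 2).
Proof.
move=> J0 J4 g0 D0 D1.
set t := D * g - 3 / 4 * D ^+ 2.
have [t0|t0] := leP t 0.
  apply: (@le_trans _ _ J); first lra.
  rewrite -[leLHS]ger0_norm // -sqrtr_sqr ler_sqrt; last by rewrite addr_ge0 ?sqr_ge0.
  by rewrite lerDl sqr_ge0.
rewrite -[leLHS]ger0_norm; last by rewrite addr_ge0 // ltW.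
rewrite -sqrtr_sqr ler_sqrt; last by rewrite addr_ge0 ?sqr_ge0.
have tg : t <= g.
  have := mulr_ge0 g0 (_ : 0 <= 1 - D); rewrite subr_ge0 => /(_ D1).
  by have := sqr_ge0 D; rewrite /t; lra.
have key : t * (2^-1 + g) <= g ^+ 2.
  rewrite /t -subr_ge0.
  have -> : g ^+ 2 - (D * g - 3 / 4 * D ^+ 2) * (2^-1 + g)
    = (1 - D) * (g - D / 4) ^+ 2 + D ^+ 2 * g / 4 + D^+2 * (3/8 - (1 - D) / 16).
    by field.
  have h1 := mulr_ge0 (_ : 0 <= 1 - D) (sqr_ge0 (g - D / 4)).
  have h2 := mulr_ge0 (sqr_ge0 D) g0.
  have h3 := mulr_ge0 (sqr_ge0 D) (_ : 0 <= 3 / 8 - (1 - D) / 16).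
  have := h1 ltac:(lra); have := h3 ltac:(lra); lra.
nra.
Qed.

Lemma sqrt_add_le (R : rcfType) (a b c e : R) :
  Num.sqrt ((a + b) ^+ 2 + (c + e) ^+ 2)
  <= Num.sqrt (a ^+ 2 + c ^+ 2) + Num.sqrt (b ^+ 2 + e ^+ 2).
Proof.
set u := Num.sqrt (a ^+ 2 + _); set v := Num.sqrt (b ^+ 2 + _).
have u0 : 0 <= u by exact: sqrtr_ge0.
have v0 : 0 <= v by exact: sqrtr_ge0.
have u2 : u ^+ 2 = a ^+ 2 + c ^+ 2 by rewrite sqr_sqrtr // addr_ge0 ?sqr_ge0.
have v2 : v ^+ 2 = b ^+ 2 + e ^+ 2 by rewrite sqr_sqrtr // addr_ge0 ?sqr_ge0.
rewrite -[leRHS]ger0_norm ?addr_ge0 // -sqrtr_sqr ler_sqrt ?sqr_ge0 //.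
have h : a * b + c * e <= u * v.
  have [h0|h0] := leP (a * b + c * e) 0; first by rewrite (le_trans h0) ?mulr_ge0.
  rewrite -ler_sqr ?nnegrE ?mulr_ge0 //; last exact: ltW.
  rewrite exprMn u2 v2; have := sqr_ge0 (a * e - b * c); nra.
nra.
Qed.

Lemma sqrt_sum_le (R : rcfType) (I : finType) (u v : I -> R) :
  Num.sqrt ((\sum_i u i) ^+ 2 + (\sum_i v i) ^+ 2)
  <= \sum_i Num.sqrt (u i ^+ 2 + v i ^+ 2).
Proof.
elim/big_rec3: _ => [|i x y z _ IH]; first by rewrite !expr0n addr0 sqrtr0.
by apply: le_trans (sqrt_add_le _ _ _ _) _; rewrite lerD2l.
Qed.

(** The profile of a functional isoperimetric inequality of Bobkov type. It vanishes at [0] and [1],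
    so that only boundary terms remain for indicator functions. *)
Definition bernoulli_var (R : rcfType) (x : R) : R := x * (1 - x).

Section CyclicDescent.
Variables (R : rcfType) (X : finType) (s : X -> X).
Hypothesis s_tr : forall a b, fconnect s a b.
Variables (u G : X -> R).
Hypotheses (u01 : forall a, 0 <= u a <= 1) (G0 : forall a, 0 <= G a).
Hypothesis G_ge : forall a, #|X|%:R * (u a - u (s a)) <= G a.

Lemma descent_le_sum a b : #|X|%:R * (u a - u b) <= \sum_c G c.
Proof.
have ab := s_tr a b.
have -> : u b = u (iter (findex s a b) s a) by rewrite iter_findex.
have : (findex s a b <= order s a)%N by rewrite ltnW // findex_max.
move: (findex s a b) => k.
move=> kle.
apply: (@le_trans _ _ (\sum_(j < k) G (iter j s a))).
  elim: k kle => [|k IH] kle; first by rewrite big_ord0 subrr mulr0.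
  rewrite big_ord_recr /=.
  have := IH (ltnW kle); have := G_ge (iter k s a).
  by rewrite -iterS; lra.
rewrite -(big_mkord xpredT (fun j => G (iter j s a))).
rewrite (_ : \sum_(0 <= j < k) _ = \sum_(c <- traject s a k) G c); last first.
  rewrite big_mkord; elim: k {kle} => [|k IH]; first by rewrite big_ord0 big_nil.
  by rewrite big_ord_recr trajectSr -cats1 big_cat big_seq1 IH.
have uq : uniq (traject s a k).
  have := orbit_uniq s a; rewrite /orbit -(subnKC kle).
  by rewrite trajectD cat_uniq => /andP[].
rewrite big_uniq //=.
rewrite [leRHS](bigID (fun c => c \in traject s a k)) /= lerDl.
by apply: sumr_ge0.
Qed.

Local Notation J := (@bernoulli_var R).

(** Let [D] be the oscillation of [u]. The tangent bound with slope [D] adds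
    [D * mean G - 3/4 * D^2] to the mean of [J (u a)], and walking along the cycle from a maximum to
    a minimum shows [mean G >= D]. The surplus [D^2 / 4] dominates the variance of [u], which is the
    difference between [J] of the mean and the mean of [J]. *)
Lemma cyclic_bobkov : (0 < #|X|)%N ->
  J ((\sum_a u a) / #|X|%:R)
  <= (\sum_a Num.sqrt (J (u a) ^+ 2 + G a ^+ 2)) / #|X|%:R.
Proof.
move=> X0.
have /card_gt0P [a0 _] := X0.
pose hi := u [arg max_(a > a0) u a]%O; pose lo := u [arg min_(a < a0) u a]%O.
have hiP a : u a <= hi by rewrite /hi; case: Order.TotalTheory.arg_maxP => // i _ h; exact: h.
have loP a : lo <= u a by rewrite /lo; case: Order.TotalTheory.arg_minP => // i _ h; exact: h.
set D := hi - lo.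
have D0 : 0 <= D by rewrite subr_ge0 (le_trans (loP a0)).
have D1 : D <= 1.
  have /andP[_ h1] : 0 <= hi <= 1 by exact: u01.
  have /andP[l0 _] : 0 <= lo <= 1 by exact: u01.
  by rewrite /D; lra.
set m : R := #|X|%:R.
have m0 : 0 < m by rewrite ltr0n.
have DG : m * D <= \sum_a G a by exact: descent_le_sum.
rewrite ler_pdivlMr //.
apply: (@le_trans _ _ (\sum_a (J (u a) + (D * G a - 3 / 4 * D ^+ 2)))); last first.
  apply: ler_sum => a _; have /andP[ua0 ua1] := u01 a.
  apply: sqrt_lower_tangent => //; rewrite /bernoulli_var; first by nra.
  by have := sqr_ge0 (u a - 2^-1); nra.
rewrite !big_split /= sumrN -mulr_sumr sumr_const -/m.
set su := \sum_a u a.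
have var : \sum_a (u a) ^+ 2 <= (lo + hi) * su - m * (lo * hi).
  apply: (@le_trans _ _ (\sum_a ((lo + hi) * u a - lo * hi))).
    by apply: ler_sum => a _; have := hiP a; have := loP a; nra.
  rewrite big_split /= -mulr_sumr sumrN sumr_const -/su.
  by rewrite -(mulr_natl (lo * hi)).
have -> : \sum_a J (u a) = su - \sum_a (u a) ^+ 2.
  by rewrite -sumrB; apply: eq_bigr => a _; rewrite /bernoulli_var; ring.
rewrite -(mulr_natl (3 / 4 * D ^+ 2)) -/m.
set y := su / m.
have sE : su = y * m by rewrite /y mulfVK // gt_eqF.
rewrite /bernoulli_var; move: DG var; rewrite sE.
move=> DG var.
have h2 : D * (m * D) <= D * \sum_a G a by rewrite ler_wpM2l.
have h3 : (y - lo) * (hi - y) <= D ^+ 2 / 4.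
  by have := sqr_ge0 (2 * y - lo - hi); rewrite /D; nra.
have h4 : m * ((y - lo) * (hi - y)) <= m * (D ^+ 2 / 4) by rewrite ler_wpM2l // ltW.
nra.
Qed.

End CyclicDescent.

Section ProductAverage.
Variables (R : rcfType) (X : finType) (d : nat).
Implicit Types (x y : {ffun 'I_d -> X}) (i j : 'I_d) (a b : X).
Implicit Types (f g : {ffun 'I_d -> X} -> R).

Definition upd x i a : {ffun 'I_d -> X} := [ffun j => if j == i then a else x j].

Lemma updE x i a : upd x i a i = a.
Proof. by rewrite ffunE eqxx. Qed.

Lemma upd_upd x i a b : upd (upd x i a) i b = upd x i b.
Proof. by apply/ffunP => j; rewrite !ffunE; case: eqP. Qed.

Lemma upd_id x i : upd x i (x i) = x.
Proof. by apply/ffunP => j; rewrite !ffunE; case: eqP => [->|]. Qed.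

Lemma upd_comm x i j a b : i != j -> upd (upd x i a) j b = upd (upd x j b) i a.
Proof.
move=> ij; apply/ffunP => k; rewrite !ffunE.
by case: (k =P j) => // ->; case: eqP => // ji; rewrite ji eqxx in ij.
Qed.

Definition avg i f x : R := (\sum_a f (upd x i a)) / #|X|%:R.
Definition avgl (s : seq 'I_d) f := foldr avg f s.

Lemma avgl_le s f g : (forall x, f x <= g x) -> forall x, avgl s f x <= avgl s g x.
Proof.
move=> fg; elim: s => //= i s IH x.
by rewrite /avg ler_wpM2r ?invr_ge0 //; apply: ler_sum => a _; apply: IH.
Qed.

Lemma avglM s (c : R) f x : avgl s (fun y => c * f y) x = c * avgl s f x.
Proof.
elim: s x => //= i s IH x; rewrite /avg mulrA mulr_sumr; congr (_ / _).
by apply: eq_bigr => a _.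
Qed.

Lemma avglB s f g x : avgl s (fun y => f y - g y) x = avgl s f x - avgl s g x.
Proof.
elim: s x => //= i s IH x; rewrite /avg -mulrBl -sumrB; congr (_ / _).
by apply: eq_bigr => a _.
Qed.

Lemma avgl_ge0 s f : (forall x, 0 <= f x) -> forall x, 0 <= avgl s f x.
Proof.
move=> f0; elim: s => //= i s IH x.
by rewrite /avg divr_ge0 // sumr_ge0.
Qed.

Lemma avgl_const s (c : R) x : (0 < #|X|)%N -> avgl s (fun=> c) x = c.
Proof.
move=> X0; elim: s x => //= i s IH x; rewrite /avg.
under eq_bigr => a _ do rewrite IH.
by rewrite sumr_const -[c *+ _]mulr_natr mulfK // pnatr_eq0 -lt0n.
Qed.

Lemma avgl_sqrt s f g x :
  Num.sqrt ((avgl s f x) ^+ 2 + (avgl s g x) ^+ 2)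
  <= avgl s (fun y => Num.sqrt (f y ^+ 2 + g y ^+ 2)) x.
Proof.
elim: s x => //= i s IH x; rewrite /avg !exprMn -mulrDl.
rewrite sqrtrM ?addr_ge0 ?sqr_ge0 // sqrtr_sqr ger0_norm ?invr_ge0 //.
rewrite ler_wpM2r ?invr_ge0 //; apply: le_trans (sqrt_sum_le _ _) _.
by apply: ler_sum => a _; apply: IH.
Qed.

Lemma avgl_indep s f i x b : i \in s -> avgl s f (upd x i b) = avgl s f x.
Proof.
elim: s x => //= j s IH x; rewrite inE /avg.
have [<- _|ij /= /IH h] := eqVneq i j.
  by congr (_ / _); apply: eq_bigr => a _; rewrite upd_upd.
by congr (_ / _); apply: eq_bigr => a _; rewrite upd_comm // h.
Qed.

Lemma avgl_shift s f (t : X -> X) i x : i \notin s ->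
  avgl s f (upd x i (t (x i))) = avgl s (fun y => f (upd y i (t (y i)))) x.
Proof.
elim: s x => //= j s IH x; rewrite inE negb_or => /andP[ij iS]; rewrite /avg.
congr (_ / _); apply: eq_bigr => a _; rewrite upd_comm //.
by rewrite -(IH (upd x j a) iS) ffunE (negPf ij).
Qed.

Lemma sum_avg i f : (0 < #|X|)%N -> \sum_x avg i f x = \sum_x f x.
Proof.
move=> X0; rewrite /avg -mulr_suml.
pose phi (p : {ffun 'I_d -> X} * X) := (upd p.1 i p.2, p.1 i).
have phiK : involutive phi by case=> x a; rewrite /phi /= upd_upd upd_id updE.
rewrite pair_big /= (reindex_inj (inv_inj phiK)) /=.
transitivity ((\sum_(p : {ffun 'I_d -> X} * X) f p.1) / #|X|%:R).
  by congr (_ / _); apply: eq_bigr => -[x a] _; rewrite /= upd_upd upd_id.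
rewrite -(pair_big xpredT xpredT (fun x _ => f x)) /=.
under eq_bigr => x _ do rewrite sumr_const -[f x *+ _]mulr_natr.
by rewrite -mulr_suml mulfK // pnatr_eq0 -lt0n.
Qed.

Lemma sum_avgl s f : (0 < #|X|)%N -> \sum_x avgl s f x = \sum_x f x.
Proof. by move=> X0; elim: s => //= i s IH; rewrite sum_avg. Qed.

Lemma avgl_full f x : (0 < #|X|)%N ->
  avgl (enum 'I_d) f x = (\sum_y f y) / #|{ffun 'I_d -> X}|%:R.
Proof.
move=> X0; set h := avgl (enum 'I_d) f.
have hc y : h y = h x.
  pose mix (s : seq 'I_d) := [ffun j => if j \in s then x j else y j] : {ffun 'I_d -> X}.
  have hm s : h (mix s) = h y.
    elim: s => [|i s IH]; first by congr h; apply/ffunP => j; rewrite ffunE.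
    rewrite -IH; transitivity (h (upd (mix s) i (x i))); last first.
      by rewrite /h avgl_indep // mem_enum.
    by congr h; apply/ffunP => j; rewrite !ffunE inE; case: eqP => [->|].
  rewrite -(hm (enum 'I_d)); congr h; apply/ffunP => j.
  by rewrite ffunE mem_enum.
rewrite -(sum_avgl (enum 'I_d) f X0) -/h.
under eq_bigr do rewrite hc.
rewrite sumr_const -[h x *+ _]mulr_natr mulfK // pnatr_eq0 -lt0n.
by apply/card_gt0P; exists x.
Qed.

Section Bobkov.
Variable s : X -> X.
Hypothesis s_tr : forall a b, fconnect s a b.
Variables (f : {ffun 'I_d -> X} -> R) (G : 'I_d -> {ffun 'I_d -> X} -> R).
Hypotheses (f01 : forall x, 0 <= f x <= 1) (G0 : forall i x, 0 <= G i x).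
Hypothesis G_ge : forall i x, #|X|%:R * (f x - f (upd x i (s (x i)))) <= G i x.
Hypothesis X0 : (0 < #|X|)%N.
Local Notation J := (@bernoulli_var R).

(** The inequality tensorizes. After averaging over [r], the increments in the new direction [i]
    stay below the average of [G i], so the cyclic case applies; Minkowski's inequality in the plane
    then pulls the average over [r] out of the square root. *)
Lemma product_bobkov_seq (r : seq 'I_d) : uniq r -> forall x,
  J (avgl r f x) <= avgl r (fun y => Num.sqrt (J (f y) ^+ 2 + \sum_(i <- r) G i y ^+ 2)) x.
Proof.
elim: r => [_ x|i r IH /= /andP[ir ur] x].
  by rewrite /= big_nil addr0 sqrtr_sqr ler_norm.
rewrite {1}/avg.
apply: le_trans (@cyclic_bobkov R X s s_tr (fun a => avgl r f (upd x i a))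
  (fun a => avgl r (G i) (upd x i a)) _ _ _ X0) _.
- move=> a; rewrite avgl_ge0 /=; last by move=> y; case/andP: (f01 y).
  rewrite -(avgl_const r 1 (upd x i a) X0); apply: avgl_le => y.
  by case/andP: (f01 y).
- by move=> a; apply: avgl_ge0.
- move=> a; have -> : upd x i (s a) = upd (upd x i a) i (s (upd x i a i)).
    by rewrite updE upd_upd.
  by rewrite avgl_shift // -avglB -avglM; apply: avgl_le => y; apply: G_ge.
rewrite /avg ler_wpM2r ?invr_ge0 //; apply: ler_sum => a _.
set H := fun y => Num.sqrt (J (f y) ^+ 2 + \sum_(i <- r) G i y ^+ 2).
apply: (@le_trans _ _ (Num.sqrt ((avgl r H (upd x i a)) ^+ 2
    + (avgl r (G i) (upd x i a)) ^+ 2))).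
  rewrite ler_sqrt ?addr_ge0 ?sqr_ge0 // lerD2r.
  have J0 : 0 <= J (avgl r f (upd x i a)).
    rewrite /bernoulli_var mulr_ge0 ?subr_ge0 //.
      by apply: avgl_ge0 => y; case/andP: (f01 y).
    rewrite -(avgl_const r 1 (upd x i a) X0); apply: avgl_le => y.
    by case/andP: (f01 y).
  have hI := IH ur (upd x i a).
  by rewrite lerXn2r // nnegrE // (le_trans J0 hI).
apply: le_trans (avgl_sqrt _ _ _ _) _.
apply: avgl_le => y; rewrite /H sqr_sqrtr; last first.
  by rewrite addr_ge0 ?sqr_ge0 // sumr_ge0 // => k _; exact: sqr_ge0.
by rewrite big_cons (addrC (G i y ^+ 2)) addrA.
Qed.

Lemma product_bobkov :
  J ((\sum_x f x) / #|{ffun 'I_d -> X}|%:R)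
  <= (\sum_x Num.sqrt (J (f x) ^+ 2 + \sum_i G i x ^+ 2)) / #|{ffun 'I_d -> X}|%:R.
Proof.
have [x0 _] : exists x : {ffun 'I_d -> X}, true.
  by have /card_gt0P[a _] := X0; exists [ffun=> a].
rewrite -(avgl_full _ x0 X0) -(avgl_full _ x0 X0).
apply: le_trans (product_bobkov_seq (enum_uniq _) x0) _.
by apply: avgl_le => y; rewrite big_enum.
Qed.

End Bobkov.
End ProductAverage.

Section Isoperimetry.
Variables (R : rcfType) (X : finType) (d : nat) (s : X -> X).
Hypothesis s_tr : forall a b, fconnect s a b.
Hypothesis X0 : (0 < #|X|)%N.
Variable A : {set {ffun 'I_d -> X}}.
Local Notation N := (#|{ffun 'I_d -> X}|%:R : R).

Definition exits (x : {ffun 'I_d -> X}) (i : 'I_d) :=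
  (x \in A) && (upd x i (s (x i)) \notin A).

(** For an indicator the left square vanishes under the root, and what remains is the root of the
    number of exits. Keeping this root is what yields [sqrt d] instead of [d] in [vertex_iso]. *)
Lemma iso_gen :
  #|A|%:R * (N - #|A|%:R)
  <= #|X|%:R * N * \sum_x Num.sqrt ((#|[set i | exits x i]|%:R : R)).
Proof.
have N0 : 0 < N.
  by have /card_gt0P[a _] := X0; rewrite ltr0n; apply/card_gt0P; exists [ffun=> a].
have := @product_bobkov R X d s s_tr (fun x => (x \in A)%:R)
  (fun i x => #|X|%:R * (exits x i)%:R) _ _ _ X0.
have -> : \sum_x ((x \in A)%:R : R) = #|A|%:R.
  rewrite -sum1_card natr_sum [RHS]big_mkcond /=.
  by apply: eq_bigr => x _; case: (x \in A).
have -> : \sum_x Num.sqrt (bernoulli_var (x \in A)%:R ^+ 2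
   + \sum_i (#|X|%:R * (exits x i)%:R) ^+ 2)
  = #|X|%:R * \sum_x Num.sqrt ((#|[set i | exits x i]|%:R : R)).
  rewrite mulr_sumr; apply: eq_bigr => x _.
  have -> : bernoulli_var (x \in A)%:R = 0 :> R.
    by rewrite /bernoulli_var; case: (x \in A); rewrite ?subrr ?mulr0 ?mul0r.
  rewrite expr0n add0r; under eq_bigr do rewrite exprMn.
  rewrite -mulr_sumr sqrtrM ?sqr_ge0 // sqrtr_sqr ger0_norm //; congr (_ * Num.sqrt _).
  rewrite -sum1dep_card natr_sum [RHS]big_mkcond /=; apply: eq_bigr => i _.
  by case: exits; rewrite ?expr1n ?expr0n.
rewrite /bernoulli_var => h0.
have h : #|A|%:R / N * (1 - #|A|%:R / N)
  <= #|X|%:R * (\sum_x Num.sqrt ((#|[set i | exits x i]|%:R : R))) / N.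
  apply: h0.
  - by move=> x; case: (x \in A); rewrite ?lexx ?ler01.
  - by move=> i x; rewrite mulr_ge0.
  - move=> i x; rewrite ler_wpM2l // /exits.
    by case: (x \in A); case: (_ \in A); rewrite ?subrr ?subr0 ?sub0r ?oppr_le0 //= ?lerN10.
have := ler_wpM2r (ltW (exprn_gt0 2 N0)) h.
set S := \sum_x _; set a := #|A|%:R.
have -> : a / N * (1 - a / N) * N ^+ 2 = a * (N - a) by field; rewrite gt_eqF.
by have -> : #|X|%:R * S / N * N ^+ 2 = #|X|%:R * N * S by field; rewrite gt_eqF.
Qed.

Lemma vertex_iso :
  #|A|%:R * (N - #|A|%:R)
  <= #|X|%:R * N * (Num.sqrt d%:R * #|[set x | [exists i, exits x i]]|%:R).
Proof.
apply: le_trans iso_gen _; rewrite ler_wpM2l ?mulr_ge0 //.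
rewrite -sum1dep_card natr_sum mulr_sumr [leRHS]big_mkcond /=.
apply: ler_sum => x _; case: ifPn => [_|/existsPn h].
  by rewrite mulr1 ler_sqrt // ler_nat -[leqRHS]card_ord max_card.
have -> : [set i | exits x i] = set0.
  by apply/setP => i; rewrite !inE; apply/negbTE/h.
by rewrite cards0 sqrtr0.
Qed.

Lemma edge_iso :
  #|A|%:R * (N - #|A|%:R)
  <= #|X|%:R * N * \sum_x (#|[set i | exits x i]|%:R : R).
Proof.
apply: le_trans iso_gen _; rewrite ler_wpM2l ?mulr_ge0 //.
apply: ler_sum => x _; case: #|_| => [|n]; first by rewrite sqrtr0.
rewrite -[leRHS]ger0_norm // -sqrtr_sqr ler_sqrt ?sqr_ge0 //.
by rewrite -natrX ler_nat leq_pmulr.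
Qed.

End Isoperimetry.

(** * Containers for independent sets of the hypercube *)

Section Cube.
Variable d : nat.
Local Notation V := {ffun 'I_d -> bool}.
Implicit Types (x y z u v w : V) (i j : 'I_d) (K C S F T : {set V}).

Definition flip x i : V := upd x i (~~ x i).

Lemma flipE x i j : flip x i j = (j == i) (+) x j.
Proof. by rewrite ffunE; case: eqP => [->|]. Qed.

Lemma flipK i : involutive (flip^~ i).
Proof. by move=> x; apply/ffunP => j; rewrite !flipE addbA addbb. Qed.

Lemma flip_inj i : injective (flip^~ i).
Proof. exact: inv_inj (flipK i). Qed.

Lemma flipC x i j : flip (flip x i) j = flip (flip x j) i.
Proof. by apply/ffunP => k; rewrite !flipE addbCA. Qed.

Lemma flip_injr x : injective (flip x).
Proof.
move=> i j /ffunP/(_ i); rewrite !flipE eqxx.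
by case: eqP => // _; case: (x i).
Qed.

Definition par x := \big[addb/false]_i x i.

Lemma par_flip x i : par (flip x i) = ~~ par x.
Proof.
rewrite /par (bigD1 i) // [in RHS](bigD1 i) //= flipE eqxx -addbA; congr (~~ (_ (+) _)).
by apply: eq_bigr => j /negPf ji; rewrite flipE ji.
Qed.

Definition deg K x := #|[set i | flip x i \in K]|.
Definition nb K := [set y | [exists i, flip y i \in K]].

Lemma deg_le K x : (deg K x <= d)%N.
Proof. by rewrite -[leqRHS]card_ord max_card. Qed.

Lemma degE K x : (deg K x = \sum_i (flip x i \in K))%N.
Proof. by rewrite /deg -sum1_card big_mkcond /=; apply: eq_bigr => i _; rewrite inE; case: ifP. Qed.

Lemma sum_nbr_swap (M : nmodType) (f : V -> V -> M) :
  \sum_x \sum_i f x (flip x i) = \sum_x \sum_i f (flip x i) x.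
Proof.
rewrite exchange_big [RHS]exchange_big; apply: eq_bigr => i _ /=.
by rewrite (reindex_inj (@flip_inj i)) /=; apply: eq_bigr => x _; rewrite flipK.
Qed.

Lemma sum_nbrs (M : nmodType) (f : V -> M) : \sum_x \sum_i f (flip x i) = \sum_x f x *+ d.
Proof.
transitivity (\sum_x \sum_(i < d) f x); first exact: (sum_nbr_swap (fun _ y => f y)).
by apply: eq_bigr => x _; rewrite sumr_const card_ord.
Qed.

Lemma sum_deg_swap S F : (\sum_(x in S) deg F x = \sum_(x in F) deg S x)%N.
Proof.
have h A B : (\sum_(x in A) deg B x = \sum_x \sum_i ((x \in A) && (flip x i \in B) : nat))%N.
  rewrite big_mkcond; apply: eq_bigr => x _; rewrite degE.
  by case: (x \in A); rewrite ?big1_eq.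
rewrite !h (@sum_nbr_swap nat (fun x y => ((x \in S) && (y \in F) : nat))).
by apply: eq_bigr => x _; apply: eq_bigr => i _; rewrite andbC.
Qed.

Lemma sum_deg K : (\sum_x deg K x = #|K| * d)%N.
Proof.
transitivity (\sum_(x in [set: V]) deg K x)%N.
  by apply: eq_bigl => x; rewrite inE.
rewrite sum_deg_swap -sum_nat_const; apply: eq_bigr => x _.
rewrite /deg -[RHS]card_ord; apply: eq_card => i; rewrite !inE; exact.
Qed.

Lemma nbP K y : reflect (exists i, flip y i \in K) (y \in nb K).
Proof. by rewrite inE; apply: existsP. Qed.

Lemma card_nb K : (#|nb K| <= #|K| * d)%N.
Proof.
rewrite -sum_deg -sum1_card [leqRHS](bigID (mem (nb K))) /=.
apply: leq_trans (leq_addr _ _); apply: leq_sum => x /nbP[i hi].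
by rewrite card_gt0; apply/set0Pn; exists i; rewrite inE.
Qed.

(* A set whose boundary vertices are all odd on the inside, equivalently all even on the outside. *)
Definition odd_bounded (W : {set V}) := forall x i, ~~ par x -> x \in W -> flip x i \in W.

Section Boundary.
Variables (W : {set V}) (W_odd : odd_bounded W).

Definition bdeg x := #|[set i | (flip x i \in W) != (x \in W)]|.

Lemma odd_bounded_out x i : par x -> x \notin W -> flip x i \notin W.
Proof.
move=> px; apply: contra => h.
by rewrite -(flipK i x); apply: W_odd => //; rewrite par_flip px.
Qed.

Lemma bdeg_even_in x : ~~ par x -> x \in W -> bdeg x = 0.
Proof.
move=> px xW; apply: eq_card0 => i; rewrite !inE xW; apply/negbTE; rewrite negbK.
by rewrite W_odd.
Qed.

Lemma bdeg_odd_out x : par x -> x \notin W -> bdeg x = 0.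
Proof.
move=> px xW; apply: eq_card0 => i; rewrite !inE (negPf xW); apply/negbTE.
by rewrite negbK (negPf (odd_bounded_out i px xW)).
Qed.

Lemma bdeg_gt0 x : (0 < bdeg x)%N -> par x = (x \in W).
Proof.
case px: (par x); case xW: (x \in W) => //.
  by rewrite bdeg_odd_out ?px ?xW.
by rewrite bdeg_even_in ?px ?xW.
Qed.

Lemma bdeg_out x : x \notin W -> bdeg x = deg W x.
Proof.
by move=> xW; apply: eq_card => i; rewrite !inE (negPf xW); case: (_ \in W).
Qed.

Lemma bdeg_in x : x \in W -> (bdeg x + deg W x = d)%N.
Proof.
move=> xW; rewrite -[RHS]card_ord -(cardC [set i | flip x i \in W]) addnC; congr addn.
by apply: eq_card => i; rewrite !inE xW; case: (_ \in W).
Qed.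

(** In each direction [j], the square spanned by [i] and [j] has a boundary edge in direction [j] at
    one of the two ends: an even vertex of [W] has all its neighbours in [W], so the fourth corner
    follows the third. *)
Lemma bdeg_edge x i : (flip x i \in W) != (x \in W) -> (d <= bdeg x + bdeg (flip x i))%N.
Proof.
wlog px : x / par x.
  move=> h; case px: (par x); first exact: h.
  move=> hx; rewrite addnC -{2}(flipK i x); apply: h; first by rewrite par_flip px.
  by rewrite flipK eq_sym.
move=> hx.
have xW : x \in W.
  by apply: contraT => h; move: hx; rewrite (negPf h) (negPf (odd_bounded_out i px h)).
have fW : flip x i \notin W by move: hx; rewrite xW; case: (_ \in W).
rewrite -[leqLHS]card_ord -cardsT.
apply: leq_trans (leq_card_setU _ _); apply: subset_leq_card; apply/subsetP => j _.
rewrite !inE xW (negPf fW); apply/orP.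
case h: (flip (flip x i) j \in W); [by right|left].
suff -> : (flip x j \in W) = false by [].
apply/negbTE; rewrite -(flipK i (flip x j)) (flipC x j i).
by apply: odd_bounded_out; rewrite ?par_flip ?px ?h.
Qed.

(** Double counting of the edges inside [W]: the even vertices of [W] have full degree there. *)
Lemma sum_bdeg_in : (\sum_(x in W) bdeg x + #|[set x in W | ~~ par x]| * d
  = #|[set x in W | par x]| * d)%N.
Proof.
have e1 : (\sum_(x in W) (bdeg x + deg W x) = #|W| * d)%N.
  by rewrite -sum_nat_const; apply: eq_bigr => x /bdeg_in.
have e2 : (\sum_(x in W) deg W x = (#|[set x in W | ~~ par x]| * d).*2)%N.
  have ev : (\sum_(x in [set x in W | ~~ par x]) deg [set x in W | par x] x
       = #|[set x in W | ~~ par x]| * d)%N.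
    rewrite -sum_nat_const; apply: eq_bigr => x; rewrite inE => /andP[xW px].
    rewrite /deg -[RHS]card_ord; apply: eq_card => i.
    by rewrite !inE W_odd //= par_flip.
  rewrite (bigID par) /= -addnn -{1}ev; congr (_ + _)%N; last first.
    rewrite -sum_nat_const; apply: eq_big => [x|x /andP[xW px]]; first by rewrite inE.
    by rewrite /deg -[RHS]card_ord; apply: eq_card => i; rewrite !inE W_odd.
  rewrite sum_deg_swap; apply: eq_big => [x|x /andP[xW px]]; first by rewrite inE.
  by apply: eq_card => i; rewrite !inE par_flip px andbT.
have e3 : (#|W| = #|[set x in W | par x]| + #|[set x in W | ~~ par x]|)%N.
  rewrite -(cardsID [set x | par x] W); congr (_ + _)%N; apply: eq_card => x; rewrite !inE //.
  by rewrite andbC.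
move: e1; rewrite big_split /= e2 e3 mulnDl -addnn addnA => /eqP.
by rewrite eqn_add2r => /eqP.
Qed.

Lemma sum_bdeg_out : (\sum_(x in ~: W) bdeg x = \sum_(x in W) bdeg x)%N.
Proof.
transitivity (\sum_(x in ~: W) deg W x)%N.
  by apply: eq_bigr => x; rewrite inE => /bdeg_out.
rewrite sum_deg_swap; apply: eq_bigr => x xW; apply: eq_card => i.
by rewrite !inE xW; case: (_ \in W).
Qed.

End Boundary.
End Cube.

(** * Locating the boundary of an odd-bounded set *)

Section Cover.
Variable d : nat.
Local Notation V := {ffun 'I_d -> bool}.
Implicit Types (x y z u v w : V) (i j : 'I_d) (K C S F T : {set V}).
Variables (W : {set V}) (W_odd : odd_bounded W) (s : nat).
Hypotheses (s_small : (8 * s <= d)%N) (s_gt0 : (0 < s)%N).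
Local Notation b := (bdeg W).

Definition heavy : {set V} := [set z | (d <= b z + s)%N].
(** A heavy vertex has nearly all its neighbours across the boundary, and these may have few
    boundary edges themselves, so its boundary edges need not show in [nbr_bdeg]. Moving heavy
    vertices to the other side removes most such edges. *)
Definition flipped : {set V} := [set z | (z \in W) (+) (z \in heavy)].
Definition nbr_bdeg y := (\sum_j b (flip y j))%N.

Lemma nbr_bdeg_ge y (J : {set 'I_d}) m t : (m <= #|J|)%N ->
  (forall j, j \in J -> (t <= b (flip y j))%N) -> (m * t <= nbr_bdeg y)%N.
Proof.
move=> mJ Jt; apply: (@leq_trans (\sum_(j in J) t)%N).
  by rewrite sum_nat_const leq_mul2r mJ orbT.
rewrite /nbr_bdeg [leqRHS](bigID (mem J)) /=; apply: leq_trans (leq_addr _ _).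
by apply: leq_sum => j /Jt.
Qed.

Lemma heavy_nbrs y : (s <= #|[set j | flip y j \in heavy]|)%N ->
  (s * d <= 2 * nbr_bdeg y)%N.
Proof.
move=> h; have H j : j \in [set j | flip y j \in heavy] -> (d - s <= b (flip y j))%N.
  by rewrite !inE leq_subLR addnC.
have := nbr_bdeg_ge h H; move: (nbr_bdeg y) => B h2; nia.
Qed.

Lemma cover_heavy y i : y \in heavy ->
  (y \in flipped) != (flip y i \in flipped) ->
  (s * d <= 2 * nbr_bdeg y)%N || (s * d <= 2 * nbr_bdeg (flip y i))%N.
Proof.
move=> yH; set u := flip y i => hyu.
have [|h1] := leqP s #|[set j | flip y j \in heavy]|.
  by move/heavy_nbrs => ->.
have [|h2] := leqP s #|[set j | flip u j \in heavy]|.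
  by move/heavy_nbrs => ->; rewrite orbT.
apply/orP; left.
have by_ : (d <= b y + s)%N by move: yH; rewrite inE.
have b0 : (0 < b y)%N by lia.
have py := bdeg_gt0 W_odd b0.
have h3 : (#|[set j | (flip y j \in W) == (y \in W)]| <= s)%N.
  rewrite -(leq_add2l (b y)) /bdeg -[X in (X <= _)%N](_ : d = _) //.
  rewrite -[LHS]card_ord -(cardC [set j | (flip y j \in W) != (y \in W)]); congr addn.
  by apply: eq_card => j; rewrite !inE negbK.
have h4 : (#|[set j | (flip u j \in W) != (y \in W)]| <= s)%N.
  case uH : (u \in heavy).
    have bu : (d <= b u + s)%N by move: uH; rewrite inE.
    have yu : (u \in W) != (y \in W).
      by move: hyu; rewrite ![_ \in flipped]in_set yH uH; case: (y \in W); case: (u \in W).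
    rewrite -(leq_add2l (b u)); apply: leq_trans bu.
    rewrite -[leqRHS]card_ord -(cardC [set j | (flip u j \in W) != (u \in W)]) leq_add2l.
    apply: subset_leq_card; apply/subsetP => j; rewrite !inE.
    by move: yu; case: (u \in W); case: (y \in W); case: (flip u j \in W).
  have yu : (u \in W) = (y \in W).
    by move: hyu; rewrite ![_ \in flipped]in_set yH uH; case: (y \in W); case: (u \in W).
  have bu : b u = 0.
    case E: (b u) => [//|k]; have := @bdeg_gt0 _ _ W_odd u.
    by rewrite E => /(_ isT); rewrite /u par_flip py -/u yu; case: (y \in W).
  move: bu => /eqP; rewrite /bdeg cards_eq0 => /eqP bu.
  rewrite (_ : [set _ | _] = set0) ?cards0 // -bu.
  by apply/setP => j; rewrite !inE yu.
pose J := [set j | [&& flip y j \notin heavy, flip u j \notin heavy,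
   (flip y j \in W) != (y \in W) & (flip u j \in W) == (y \in W)]].
have hJ : (d - 4 * s <= #|J|)%N.
  have : (d <= #|J| + (#|[set j | flip y j \in heavy]| + #|[set j | flip u j \in heavy]|
     + #|[set j | (flip y j \in W) == (y \in W)]|
     + #|[set j | (flip u j \in W) != (y \in W)]|))%N.
    rewrite -[leqLHS]card_ord -cardsT.
    pose J1 := [set j | flip y j \in heavy].
    pose J2 := [set j | flip u j \in heavy].
    pose J3 := [set j | (flip y j \in W) == (y \in W)].
    pose J4 := [set j | (flip u j \in W) != (y \in W)].
    apply: (@leq_trans #|J :|: (J1 :|: J2 :|: J3 :|: J4)|).
      apply: subset_leq_card; apply/subsetP => j _.
      rewrite !in_setU !in_set.
      by case: (_ <= _)%N; case: (_ <= _)%N; case: (_ == _); case: (_ == _).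
    apply: leq_trans (leq_card_setU _ _) _; rewrite leq_add2l.
    apply: leq_trans (leq_card_setU _ _) _; rewrite leq_add2r.
    apply: leq_trans (leq_card_setU _ _) _; rewrite leq_add2r.
    exact: leq_card_setU.
  by lia.
have hb : forall j, j \in J -> (s <= b (flip y j))%N.
  move=> j; rewrite in_set => /and4P[_ + h5 /eqP h6].
  rewrite inE -ltnNge => h7.
  have := @bdeg_edge _ _ W_odd (flip y j) i.
  rewrite (flipC y j i) -/u h6 eq_sym => /(_ h5); lia.
have := nbr_bdeg_ge hJ hb; move: (nbr_bdeg y) => B hB; nia.
Qed.

(** So the vertices of large [nbr_bdeg] separate [flipped] from its complement. When neither end is
    heavy, [b y] lies between [s] and [d - s], and each of the [b y] neighbours across the boundary
    has at least [d - b y] boundary edges. *)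
Lemma cover y i : (y \in flipped) != (flip y i \in flipped) ->
  (s * d <= 2 * nbr_bdeg y)%N || (s * d <= 2 * nbr_bdeg (flip y i))%N.
Proof.
move=> h; have [yH|yH] := boolP (y \in heavy); first exact: cover_heavy.
have [uH|uH] := boolP (flip y i \in heavy).
  rewrite orbC; have := @cover_heavy (flip y i) i uH; rewrite flipK; apply.
  by rewrite eq_sym.
have hW : (flip y i \in W) != (y \in W).
  by move: h; rewrite ![_ \in flipped]in_set (negPf yH) (negPf uH) !addbF eq_sym.
have e := bdeg_edge W_odd hW.
move: yH uH; rewrite !inE -!ltnNge => yH uH.
have H j : j \in [set j | (flip y j \in W) != (y \in W)] -> (d - b y <= b (flip y j))%N.
  by rewrite inE => /(bdeg_edge W_odd); lia.
have := nbr_bdeg_ge (leqnn _) H; rewrite -/(bdeg W y).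
move: (nbr_bdeg y) => B hB; apply/orP; left.
have k1 : (s < b y)%N by lia.
have k2 : (b y < d - s)%N by lia.
have : (s * (d - s) <= b y * (d - b y))%N by nia.
nia.
Qed.

Lemma card_heavy g : (\sum_x b x = 2 * (d * g))%N -> (#|heavy| <= 4 * g)%N.
Proof.
move=> hg.
have h : (#|heavy| * (d - s) <= 2 * (d * g))%N.
  rewrite -hg -sum_nat_const [leqRHS](bigID (mem heavy)) /=.
  apply: leq_trans (leq_addr _ _); apply: leq_sum => z; rewrite inE; lia.
nia.
Qed.

Lemma heavy_in z : z \in heavy -> par z = (z \in W).
Proof. by rewrite inE => h; apply: (bdeg_gt0 W_odd); lia. Qed.

End Cover.

(** Averaging with the weights [c] shows that some [z] covers a fraction [a / S] of what is still
    uncovered; pick it and repeat. *)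
Lemma greedy_cover (R : realFieldType) (V : finType) (e : rel V) (c : V -> R)
    (Y : {set V}) (a S : R) :
  0 < a -> 0 < S -> (forall z, 0 <= c z) -> \sum_z c z <= S ->
  (forall y, y \in Y -> a <= \sum_(z | e y z) c z) ->
  forall t : nat, exists T : {set V}, (#|T| <= t)%N /\
    #|[set y in Y | [forall z in T, ~~ e y z]]|%:R <= #|Y|%:R * (1 - a / S) ^+ t.
Proof.
move=> a0 S0 c0 cS hY; elim=> [|t [T [hT hU]]].
  exists set0; rewrite cards0 mulr1 leqnn ler_nat; split=> //.
  by apply: subset_leq_card; apply/subsetP => y; rewrite inE => /andP[].
set U := [set y in Y | _] in hU *.
pose cov z := #|[set y in U | e y z]|.
have [Y0|Y0] := eqVneq #|Y| 0%N.
  exists T; split; first exact: leqW.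
  rewrite -/U; suff -> : U = set0 by rewrite cards0 Y0 mul0r.
  by apply/eqP; rewrite -subset0 -(cards0_eq Y0); apply/subsetP => y; rewrite inE => /andP[].
have aS : a <= S.
  move: Y0; rewrite -lt0n => /card_gt0P[y /hY h]; apply: le_trans h _; apply: le_trans cS.
  rewrite [leLHS]big_mkcond; apply: ler_sum => z _; case: ifP => // _; exact: c0.
have [z hz] : exists z, #|U|%:R * (a / S) <= (cov z)%:R.
  apply/existsP; apply: contraT => /existsPn h.
  have h1 : \sum_z c z * (cov z)%:R <= \sum_z c z * (#|U|%:R * (a / S)).
    by apply: ler_sum => z _; rewrite ler_wpM2l // ltW // ltNge.
  have h2 : \sum_z c z * (cov z)%:R = \sum_(y in U) \sum_(z | e y z) c z.
    rewrite (exchange_big_dep xpredT) //=; apply: eq_bigr => z _.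
    rewrite sumr_const -[c z *+ _]mulr_natr; congr (_ * _%:R).
    by apply: eq_card => y; rewrite [LHS]in_set.
  have h3 : #|U|%:R * a <= \sum_(y in U) \sum_(z | e y z) c z.
    rewrite mulr_natl -sumr_const; apply: ler_sum => y; rewrite inE => /andP[yY _].
    exact: hY.
  have U0 : 0 < (#|U|%:R : R).
    rewrite ltr0n lt0n; apply: contraT; rewrite negbK => /eqP U0.
    move: Y0; rewrite -lt0n => /card_gt0P[y _].
    by have := h y; rewrite U0 mul0r ler0n.
  have [z0 cz0] : exists z, 0 < c z.
    apply/existsP; apply: contraT => /existsPn h'.
    have c00 z : c z = 0 by apply/eqP; rewrite eq_le c0 andbT leNgt.
    move: h3; under eq_bigr => y _ do (under eq_bigr => z _ do rewrite c00; rewrite big1_eq).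
    by rewrite big1_eq leNgt mulr_gt0.
  have h4 : \sum_z c z * (cov z)%:R < \sum_z c z * (#|U|%:R * (a / S)).
    rewrite (bigD1 z0) //= [ltRHS](bigD1 z0) //=; apply: ltr_leD.
      by rewrite ltr_pM2l // ltNge.
    by apply: ler_sum => z _; rewrite ler_wpM2l // ltW // ltNge.
  have h5 : (\sum_z c z) * (#|U|%:R * (a / S)) <= #|U|%:R * a.
    apply: le_trans (ler_wpM2r _ cS) _; first by rewrite mulr_ge0 // divr_ge0 // ltW.
    by rewrite mulrCA (mulrC S) divfK // gt_eqF.
  by move: h4; rewrite h2 -mulr_suml ltNge (le_trans h5 h3).
exists (z |: T); split.
  by apply: leq_trans (leq_card_setU _ _) _; rewrite cards1 add1n.
rewrite exprSr mulrA; set U' := [set y in Y | _].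
have e1 : (#|U'| + cov z <= #|U|)%N.
  rewrite -(cardsID [set y | e y z] U) addnC; apply: leq_add; apply: subset_leq_card.
    by apply/subsetP => y; rewrite !inE => /andP[/andP[-> ->] ->].
  apply/subsetP => y; rewrite !inE => /andP[-> /forall_inP h] /=.
  rewrite h ?setU11 //=; apply/forall_inP => z' z'T; apply: h.
  by rewrite in_setU z'T orbT.
have e2 : #|U'|%:R <= #|U|%:R * (1 - a / S).
  rewrite mulrBr mulr1; have : ((#|U'| + cov z)%:R : R) <= #|U|%:R by rewrite ler_nat.
  by rewrite natrD; move: hz; move: (#|U|%:R * _) => q; lra.
apply: le_trans e2 _; rewrite ler_wpM2r // subr_ge0.
by rewrite ler_pdivrMr ?mul1r.
Qed.

(** * Refinement of approximations, after Sapozhenko *)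

Section Refine.
Variable d : nat.
Local Notation V := {ffun 'I_d -> bool}.
Implicit Types (x y z u v w : V) (i j : 'I_d) (K C F T : {set V}).

Lemma deg_compl K x : (deg K x + #|[set i | flip x i \notin K]| = d)%N.
Proof.
rewrite -[RHS]card_ord -(cardC [set i | flip x i \in K]); congr addn.
by apply: eq_card => i; rewrite !inE.
Qed.

(** While some vertex of [P] has more than [psi] neighbours in [Z], put it in [G] and delete its
    neighbours from [Z]; each pick deletes more than [psi] points. *)
Lemma greedy_saturate (P Z : {set V}) (psi : nat) :
  exists G : {set V}, [/\ G \subset P, (#|G| * psi <= #|Z|)%N &
    forall u, u \in P -> (#|[set i | (flip u i \in Z) && (flip u i \notin nb G)]| <= psi)%N].
Proof.
have [m] := ubnP #|Z|; elim: m Z => // m IH Z; rewrite ltnS => Zm.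
have [h|] := boolP [forall u in P, (#|[set i | flip u i \in Z]| <= psi)%N].
  exists set0; split; rewrite ?sub0set ?cards0 //.
  move=> u uP; apply: leq_trans (forall_inP h u uP); apply: subset_leq_card.
  by apply/subsetP => i; rewrite !inE => /andP[].
rewrite negb_forall_in => /exists_inP[u uP]; rewrite -ltnNge => hu.
have hc : (#|Z :\: nb [set u]| + #|[set i | flip u i \in Z]| <= #|Z|)%N.
  rewrite -(cardsID (nb [set u]) Z) addnC leq_add2r.
  rewrite -(card_imset _ (@flip_injr _ u)); apply: subset_leq_card.
  apply/subsetP => y /imsetP[i]; rewrite inE => hi ->; rewrite inE hi.
  by apply/nbP; exists i; rewrite flipK inE.
have [|G [GP GZ hG]] := IH (Z :\: nb [set u]); first by lia.
exists (u |: G); split.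
- by apply/subsetP => y; rewrite !inE => /orP[/eqP->//|/(subsetP GP)].
- apply: leq_trans hc; apply: leq_trans (leq_add GZ (ltnW hu)).
  by rewrite -mulSnr leq_mul2r; apply/orP; right; rewrite cardsU1; case: (u \in G).
- move=> v vP; apply: leq_trans (hG v vP); apply: subset_leq_card.
  apply/subsetP => i; rewrite !in_set => /andP[-> h1]; rewrite andbT /=.
  apply/andP; split; apply: contra h1 => /existsP[j hj]; apply/existsP; exists j.
    by move: hj; rewrite !inE => ->.
  by rewrite !inE hj orbT.
Qed.

(** [p.1] bounds the odd part of [W] from below and [p.2] its even part from above. [G1] will
    consist of even points of [W], whose neighbours belong to [W], and [G2] of odd points outside
    [W], whose neighbours do not. The other two moves are forced by degrees and need no record, so a
    round costs only the choice of [G1] and [G2]. *)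
Definition stage (psi : nat) (G1 G2 : {set V}) (p : {set V} * {set V}) :=
  let F1 := p.1 :|: nb G1 in
  let S1 := [set u in p.2 | (#|[set i | flip u i \notin F1]| <= psi)%N] in
  let S2 := S1 :\: nb G2 in
  (F1 :|: [set v | par v && (psi < deg S2 v)%N], S2).

Variables (W : {set V}) (W_odd : odd_bounded W).
Local Notation b := (bdeg W).

Definition approximates (p : {set V} * {set V}) :=
  [/\ p.1 \subset [set v in W | par v], [set u in W | ~~ par u] \subset p.2
    & p.2 \subset [set u | ~~ par u]].

Definition saturated (psi : nat) (p : {set V} * {set V}) :=
  (forall u, u \in p.2 -> (#|[set i | flip u i \notin p.1]| <= psi)%N) /\
  (forall v, par v -> v \notin p.1 -> (deg p.2 v <= psi)%N).

Definition missing (p : {set V} * {set V}) := #|[set v in W | par v] :\: p.1|.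
Definition excess (p : {set V} * {set V}) := #|p.2 :\: W|.

Lemma stageP psi p : approximates p ->
  exists G1 G2 : {set V}, [/\ (#|G1| * psi <= missing p)%N, (#|G2| * psi <= excess p)%N,
    approximates (stage psi G1 G2 p) & saturated psi (stage psi G1 G2 p)].
Proof.
case: p => F0 S0 [/= F0W WS0 S0e].
have [G1 [G1P G1Z hG1]] :=
  greedy_saturate [set u in W | ~~ par u] ([set v in W | par v] :\: F0) psi.
pose F1 := F0 :|: nb G1.
pose S1 := [set u in S0 | (#|[set i | flip u i \notin F1]| <= psi)%N].
have [G2 [G2P G2Z hG2]] := greedy_saturate [set v | par v && (v \notin W)] (S1 :\: W) psi.
have G2Z' : (#|G2| * psi <= #|S0 :\: W|)%N.
  apply: leq_trans G2Z _; apply: subset_leq_card; apply: setSD.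
  by apply/subsetP => u; rewrite inE => /andP[].
have F1W : F1 \subset [set v in W | par v].
  rewrite subUset F0W /=; apply/subsetP => v /nbP[i /(subsetP G1P)].
  rewrite !inE => /andP[h1 h2]; rewrite -(flipK i v) W_odd //.
  by rewrite par_flip h2.
have WS1 : [set u in W | ~~ par u] \subset S1.
  apply/subsetP => u hu; rewrite inE (subsetP WS0) //=.
  apply: leq_trans (hG1 u hu); apply: subset_leq_card; apply/subsetP => i.
  rewrite !in_set negb_or => /andP[-> ->]; rewrite andbT.
  by move: hu; rewrite inE => /andP[uW pu]; rewrite W_odd //= par_flip.
have G2S u : u \in W -> ~~ par u -> u \notin nb G2.
  move=> uW pu; apply/nbP => -[i /(subsetP G2P)]; rewrite inE => /andP[_].
  by rewrite W_odd.
have WS2 : [set u in W | ~~ par u] \subset S1 :\: nb G2.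
  apply/subsetP => u hu; rewrite inE (subsetP WS1) // andbT.
  by move: hu; rewrite inE => /andP[uW pu]; apply: G2S.
have S2e : S1 :\: nb G2 \subset [set u | ~~ par u].
  by apply/subsetP => u; rewrite !inE => /andP[_ /andP[/(subsetP S0e)]]; rewrite inE.
have sat2 v : par v -> v \notin W -> (deg (S1 :\: nb G2) v <= psi)%N.
  move=> pv vW; have vP : v \in [set v | par v && (v \notin W)] by rewrite inE pv.
  apply: leq_trans (hG2 v vP); apply: subset_leq_card; apply/subsetP => i.
  rewrite [_ \in [set _ | _]]in_set => h; rewrite [_ \in [set _ | _]]in_set.
  move: h; rewrite !in_setD => /andP[-> ->]; rewrite !andbT.
  by rewrite odd_bounded_out.
exists G1, G2; split=> //.
  split=> //=; rewrite subUset F1W; apply/subsetP => v; rewrite !in_set => /andP[pv].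
  by rewrite pv andbT; apply: contraLR => vW; rewrite -leqNgt; apply: sat2.
split=> [u|v] /=.
  rewrite in_setD => /andP[_]; rewrite in_set => /andP[_]; apply: leq_trans.
  apply: subset_leq_card; apply/subsetP => i; rewrite !in_set.
  by apply: contra => ->.
by move=> pv; rewrite in_setU negb_or => /andP[_]; rewrite in_set pv /= -leqNgt.
Qed.

(** An excess vertex sends at least [d - psi] edges into [p.1], hence across the boundary of [W].
    This ties the error to the size of the boundary, whatever it was before. *)
Lemma saturated_excess psi p : approximates p -> saturated psi p ->
  (excess p * (d - psi) <= \sum_(x in ~: W) b x)%N.
Proof.
case: p => F0 S0 [/= F0W WS0 S0e] [/= h1 h2].
rewrite /excess /= -sum_nat_const [leqRHS](bigID (mem (S0 :\: W))) /=.
apply: leq_trans (leq_addr _ _); rewrite [leqRHS](eq_bigl (mem (S0 :\: W))); last first.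
  by move=> u; rewrite !inE; case: (u \in W).
apply: leq_sum => u; rewrite inE => /andP[uW uS].
rewrite bdeg_out //; have := h1 u uS.
rewrite -(leq_add2l (deg F0 u)).
rewrite deg_compl.
have : (deg F0 u <= deg W u)%N.
  apply: subset_leq_card; apply/subsetP => i; rewrite !inE => /(subsetP F0W).
  by rewrite inE => /andP[].
lia.
Qed.

Lemma saturated_missing psi p : approximates p -> saturated psi p ->
  (missing p * (d - psi) <= \sum_(x in W) b x)%N.
Proof.
case: p => F0 S0 [/= F0W WS0 S0e] [/= h1 h2].
rewrite /missing /= -sum_nat_const [leqRHS](bigID (mem ([set v in W | par v] :\: F0))) /=.
apply: leq_trans (leq_addr _ _).
rewrite [leqRHS](eq_bigl (mem ([set v in W | par v] :\: F0))); last first.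
  by move=> u; rewrite !inE; case: (u \in W); rewrite ?andbF.
apply: leq_sum => v; rewrite !inE => /andP[vF /andP[vW pv]].
have := h2 v pv vF; have := bdeg_in vW.
have : (deg W v <= deg S0 v)%N.
  apply: subset_leq_card; apply/subsetP => i; rewrite !inE => h.
  by apply: (subsetP WS0); rewrite inE h par_flip pv.
lia.
Qed.

(** An edge from [p.2] to the outside of [p.1] either starts at an excess vertex or ends at a
    missing one, and saturation allows at most [psi] such edges per vertex. *)
Lemma saturated_gap psi p : approximates p -> saturated psi p ->
  (#|p.2| * d <= #|p.1| * d + psi * (excess p + missing p))%N.
Proof.
case: p => F0 S0 [/= F0W WS0 S0e] [/= h1 h2].
have e0 : (\sum_(u in S0) deg F0 u <= #|F0| * d)%N.
  rewrite sum_deg_swap -sum_nat_const; apply: leq_sum => v _; exact: deg_le.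
have e1 : (#|S0| * d = \sum_(u in S0) deg F0 u
     + \sum_(u in S0) #|[set i | flip u i \notin F0]|)%N.
  by rewrite -big_split /= -sum_nat_const; apply: eq_bigr => u _; rewrite deg_compl.
have e2 : (\sum_(u in S0 :\: W) #|[set i | flip u i \notin F0]| <= psi * excess (F0, S0))%N.
  rewrite mulnC /excess /= -sum_nat_const; apply: leq_sum => u; rewrite inE => /andP[_ uS].
  exact: h1.
pose M := [set v in W | par v] :\: F0.
have e3 : (\sum_(u in S0 :&: W) #|[set i | flip u i \notin F0]| <= psi * missing (F0, S0))%N.
  apply: (@leq_trans (\sum_(u in S0) deg M u)%N).
    rewrite [leqRHS](bigID (mem W)) /=; apply: leq_trans (leq_addr _ _).
    rewrite [leqRHS](eq_bigl (mem (S0 :&: W))); last by move=> u; rewrite !inE.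
    apply: leq_sum => u; rewrite inE => /andP[uS uW]; apply: subset_leq_card.
    apply/subsetP => i; rewrite !inE => ->; have pu := subsetP S0e _ uS.
    by move: pu; rewrite inE => pu; rewrite W_odd // par_flip.
  rewrite sum_deg_swap mulnC /missing /= -sum_nat_const; apply: leq_sum => v.
  by rewrite !inE => /andP[vF /andP[vW pv]]; apply: h2.
rewrite e1 /= mulnDr leq_add //.
have -> : (\sum_(u in S0) #|[set i | flip u i \notin F0]| =
  \sum_(u in S0 :\: W) #|[set i | flip u i \notin F0]|
  + \sum_(u in S0 :&: W) #|[set i | flip u i \notin F0]|)%N.
  rewrite (bigID (mem W)) /= addnC; congr (_ + _)%N; apply: eq_bigl => u; rewrite !inE //.
  by rewrite andbC.
exact: leq_add.
Qed.

End Refine.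

(** * Rough approximation from the components off a separating set *)

Section Components.
Variable d : nat.
Local Notation V := {ffun 'I_d -> bool}.
Implicit Types (x y z u v w : V) (i j : 'I_d) (K F T : {set V}).

Lemma codegree (p q : V) :
  (#|[set ij : 'I_d * 'I_d | (ij.1 != ij.2) && (flip (flip p ij.1) ij.2 == q)]| <= 2)%N.
Proof.
set A := [set ij | _].
have [->|] := eqVneq A set0; first by rewrite cards0.
case/set0Pn => -[i0 j0]; rewrite inE /= => /andP[ij0 /eqP hq].
apply: (@leq_trans #|[set (i0, j0); (j0, i0)]|); last by rewrite cards2; case: eqP.
apply: subset_leq_card; apply/subsetP => -[i j]; rewrite !inE /= => /andP[ij /eqP h].
have hk k : (k == i) (+) (k == j) = (k == i0) (+) (k == j0).
  have := congr1 (fun f : V => f k) (etrans h (esym hq)).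
  rewrite /= !flipE; case: (p k); case: (k == i); case: (k == j);
    by case: (k == i0); case: (k == j0).
have hi := hk i; have hj := hk j.
rewrite eqxx (negPf ij) /= in hi; rewrite eqxx (eq_sym j i) (negPf ij) /= in hj.
have ne k : (i == k) && (j == k) = false.
  by apply: contraNF ij => /andP[/eqP -> /eqP ->].
rewrite !xpair_eqE; move: hi hj (ne i0) (ne j0).
by case: (i == i0); case: (i == j0); case: (j == i0); case: (j == j0).
Qed.

(** Two distinct vertices have at most two common neighbours, so the squared inner degrees sum to at
    most [\sum deg + 2 * #|K| ^ 2]. An average inner degree above [d / 2] would contradict this by
    Cauchy-Schwarz. *)
Lemma small_set_degree K : (4 <= d)%N -> (16 * #|K| < d ^ 2)%N ->
  (2 * \sum_(z in K) deg K z <= #|K| * d)%N.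
Proof.
move=> d4 Ks; rewrite leqNgt; apply/negP => h.
have K0 : (0 < #|K|)%N.
  by rewrite lt0n; apply: contraTneq h => /cards0_eq ->; rewrite big_set0.
have sq : (\sum_(z in K) deg K z ^ 2 <= \sum_(z in K) deg K z + 2 * #|K| ^ 2)%N.
  have -> : (\sum_(z in K) deg K z ^ 2 = \sum_z \sum_i \sum_j
       [&& z \in K, flip z i \in K & flip z j \in K])%N.
    rewrite big_mkcond; apply: eq_bigr => z _.
    case: (z \in K); last by rewrite big1 // => i _; rewrite big1.
    rewrite degE /= -mulnn big_distrlr; apply: eq_bigr => i _; apply: eq_bigr => j _ /=.
    by case: (_ \in K); case: (_ \in K).
  have -> : (\sum_(z in K) deg K z = \sum_z \sum_i ((z \in K) && (flip z i \in K) : nat))%N.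
    rewrite big_mkcond; apply: eq_bigr => x _; rewrite degE.
    by case: (x \in K); rewrite ?big1_eq.
  apply: (@leq_trans (\sum_z \sum_i ((z \in K) && (flip z i \in K) : nat)
    + \sum_z \sum_i \sum_(j | i != j) ((flip z i \in K) && (flip z j \in K) : nat)))%N.
    rewrite -big_split leq_sum // => z _ /=; rewrite -big_split leq_sum // => i _ /=.
    rewrite (bigD1 i) //= andbb leq_add2l.
    rewrite [leqRHS](eq_bigl (fun j => j != i)); last by move=> j; rewrite eq_sym.
    by apply: leq_sum => j _; case: (z \in K).
  rewrite leq_add2l.
  pose f x y i := (\sum_(j | i != j) ((y \in K) && (flip x j \in K) : nat))%N.
  have -> : (\sum_z \sum_i \sum_(j | i != j) ((flip z i \in K) && (flip z j \in K) : nat)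
    = \sum_z \sum_i \sum_(j | i != j) ((z \in K) && (flip (flip z i) j \in K) : nat))%N.
    rewrite exchange_big [RHS]exchange_big; apply: eq_bigr => i _ /=.
    rewrite (reindex_inj (@flip_inj _ i)) /=; apply: eq_bigr => x _.
    by apply: eq_bigr => j _; rewrite flipK.
  apply: (@leq_trans (\sum_(z in K) 2 * #|K|)%N); last by rewrite sum_nat_const; lia.
  rewrite [leqRHS]big_mkcond; apply: leq_sum => z _; case: (z \in K); last first.
    by rewrite big1 // => i _; rewrite big1.
  rewrite pair_big_dep /=.
  rewrite (eq_bigr (fun p : 'I_d * 'I_d => \sum_(q in K) (flip (flip z p.1) p.2 == q : nat))%N).
    rewrite exchange_big /= mulnC -sum_nat_const; apply: leq_sum => q qK.
    apply: leq_trans (codegree z q); rewrite -sum1_card [leqRHS]big_mkcond /= [leqLHS]big_mkcond.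
    apply: leq_sum => -[i j] _; rewrite inE /=.
    by case: (i != j); case: (_ == q).
  move=> [i j] _ /=; case E: (_ \in K).
    rewrite (bigD1 (flip (flip z i) j)) //= eqxx big1 // => q /andP[_].
    by rewrite eq_sym => /negPf ->.
  rewrite big1 // => q qK; apply/eqP; rewrite eqb0; apply: contraFneq E => -> //.
have lower : (4 * d * \sum_(z in K) deg K z <= 4 * (\sum_(z in K) deg K z ^ 2) + #|K| * d ^ 2)%N.
  rewrite !big_distrr /= -sum_nat_const -big_split /=; apply: leq_sum => z _.
  by move: (deg K z) => k; have [+ _] := nat_Cauchy (2 * k) d; rewrite expnMn; lia.
move: h sq lower; move: (\sum_(z in K) deg K z)%N (\sum_(z in K) deg K z ^ 2)%N => D Q.
move: Ks K0; move: #|K| => k Ks K0 h1 h2 h3.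
have h4 : (4 * d * D <= 4 * D + 8 * k ^ 2 + k * d ^ 2)%N by lia.
have h5 : (2 * (d - 1) * (k * d) < 2 * (d - 1) * (2 * D))%N by rewrite ltn_pmul2l //; lia.
have h6 : (2 * (d - 1) * (k * d) < 8 * k ^ 2 + k * d ^ 2)%N by nia.
have h7 : (2 * (d - 1) * d < 8 * k + d ^ 2)%N by nia.
nia.
Qed.

Variables (R : rcfType) (C : {set V}).

Definition freeadj : rel V := fun y z =>
  [&& y \notin C, z \notin C & [exists i, z == flip y i]].
Definition comp y := [set z | connect freeadj y z].
Definition big_comp y := (d ^ 2 <= 16 * #|comp y|)%N.

Lemma freeadj_sym : connect_sym freeadj.
Proof.
apply: sym_connect_sym => y z; rewrite /freeadj andbCA; congr [&& _, _ & _].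
by apply/existsP/existsP => -[i /eqP ->]; exists i; rewrite flipK.
Qed.

Lemma comp_eq y z : z \in comp y -> comp z = comp y.
Proof.
rewrite inE => yz; apply/setP => t; rewrite !inE.
exact/esym/(same_connect freeadj_sym).
Qed.

Lemma comp_notin y z : y \notin C -> z \in comp y -> z \notin C.
Proof.
rewrite inE => yC /connectP[p]; elim/last_ind: p z => [|p t _] z /=; first by move=> _ ->.
by rewrite rcons_path last_rcons => /andP[_ /and3P[_ h _]] ->.
Qed.

Lemma comp_exit y z i : y \notin C -> z \in comp y -> flip z i \notin comp y -> flip z i \in C.
Proof.
move=> yC zy; apply: contraR => fC; have zC := comp_notin yC zy.
move: zy; rewrite !inE => zy; apply: connect_trans zy _; apply: connect1.
by rewrite /freeadj zC fC; apply/existsP; exists i.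
Qed.

Lemma comp_side (W : {set V}) y z :
  (forall y i, (y \in W) != (flip y i \in W) -> (y \in C) || (flip y i \in C)) ->
  z \in comp y -> (z \in W) = (y \in W).
Proof.
move=> h; rewrite inE => /connectP[p]; elim: p y => [|t p IH] y /=; first by move=> _ ->.
move=> /andP[/and3P[yC tC /existsP[i /eqP et]] hp] hz; rewrite (IH t hp hz).
apply/eqP; apply: contraT; rewrite et eq_sym => /h.
by rewrite (negPf yC) -et (negPf tC).
Qed.

Lemma sum_degC : (\sum_(z in ~: C) deg C z <= #|C| * d)%N.
Proof.
rewrite -sum_deg [leqRHS](bigID (mem (~: C))) /=; exact: leq_addr.
Qed.

Lemma small_comp y : (4 <= d)%N -> y \notin C -> ~~ big_comp y ->
  (#|comp y| * d <= 2 * \sum_(z in comp y) deg C z)%N.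
Proof.
rewrite /big_comp -ltnNge => d4 yC /(small_set_degree d4) h.
have e : (#|comp y| * d <= \sum_(z in comp y) deg (comp y) z + \sum_(z in comp y) deg C z)%N.
  rewrite -big_split /= -sum_nat_const; apply: leq_sum => z zy.
  rewrite -[leqLHS](deg_compl (comp y) z) leq_add2l.
  apply: subset_leq_card; apply/subsetP => i hi; rewrite in_set.
  by apply: (comp_exit yC zy); move: hi; rewrite in_set.
move: e h; move: (#|comp y| * d)%N (\sum_(z in comp y) deg (comp y) z)%N => k A.
lia.
Qed.

(** Edges leaving a component end in [C]. By edge isoperimetry their number is at least a quarter of
    the size of the component. *)
Lemma big_comp_out y : y \notin C -> big_comp y -> (2 * #|comp y| <= #|V|)%N ->
  (d ^ 2 <= 64 * \sum_(z in comp y) deg C z)%N.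
Proof.
move=> yC yb hh.
have tr : forall a b0 : bool, fconnect negb a b0.
  move=> a c; case: (eqVneq a c) => [->|ac]; first exact: connect0.
  have -> : c = ~~ a by move: ac; case: a; case: c.
  exact: fconnect1.
have := @edge_iso R bool d negb tr _ (comp y); rewrite card_bool => /(_ isT).
set n := #|V| in hh *.
have -> : \sum_x (#|[set i | exits negb (comp y) x i]|%:R : R)
   = (\sum_(z in comp y) #|[set i | exits negb (comp y) z i]|)%:R.
  rewrite natr_sum [RHS]big_mkcond; apply: eq_bigr => z _; case: ifPn => // /negPf hz.
  by rewrite (_ : [set _ | _] = set0) ?cards0 //; apply/setP => i; rewrite !in_set /exits hz.
have e : (\sum_(z in comp y) #|[set i | exits negb (comp y) z i]|
   <= \sum_(z in comp y) deg C z)%N.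
  apply: leq_sum => z zy; apply: subset_leq_card; apply/subsetP => i.
  move=> h; rewrite in_set; move: h; rewrite in_set => /andP[_ h].
  exact: comp_exit h.
move: e; move: (\sum_(z in comp y) deg C z)%N (\sum_(z in comp y) #|_|)%N => A B AB.
move: yb hh; rewrite /big_comp; move: #|comp y| => k yb hh.
have kn : (k <= n)%N by lia.
rewrite -natrB // -!natrM ler_nat => h.
have n0 : (0 < n)%N by rewrite /n; apply/card_gt0P; exists y.
have h1 : (k * n <= 2 * (k * (n - k)))%N by nia.
have h2 : (n * k <= n * (4 * B))%N by nia.
rewrite leq_pmul2l // in h2; lia.
Qed.

Definition is_root r := (r \notin C) && (fingraph.root freeadj r == r).

Lemma sum_roots (P : pred V) (f : V -> nat) :
  (\sum_(r | is_root r && P r) \sum_(z in comp r) f z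
    = \sum_(z in ~: C | P (fingraph.root freeadj z)) f z)%N.
Proof.
rewrite [RHS](partition_big (fingraph.root freeadj) (fun r => is_root r && P r)) /=.
  apply: eq_bigr => r /andP[/andP[rC /eqP rr] Pr]; apply: eq_bigl => z.
  rewrite inE -(root_connect freeadj_sym) rr in_setC.
  case: (eqVneq r (fingraph.root freeadj z)) => [rz|rz]; last by rewrite !andbF.
  rewrite -rz Pr !andbT; apply/esym; apply: (@comp_notin r) => //.
  by rewrite inE -(root_connect freeadj_sym) rr rz.
move=> z /andP[zC ->]; rewrite andbT /is_root root_root //; last exact: freeadj_sym.
rewrite eqxx andbT; apply: (@comp_notin z); first by rewrite in_setC in zC.
by rewrite inE connect_root.
Qed.

(** [C] receives at most [#|C| * d] edges, and each component on at most half of the cube sends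
    [d ^ 2 / 64] of them. The extra [d] stands for the at most one component larger than half. *)
Lemma card_roots (P : pred V) : (forall r, P r -> big_comp r) ->
  (#|[set r | is_root r && P r]| * d <= d + 64 * #|C|)%N.
Proof.
move=> Pb.
have [d0|d0] := posnP d; first by rewrite [X in (_ * X <= _)%N]d0 muln0.
pose Q r := P r && (2 * #|comp r| <= #|V|)%N.
pose RQ := [set r | is_root r && Q r].
pose RN := [set r | is_root r && (P r && ~~ (2 * #|comp r| <= #|V|)%N)].
have c1 : (#|RN| <= 1)%N.
  rewrite leqNgt; apply/negP => /card_gt1P[r [t [hr ht rt]]].
  move: hr ht; rewrite !in_set => /andP[/andP[rC /eqP hr] /andP[_ h1]].
  move=> /andP[/andP[tC /eqP ht] /andP[_ h2]].
  have dis : [disjoint comp r & comp t].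
    rewrite -setI_eq0 -subset0; apply/subsetP => z; rewrite !inE => /andP[].
    rewrite -!(root_connect freeadj_sym) hr ht => /eqP e1 /eqP e2.
    by rewrite e1 e2 eqxx in rt.
  have h3 : (#|comp r :|: comp t| <= #|V|)%N by exact: max_card.
  move: h3 h1 h2; rewrite cardsU.
  move: dis; rewrite -setI_eq0 => /eqP ->; rewrite cards0 subn0 -!ltnNge.
  move: #|V| #|comp r| #|comp t| => a1 a2 a3; lia.
have c2 : (#|RQ| * d ^ 2 <= 64 * (#|C| * d))%N.
  apply: (@leq_trans (64 * \sum_(r | is_root r && Q r) \sum_(z in comp r) deg C z))%N.
    rewrite big_distrr /= -sum_nat_const.
    rewrite (eq_bigl (fun r => is_root r && Q r)); last by move=> r; rewrite inE.
    by apply: leq_sum => r /andP[/andP[rC _] /andP[/Pb Pr hr]]; apply: big_comp_out.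
  rewrite leq_mul2l /= (sum_roots Q); apply: leq_trans sum_degC.
  rewrite [leqRHS](bigID (fun z => Q (fingraph.root freeadj z))) /=; exact: leq_addr.
have -> : [set r | is_root r && P r] = RQ :|: RN.
  apply/setP => r; rewrite !in_set /Q; case: (is_root r); case: (P r) => //=.
  by case: (_ <= _)%N.
have c3 : (#|RQ :|: RN| <= #|RQ| + #|RN|)%N by exact: leq_card_setU.
have c4 : (#|RQ| * d <= 64 * #|C|)%N by rewrite -(leq_pmul2r d0); lia.
have := leq_mul c3 (leqnn d); rewrite mulnDl; nia.
Qed.

(** A small component sends at least half of its edges into [C]. *)
Lemma card_small_comps : (4 <= d)%N ->
  (#|[set z | (z \notin C) && ~~ big_comp z]| <= 2 * #|C|)%N.
Proof.
move=> d4; have d0 : (0 < d)%N by lia.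
rewrite -(leq_pmul2r d0).
have hb z : big_comp (fingraph.root freeadj z) = big_comp z.
  by rewrite /big_comp (@comp_eq z) // inE connect_root.
apply: (@leq_trans (\sum_(z in ~: C | ~~ big_comp (fingraph.root freeadj z)) d)%N).
  rewrite -sum_nat_const [leqRHS](eq_bigl (mem [set z | (z \notin C) && ~~ big_comp z])) //.
  by move=> z; rewrite !inE hb.
rewrite -(sum_roots (fun z => ~~ big_comp z) (fun=> d)).
apply: (@leq_trans (\sum_(r | is_root r && ~~ big_comp r) 2 * \sum_(z in comp r) deg C z)%N).
  apply: leq_sum => r /andP[/andP[rC _] hr]; rewrite sum_nat_const.
  exact: small_comp.
rewrite -big_distrr /= -mulnA leq_mul2l /= (sum_roots (fun z => ~~ big_comp z)); apply: leq_trans sum_degC.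
rewrite [leqRHS](bigID (fun z => ~~ big_comp (fingraph.root freeadj z))) /=; exact: leq_addr.
Qed.

Definition inner (Rt : {set V}) := [set z | [&& z \notin C, big_comp z
  & [exists r in Rt, connect freeadj r z]]].

(** The undecided vertices, those of [C] and of the small components, are left out of the lower
    bound and kept in the upper one. *)
Definition rough (Rt : {set V}) : {set V} * {set V} :=
  ([set z in inner Rt | par z],
   [set z | ~~ par z && ~~ [&& z \notin C, big_comp z & z \notin inner Rt]]).

(** [C] meets every boundary edge of [W'], so a component off [C] lies on one side of [W']. The
    roots of the big components inside [W'] thus determine [W'] up to [C] and the small components,
    and [W'] differs from [W] on [H] only. *)
Lemma roughP (W H : {set V}) : (4 <= d)%N -> odd_bounded W ->
  (forall z, z \in H -> par z = (z \in W)) ->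
  (forall y i, let W' := [set z | (z \in W) (+) (z \in H)] in
     (y \in W') != (flip y i \in W') -> (y \in C) || (flip y i \in C)) ->
  exists Rt : {set V}, [/\ (#|Rt| * d <= d + 64 * #|C|)%N, approximates W (rough Rt),
    (missing W (rough Rt) <= #|H| + 3 * #|C|)%N & (excess W (rough Rt) <= #|H| + 3 * #|C|)%N].
Proof.
move=> d4 W_odd HW; set W' := [set z | _] => hC.
pose Rt := [set r | is_root r && (big_comp r && (r \in W'))].
have hI z : z \notin C -> big_comp z -> (z \in inner Rt) = (z \in W').
  move=> zC zb; rewrite inE zC zb /=; apply/exists_inP/idP => [[r]|zW].
    by rewrite inE => /andP[_ /andP[_ rW]] rz; rewrite (@comp_side W' r z) // inE.
  exists (fingraph.root freeadj z); last by rewrite freeadj_sym connect_root.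
  have zr : fingraph.root freeadj z \in comp z by rewrite inE connect_root.
  rewrite inE /is_root (comp_notin zC zr) root_root //; last exact: freeadj_sym.
  rewrite eqxx /=; apply/andP; split; first by rewrite /big_comp (comp_eq zr).
  by rewrite (@comp_side W' z).
have W'odd z : par z -> (z \in W') -> z \in W.
  by rewrite inE => pz; case zH: (z \in H); [rewrite -HW // pz | rewrite addbF].
have W'even z : ~~ par z -> z \in W -> z \in W'.
  move=> /negPf pz zW; rewrite inE zW; case zH: (z \in H) => //.
  by move: (HW z zH); rewrite pz zW.
pose Sm := [set z | (z \notin C) && ~~ big_comp z].
have cHC : (#|H :|: (C :|: Sm)| <= #|H| + 3 * #|C|)%N.
  apply: leq_trans (leq_card_setU _ _) _; rewrite leq_add2l.
  apply: leq_trans (leq_card_setU _ _) _; have := card_small_comps d4; rewrite -/Sm; lia.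
exists Rt; split.
- by apply: card_roots => r /andP[].
- split; apply/subsetP => z; rewrite !in_set.
  + move=> /andP[zI pz]; rewrite pz andbT; apply: W'odd => //.
    by move: zI => /and3P[zC zb h]; rewrite -hI // in_set zC zb.
  + move=> /andP[zW pz]; rewrite pz /=; apply/negP => /and3P[zC zb].
    by rewrite -[[&& _, _ & _]](in_set (fun z => [&& z \notin C, big_comp z & _])) -/(inner Rt) hI // W'even.
  + by move=> /andP[].
- apply: leq_trans cHC; apply: subset_leq_card; apply/subsetP => z.
  rewrite in_setD => /andP[zF]; rewrite in_set => /andP[zW pz].
  rewrite !in_setU; case zH: (z \in H) => //=; case zC: (z \in C) => //=.
  rewrite in_set zC /=; apply: contra zF => zb.
  by rewrite in_set pz andbT hI ?zC // in_set zW zH.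
- apply: leq_trans cHC; apply: subset_leq_card; apply/subsetP => z.
  rewrite in_setD => /andP[zW]; rewrite in_set => /andP[pz].
  rewrite !in_setU; case zH: (z \in H) => //=; case zC: (z \in C) => //=.
  move=> h; rewrite /Sm in_set zC /=; apply: contra h => zb; rewrite zb /=.
  have := hI z (negbT zC) zb; rewrite [z \in inner Rt]in_set zC zb /= => ->.
  by rewrite in_set (negPf zW) zH.
Qed.

End Components.

Lemma sum_subsets_split (M : nmodType) (V : finType) (S : {set V}) (u : V) (f : {set V} -> M) :
  u \in S ->
  \sum_(A : {set V} | A \subset S) f A
  = \sum_(A : {set V} | A \subset S :\ u) (f (u |: A) + f A).
Proof.
move=> uS; rewrite big_split /= (bigID (fun A : {set V} => u \in A)) /=; congr (_ + _).
  rewrite (reindex_onto (fun A => u |: A) (fun A => A :\ u)) /=.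
    apply: eq_bigl => A; rewrite setU11 andbT subUset sub1set uS /=.
    apply/andP/idP => [[AS /eqP e]|AS].
      rewrite subsetD1 AS -e; apply/negP; rewrite !inE eqxx //.
    split; first by apply: subset_trans AS (subsetDl _ _).
    rewrite setU1K // ; move: AS; rewrite subsetD1 => /andP[_ //].
  by move=> A /andP[_ uA]; rewrite setD1K.
apply: eq_bigl => A; rewrite subsetD1; by [].
Qed.

(** * Weight of the sets in one container *)

Section Reveal.
Variables (R : realFieldType) (V : finType) (N : V -> {set V}) (lambda : R).
Hypothesis lambda_gt0 : 0 < lambda.
Implicit Types (S A U : {set V}) (u : V).

Definition nbhd A := \bigcup_(u in A) N u.
Definition uncovered S U A := #|[set u in S | ~~ (N u \subset U :|: nbhd A)]|.
Definition fresh U A := #|nbhd A :\: U|.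

Definition occ := lambda / (1 + lambda).
Definition vac := (1 + lambda)^-1.
(** Hard-core partition function of an edge divided by that of two isolated vertices. *)
Definition gain := (1 + 2 * lambda) / (1 + lambda) ^+ 2.

Lemma lambda1_gt0 : 0 < 1 + lambda. Proof. by rewrite ltr_wpDl. Qed.

Lemma vac_gt0 : 0 < vac. Proof. by rewrite invr_gt0 lambda1_gt0. Qed.
Lemma occ_gt0 : 0 < occ. Proof. by rewrite divr_gt0 // lambda1_gt0. Qed.
Lemma gain_gt0 : 0 < gain.
Proof. by rewrite divr_gt0 ?exprn_gt0 ?lambda1_gt0 // ltr_wpDl // mulr_gt0. Qed.

Lemma gainE : gain = occ * vac + vac.
Proof. by rewrite /gain /occ /vac; field; rewrite gt_eqF ?lambda1_gt0. Qed.

Lemma vac_le_gain : vac <= gain.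
Proof. by rewrite gainE lerDr mulr_ge0 // ltW // ?occ_gt0 ?vac_gt0. Qed.

Lemma occ_vac : occ + vac = 1.
Proof. by rewrite /gain /occ /vac; field; rewrite gt_eqF ?lambda1_gt0. Qed.

Lemma gain_le1 : gain <= 1.
Proof.
rewrite gainE -occ_vac lerD2r ger_pMr ?occ_gt0 // -occ_vac lerDr ltW //; exact: occ_gt0.
Qed.

(* Revealing the membership of [u] one vertex at a time, only while [u] still has a
   neighbour outside the covered set [U]: a success costs [vac / gain] at least once,
   a failure costs [1 / gain], and [occ * vac + vac = gain]. *)
Lemma reveal_bound S U :
  \sum_(A : {set V} | A \subset S)
     occ ^+ #|A| * vac ^+ #|S :\: A| * (vac / gain) ^+ fresh U A * gain^-1 ^+ uncovered S U A
  <= 1.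
Proof.
have gi : 0 < gain^-1 by rewrite invr_gt0 gain_gt0.
have vg : 0 < vac / gain by rewrite divr_gt0 ?vac_gt0 ?gain_gt0.
have vg1 : vac / gain <= 1 by rewrite ler_pdivrMr ?gain_gt0 // mul1r vac_le_gain.
have gi1 : 1 <= gain^-1 by rewrite invf_ge1 ?gain_gt0 ?gain_le1.
have plain (T : {set V}) : \sum_(A : {set V} | A \subset T) occ ^+ #|A| * vac ^+ #|T :\: A| = 1.
  have [m] := ubnP #|T|; elim: m T => // m IH T; rewrite ltnS => Tm.
  have [->|/set0Pn[u uT]] := eqVneq T set0.
    rewrite (big_pred1 set0) => [|A]; last by rewrite subset0.
    by rewrite setD0 cards0 !expr0 mulr1.
  rewrite (sum_subsets_split _ uT) -[RHS](IH (T :\ u)); last first.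
    by rewrite (cardsD1 u) uT in Tm.
  apply: eq_bigr => A; rewrite subsetD1 => /andP[AT uA].
  rewrite cardsU1 uA add1n exprS.
  have -> : T :\: (u |: A) = (T :\ u) :\: A by rewrite setDDl.
  have -> : #|T :\: A| = #|(T :\ u) :\: A|.+1.
    by rewrite (cardsD1 u) inE uA uT /= add1n !setDDl setUC.
  rewrite exprS; set a := occ ^+ _; set b := vac ^+ _.
  by transitivity ((occ + vac) * (a * b)); [ring | rewrite occ_vac mul1r].
have [m] := ubnP #|S|; elim: m S U => // m IH S U; rewrite ltnS => Sm.
have [h|] := boolP [forall u in S, N u \subset U].
  rewrite -[leRHS](plain S); apply: ler_sum => A AS.
  have nA : nbhd A \subset U.
    by apply/bigcupsP => u uA; apply: (forall_inP h); apply: (subsetP AS).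
  have -> : fresh U A = 0%N by apply/eqP; rewrite cards_eq0 setD_eq0.
  have -> : uncovered S U A = 0%N.
    apply/eqP; rewrite cards_eq0 -subset0; apply/subsetP => u; rewrite !inE => /andP[uS].
    by rewrite (subset_trans (forall_inP h u uS)) // subsetUl.
  by rewrite !expr0 !mulr1.
rewrite negb_forall_in => /exists_inP[u uS uN].
rewrite (sum_subsets_split _ uS) big_split /=.
have Sm' : (#|S :\ u| < m)%N by rewrite (cardsD1 u) uS in Sm.
have j0 : (0 < #|N u :\: U|)%N.
  by rewrite card_gt0; apply: contraNneq uN => /eqP; rewrite setD_eq0.
have nbU A : nbhd (u |: A) = N u :|: nbhd A by rewrite /nbhd bigcup_setU big_set1.
have one : \sum_(A : {set V} | A \subset S :\ u)
   occ ^+ #|u |: A| * vac ^+ #|S :\: (u |: A)| * (vac / gain) ^+ fresh U (u |: A)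
     * gain^-1 ^+ uncovered S U (u |: A) <= occ * (vac / gain).
  rewrite -[leRHS]mulr1; have := IH (S :\ u) (U :|: N u) Sm'.
  rewrite -(ler_pM2l (_ : 0 < occ * (vac / gain))); last by rewrite mulr_gt0 ?occ_gt0.
  apply: le_trans; rewrite mulr_sumr; apply: ler_sum => A; rewrite subsetD1 => /andP[AS uA].
  rewrite cardsU1 uA add1n exprS.
  have -> : S :\: (u |: A) = (S :\ u) :\: A by rewrite setDDl.
  have e1 : fresh U (u |: A) = (#|N u :\: U| + fresh (U :|: N u) A)%N.
    rewrite /fresh nbU -(cardsID (N u) ((N u :|: nbhd A) :\: U)); congr (_ + _)%N.
      by apply: eq_card => z; rewrite !inE; case: (z \in N u); rewrite ?andbF ?andbT.
    by apply: eq_card => z; rewrite !inE; case: (z \in N u); case: (z \in U).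
  have e2 : uncovered S U (u |: A) = uncovered (S :\ u) (U :|: N u) A.
    apply: eq_card => z; rewrite !inE nbU setUA; case: eqP => [->|] //=.
    by rewrite uS -setUA (subset_trans (subsetUl _ (nbhd A))) // subsetUr.
  rewrite e1 e2 exprD.
  set a := occ ^+ _; set b := vac ^+ _; set q := (vac / gain) ^+ #|_|.
  set f := (vac / gain) ^+ _; set w := gain^-1 ^+ _.
  have -> : occ * a * b * (q * f) * w = q * (occ * (a * b * f * w)) by ring.
  have -> : occ * (vac / gain) * (a * b * f * w) = (vac / gain) * (occ * (a * b * f * w)).
    by rewrite mulrAC mulrC.
  apply: ler_wpM2r.
    by rewrite !mulr_ge0 // ?exprn_ge0 // ltW // ?occ_gt0 ?vac_gt0.
  rewrite /q.
  move: j0; case: #|_| => // j _; rewrite exprS ger_pMr //.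
  by apply: exprn_ile1 => //; exact: ltW.
have two : \sum_(A : {set V} | A \subset S :\ u)
   occ ^+ #|A| * vac ^+ #|S :\: A| * (vac / gain) ^+ fresh U A * gain^-1 ^+ uncovered S U A
   <= vac * gain^-1.
  rewrite -[leRHS]mulr1; have := IH (S :\ u) U Sm'.
  rewrite -(ler_pM2l (_ : 0 < vac * gain^-1)); last by rewrite mulr_gt0 ?vac_gt0.
  apply: le_trans; rewrite mulr_sumr; apply: ler_sum => A; rewrite subsetD1 => /andP[AS uA].
  have -> : #|S :\: A| = #|(S :\ u) :\: A|.+1.
    by rewrite (cardsD1 u) inE uA uS /= add1n !setDDl setUC.
  have e : (uncovered S U A <= (uncovered (S :\ u) U A).+1)%N.
    rewrite /uncovered (cardsD1 u) -[leqRHS]add1n leq_add //; first by case: (_ \in _).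
    by apply: subset_leq_card; apply/subsetP => z; rewrite !inE => /andP[-> /andP[-> ->]].
  apply: (@le_trans _ _ (occ ^+ #|A| * vac ^+ #|(S :\ u) :\: A|.+1 * (vac / gain) ^+ fresh U A
     * gain^-1 ^+ (uncovered (S :\ u) U A).+1)).
    apply: ler_wpM2l; last exact: ler_weXn2l.
    by rewrite !mulr_ge0 // exprn_ge0 // ltW // ?occ_gt0 ?vac_gt0.
  by rewrite !exprS le_eqVlt; apply/orP; left; apply/eqP; ring.
apply: le_trans (lerD one two) _.
by rewrite mulrA -mulrDl -gainE divff // gt_eqF ?gain_gt0.
Qed.

(** Termwise comparison with [reveal_bound] started from the covered set [F]. For an admissible [A]
    there are exactly [#|nbhd A| - #|F|] fresh vertices, and at most [#|nbhd A| - g] vertices of [S]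
    are covered; the remaining ones and the fresh ones together supply the power [g] of [gain]. *)
Lemma reveal_sum (S F : {set V}) (P : pred {set V}) (g delta : nat) :
  (#|S| <= #|F| + delta)%N ->
  (forall A, P A -> [/\ A \subset S, F \subset nbhd A &
     (g + #|[set u | N u \subset nbhd A]| <= #|nbhd A|)%N]) ->
  \sum_(A : {set V} | P A) lambda ^+ #|A| * vac ^+ #|nbhd A|
  <= (1 + lambda) ^+ delta * gain ^+ g.
Proof.
move=> SF hP; have l0 := lambda1_gt0; have v0 := vac_gt0; have g0 := gain_gt0.
have v1 : vac <= 1 by rewrite -occ_vac lerDr ltW // occ_gt0.
pose T A := occ ^+ #|A| * vac ^+ #|S :\: A| * (vac / gain) ^+ fresh F A
  * gain^-1 ^+ uncovered S F A.
have T0 A : 0 <= T A.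
  have o0 := occ_gt0; have vg := divr_gt0 v0 g0.
  have gi : 0 < gain^-1 by rewrite invr_gt0.
  by rewrite /T; apply: mulr_ge0; [apply: mulr_ge0; [apply: mulr_ge0|]|];
    apply: exprn_ge0; apply: ltW.
pose c := (1 + lambda) ^+ delta * gain ^+ g.
have c0 : 0 <= c by rewrite mulr_ge0 // exprn_ge0 // ltW.
apply: (@le_trans _ _ (\sum_(A : {set V} | P A) c * T A)); last first.
  rewrite -mulr_sumr -[leRHS]mulr1 ler_wpM2l //.
  apply: le_trans (reveal_bound S F); rewrite [leRHS](bigID P) /= -[leLHS]addr0 lerD //.
    rewrite le_eqVlt; apply/orP; left; apply/eqP; apply: eq_bigl => A.
    by case PA: (P A); rewrite ?andbF // andbT; have [-> _ _] := hP A PA.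
  by apply: sumr_ge0 => A _; exact: T0.
apply: ler_sum => A PA; have [AS FA hg] := hP A PA.
have e1 : fresh F A = (#|nbhd A| - #|F|)%N by rewrite /fresh cardsD (setIidPr FA).
have e1' := subset_leq_card FA.
have e2 : (#|S| <= uncovered S F A + #|[set u | N u \subset nbhd A]|)%N.
  rewrite -(cardsID [set u | N u \subset nbhd A] S) addnC leq_add //; apply: subset_leq_card.
    by apply/subsetP => u; rewrite !inE (setUidPr FA) andbC.
  by apply/subsetP => u; rewrite !inE => /andP[].
have e3 : #|S :\: A| = (#|S| - #|A|)%N by rewrite cardsD (setIidPr AS).
have e3' := subset_leq_card AS.
have vE : vac = (1 + lambda)^-1 by [].
have oE : occ = lambda * vac by [].
have TE : T A = lambda ^+ #|A| * vac ^+ (#|S| + #|nbhd A| - #|F|)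
    * gain^-1 ^+ (fresh F A + uncovered S F A).
  rewrite /T oE exprMn expr_div_n -[gain^-1 ^+ (_ + _)]/(_) exprD -!exprVn e3.
  have -> : (#|S| + #|nbhd A| - #|F|)%N = (#|A| + (#|S| - #|A|) + fresh F A)%N by lia.
  by rewrite !exprD; ring.
rewrite TE -[_ * _ * gain^-1 ^+ _]mulrA mulrCA.
apply: ler_wpM2l; first by rewrite exprn_ge0 // ltW.
rewrite /c.
have hexp : (g + #|S| <= #|F| + (fresh F A + uncovered S F A))%N by lia.
move: hexp; set k := (fresh F A + uncovered S F A)%N => hexp.
(* The exponents need not match exactly; every surplus is harmless because
   [gain <= 1 <= (1 + lambda) * gain]. *)
have key : 1 <= (1 + lambda) ^+ delta * gain ^+ g * (1 + lambda) ^+ #|F| * vac ^+ #|S| * gain^-1 ^+ k.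
  have [h|h] := leqP #|F| #|S|.
    have [a ha] : exists a, #|S| = (#|F| + a)%N by exists (#|S| - #|F|)%N; lia.
    have [b hb] : exists b, k = (g + a + b)%N by exists (k - (g + a))%N; lia.
    have [b' hb'] : exists b', delta = (a + b')%N by exists (delta - a)%N; lia.
    rewrite ha hb hb' !exprD vE !exprVn.
    have -> : (1 + lambda) ^+ a * (1 + lambda) ^+ b' * gain ^+ g * (1 + lambda) ^+ #|F| *
       ((1 + lambda) ^- #|F| * (1 + lambda) ^- a) * (gain ^- g * gain ^- a * gain ^- b)
       = (1 + lambda) ^+ b' * (gain ^- a * gain ^- b).
      by field; rewrite !expf_neq0 ?gt_eqF.
    rewrite -!exprVn; apply: mulr_ege1; first by apply: exprn_ege1; rewrite lerDl ltW.
    by rewrite -exprD; apply: exprn_ege1; rewrite invf_ge1 // gain_le1.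
  have [a ha] : exists a, #|F| = (#|S| + a)%N by exists (#|F| - #|S|)%N; lia.
  have lg : 1 <= (1 + lambda) * gain.
    by rewrite mulrC -ler_pdivrMr // mul1r vac_le_gain.
  have -> : (1 + lambda) ^+ delta * gain ^+ g * (1 + lambda) ^+ #|F| * vac ^+ #|S| * gain^-1 ^+ k
    = (1 + lambda) ^+ delta * (gain ^+ g * (1 + lambda) ^+ a * gain^-1 ^+ k).
    by rewrite ha exprD vE !exprVn; field; rewrite !expf_neq0 ?gt_eqF.
  apply: mulr_ege1; first by apply: exprn_ege1; rewrite lerDl ltW.
  have [ga|ga] := leqP a g.
    have [b hb] : exists b, g = (a + b)%N by exists (g - a)%N; lia.
    have [b' hb'] : exists b', k = (b + b')%N by exists (k - b)%N; lia.
    rewrite hb hb' !exprD !exprVn.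
    have -> : gain ^+ a * gain ^+ b * (1 + lambda) ^+ a * (gain ^- b * gain ^- b')
       = ((1 + lambda) * gain) ^+ a * gain ^- b'.
      by rewrite [((1 + lambda) * gain) ^+ a]exprMn; field; rewrite !expf_neq0 ?gt_eqF.
    apply: mulr_ege1; first exact: exprn_ege1.
    by rewrite -exprVn; apply: exprn_ege1; rewrite invf_ge1 // gain_le1.
  apply: mulr_ege1; last by apply: exprn_ege1; rewrite invf_ge1 // gain_le1.
  have [b hb] : exists b, a = (g + b)%N by exists (a - g)%N; lia.
  rewrite hb exprD mulrA -exprMn; apply: mulr_ege1; apply: exprn_ege1; first by rewrite mulrC.
  by rewrite lerDl ltW.
have -> : (1 + lambda) ^+ delta * gain ^+ g * (vac ^+ (#|S| + #|nbhd A| - #|F|) * gain^-1 ^+ k)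
  = vac ^+ #|nbhd A| * ((1 + lambda) ^+ delta * gain ^+ g * (1 + lambda) ^+ #|F|
     * vac ^+ #|S| * gain^-1 ^+ k).
  have -> : (#|S| + #|nbhd A| - #|F|)%N = (#|S| + (#|nbhd A| - #|F|))%N by lia.
  have eF : vac ^+ #|F| * (1 + lambda) ^+ #|F| = 1.
    by rewrite -exprMn vE mulVf ?expr1n // gt_eqF.
  have eN : vac ^+ #|nbhd A| = vac ^+ (#|nbhd A| - #|F|) * vac ^+ #|F|.
    by rewrite -exprD subnK.
  rewrite eN exprD.
  transitivity ((1 + lambda) ^+ delta * gain ^+ g * (vac ^+ #|S|
     * vac ^+ (#|nbhd A| - #|F|) * gain^-1 ^+ k) * (vac ^+ #|F| * (1 + lambda) ^+ #|F|)).
    by rewrite eF mulr1.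
  ring.
by rewrite ler_peMr // exprn_ge0 // ltW.
Qed.

End Reveal.

Lemma sum_subsets_pow (R : comPzRingType) (V : finType) (S : {set V}) (y : R) :
  \sum_(A : {set V} | A \subset S) y ^+ #|A| = (1 + y) ^+ #|S|.
Proof.
have [m] := ubnP #|S|; elim: m S => // m IH S; rewrite ltnS => Sm.
have [->|/set0Pn[u uS]] := eqVneq S set0.
  by rewrite (big_pred1 set0) => [|A]; rewrite ?subset0 // cards0.
rewrite (sum_subsets_split _ uS).
have Su : #|S| = #|S :\ u|.+1 by rewrite (cardsD1 u) uS.
rewrite Su exprSr -IH; last by rewrite -Su in Sm *.
rewrite mulr_suml; apply: eq_bigr => A; rewrite subsetD1 => /andP[AS uA].
by rewrite cardsU1 uA add1n exprS mulrDr mulr1 mulrC addrC.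
Qed.

Lemma card_small_sets (R : realFieldType) (V : finType) (m : nat) (y : R) :
  0 < y -> y <= 1 ->
  #|[set Y : {set V} | (#|Y| <= m)%N]|%:R <= y ^- m * (1 + y) ^+ #|V|.
Proof.
move=> y0 y1; rewrite -cardsT -(sum_subsets_pow [set: V] y) mulr_sumr.
rewrite -sum1_card natr_sum big_mkcond [leRHS]big_mkcond /=; apply: ler_sum => Y _.
rewrite inE subsetT; case: ifP => [Ym|_]; last by rewrite mulr_ge0 ?invr_ge0 ?exprn_ge0 // ltW.
rewrite mulrC ler_pdivlMr ?exprn_gt0 // mul1r.
by apply: ler_wiXn2l => //; exact: ltW.
Qed.

(** * Containers for even sets of given gap *)

Section Containers.
Variables (R : rcfType) (d : nat).
Local Notation V := {ffun 'I_d -> bool}.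
Implicit Types (x y z u v w : V) (i j : 'I_d) (A K C F T : {set V}).
Hypothesis d_ge4 : (4 <= d)%N.

Definition evens : {set V} := [set u | ~~ par u].
Definition nbrs u : {set V} := [set flip u i | i : 'I_d].
Definition closure A := [set u | nbrs u \subset nb A].
Definition gap A := (#|nb A| - #|closure A|)%N.
(** The odd-bounded set attached to [A]. Its boundary has [d * gap A] edges ([sum_bdeg_hull]), so
    the gap plays the part of a perimeter. *)
Definition hull A := closure A :|: nb A.

Lemma nbhd_nbrs A : nbhd nbrs A = nb A.
Proof.
apply/setP => y; apply/bigcupP/nbP => [[u uA /imsetP[i _ ->]]|[i hi]].
  by exists i; rewrite flipK.
by exists (flip y i) => //; apply/imsetP; exists i; rewrite // flipK.
Qed.

Lemma closureP A u : reflect (forall i, flip u i \in nb A) (u \in closure A).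
Proof.
rewrite inE; apply: (iffP subsetP) => [h i|h y /imsetP[i _ ->]]; last exact: h.
by apply: h; apply/imsetP; exists i.
Qed.

Lemma nb_even A : A \subset evens -> forall v, v \in nb A -> par v.
Proof.
by move=> Ae v /nbP[i /(subsetP Ae)]; rewrite inE par_flip negbK.
Qed.

Lemma closure_even A : A \subset evens -> forall u, u \in closure A -> ~~ par u.
Proof.
move=> Ae u /closureP h; have i : 'I_d by apply: (@Ordinal _ 0); lia.
by have := nb_even Ae (h i); rewrite par_flip.
Qed.

Lemma sub_closure A : A \subset closure A.
Proof.
by apply/subsetP => u uA; apply/closureP => i; apply/nbP; exists i; rewrite flipK.
Qed.

Section Hull.
Variable A : {set V}.
Hypothesis A_even : A \subset evens.

Lemma hull_odd : [set v in hull A | par v] = nb A.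
Proof.
apply/setP => v; rewrite !in_set; apply/andP/idP => [[/orP[|//]]|h].
  by move=> h pv; have := closure_even A_even (u := v); rewrite inE h pv => /(_ isT).
by rewrite h orbT; split=> //; apply: (nb_even A_even); rewrite inE.
Qed.

Lemma hull_even : [set v in hull A | ~~ par v] = closure A.
Proof.
apply/setP => v; rewrite [LHS]in_set in_setU; apply/andP/idP => [[/orP[//|]]|h].
  by move=> /(nb_even A_even) ->.
by rewrite h; split=> //; apply: (closure_even A_even).
Qed.

Lemma hull_odd_bounded : odd_bounded (hull A).
Proof.
move=> u i pu; rewrite in_setU => /orP[/closureP h|/(nb_even A_even)]; last by rewrite (negPf pu).
by rewrite in_setU h orbT.
Qed.

Lemma closure_le : (#|closure A| <= #|nb A|)%N.
Proof.
have := sum_bdeg_in hull_odd_bounded; rewrite hull_odd hull_even => h.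
by rewrite -(@leq_pmul2r d); [rewrite -h leq_addl | lia].
Qed.

Lemma sum_bdeg_hull : (\sum_(x in hull A) bdeg (hull A) x = d * gap A)%N.
Proof.
have := sum_bdeg_in hull_odd_bounded; rewrite hull_odd hull_even => h.
by rewrite /gap mulnBr ![(d * _)%N]mulnC -h addnK.
Qed.

End Hull.

(** In this order: the greedy picks, the vertices they fail to cover, the roots of the big
    components inside, and the pairs [G1], [G2] of the two refinements. *)
Definition code := {ffun 'I_7 -> {set V}}.
Definition decode (psi : nat) (c : code) :=
  stage psi (c (inord 5)) (c (inord 6))
    (stage d./2 (c (inord 3)) (c (inord 4))
       (rough (nb (c (inord 0)) :|: c (inord 1)) (c (inord 2)))).

Variables (s t y m psi g : nat).
Hypotheses (s_gt0 : (0 < s)%N) (s_small : (8 * s <= d)%N) (g_gt0 : (0 < g)%N).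
Hypothesis t_large : 4 * d%:R * g%:R / s%:R * (1 - s%:R / (4 * g%:R)) ^+ t <= y%:R :> R.
Hypotheses (m_rough : (1 + 64 * (t + y) <= m)%N)
  (m_half : (4 * g + 3 * (d * t + y) <= m * d./2)%N) (m_psi : (2 * g <= m * psi)%N).
Hypotheses (psi_gt0 : (0 < psi)%N) (psi_small : (psi <= d./2)%N).

(** Two rounds are needed. The rough error may be of order [d * t], affordable only with the coarse
    threshold [d./2]; that round brings both errors below [2 * g], and the second, with the small
    [psi], makes the two sizes differ by at most [4 * psi * g / d]. *)
Lemma container_code (W : {set V}) : odd_bounded W -> (\sum_(x in W) bdeg W x = d * g)%N ->
  exists c : code, [/\ forall i : 'I_7, (#|c i| <= m)%N, approximates W (decode psi c)
    & (#|(decode psi c).2| * d <= #|(decode psi c).1| * d + 4 * (psi * g))%N].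
Proof.
move=> W_odd Wg; have d0 : (0 < d)%N by lia.
have Wg' : (\sum_(x in ~: W) bdeg W x = d * g)%N by rewrite sum_bdeg_out.
have Wall : (\sum_x bdeg W x = 2 * (d * g))%N.
  rewrite (bigID (mem W)) /= Wg [X in (_ + X)%N](eq_bigl (mem (~: W))) ?Wg'; first lia.
  by move=> x; rewrite /= in_setC.
pose Y := [set z | (s * d <= 2 * nbr_bdeg W z)%N].
have cY : (#|Y| * s <= 4 * (d * g))%N.
  rewrite -(leq_pmul2r d0).
  have : (\sum_(z in Y) s * d <= \sum_(z in Y) 2 * nbr_bdeg W z)%N.
    by apply: leq_sum => z; rewrite inE.
  rewrite sum_nat_const -big_distrr /= => h.
  have : (\sum_(z in Y) nbr_bdeg W z <= \sum_z nbr_bdeg W z)%N.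
    rewrite [leqRHS](bigID (mem Y)) /=; exact: leq_addr.
  have -> : (\sum_z nbr_bdeg W z = 2 * (d * g) * d)%N.
    rewrite /nbr_bdeg; have := @sum_nbrs d nat (bdeg W); rewrite /= => e.
    transitivity (\sum_x bdeg W x *+ d)%R; first exact: e.
    rewrite -Wall big_distrl /=; apply: eq_bigr => x _.
    by rewrite -mulr_natr natn.
  move: (\sum_(z in Y) nbr_bdeg W z)%N h => q; nia.
have dR : 0 < d%:R :> R by rewrite ltr0n.
have gR : 0 < g%:R :> R by rewrite ltr0n.
have sR : 0 < s%:R :> R by rewrite ltr0n.
pose e : rel V := fun p q => [exists i, q == flip p i].
have [|||||T [Tt TU]] := @greedy_cover R _ e (fun z => (bdeg W z)%:R) Y
    (s%:R * d%:R / 2) (2 * (d%:R * g%:R)) _ _ _ _ _ t.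
- by rewrite divr_gt0 // mulr_gt0.
- by rewrite mulr_gt0 // mulr_gt0.
- by move=> z; exact: ler0n.
- by rewrite -natr_sum Wall !natrM.
- move=> z; rewrite inE => hz.
  have -> : \sum_(q | e z q) (bdeg W q)%:R = (nbr_bdeg W z)%:R :> R.
    rewrite -natr_sum; congr (_%:R); rewrite /nbr_bdeg.
    rewrite -(big_imset (bdeg W) (h := flip z) (A := predT)) /=; last first.
      by move=> i j _ _; exact: flip_injr.
    apply: eq_bigl => q; apply/existsP/imsetP => [[i /eqP ->]|[i _ ->]]; by exists i.
  by rewrite ler_pdivrMr // -!natrM ler_nat mulnC [leqRHS]mulnC mulnC.
set U := [set q in Y | _] in TU.
have Uy : (#|U| <= y)%N.
  have [b0|b0] := leP 0 (1 - s%:R / (4 * g%:R) : R).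
    rewrite -(ler_nat R); apply: le_trans TU _; apply: le_trans t_large.
    have -> : s%:R * d%:R / 2 / (2 * (d%:R * g%:R)) = s%:R / (4 * g%:R) :> R.
      by field; rewrite !gt_eqF.
    apply: ler_wpM2r; first exact: exprn_ge0.
    by rewrite ler_pdivlMr // -!natrM ler_nat -mulnA.
  (* If [1 - s / (4 * g)] is negative, the total boundary is too small for any vertex to qualify. *)
  have Y0 : #|Y| = 0%N.
    apply/eqP; apply: contraT; rewrite -lt0n => /card_gt0P[z]; rewrite inE => hz.
    have : (2 * nbr_bdeg W z <= 2 * (2 * (d * g)))%N.
      rewrite leq_mul2l /= -Wall.
      rewrite /nbr_bdeg -(big_imset (bdeg W) (h := flip z) (A := predT)) /=; last first.
        by move=> i j _ _; exact: flip_injr.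
      rewrite [leqRHS](bigID (mem [set flip z i | i : 'I_d])) /=.
      by apply: leq_trans (leq_addr _ _); rewrite leq_eqVlt; apply/orP; left; apply/eqP/eq_bigl.
    move: b0; rewrite subr_lt0 ltr_pdivlMr ?mulr_gt0 // mul1r -natrM ltr_nat.
    nia.
  apply: (@leq_trans #|Y|); last by rewrite Y0.
  by apply: subset_leq_card; apply/subsetP => z; rewrite inE => /andP[].
pose C := nb T :|: U.
have Cc : (#|C| <= d * t + y)%N.
  apply: leq_trans (leq_card_setU _ _) _; apply: leq_add => //.
  by apply: leq_trans (card_nb _) _; rewrite mulnC leq_mul2l Tt orbT.
have YC z : z \in Y -> z \in C.
  move=> zY; rewrite in_setU orbC in_set zY /= -implyNb; apply/implyP.
  rewrite negb_forall_in => /exists_inP[q qT]; rewrite negbK => /existsP[i /eqP hq].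
  by apply/nbP; exists i; rewrite -hq.
have [||Rt [cRt aR mR eR]] := @roughP d R C W (heavy W s) d_ge4 W_odd.
- by move=> z; apply: heavy_in.
- move=> z i W' hz; have := cover W_odd s_small s_gt0 hz.
  by case/orP => h; apply/orP; [left|right]; apply: YC; rewrite inE.
have hH := card_heavy s_small s_gt0 Wall.
have [G1 [G2 [cG1 cG2 a1 s1]]] := stageP W_odd d./2 aR.
set p1 := stage _ _ _ _ in a1 s1.
have h2 : (d <= 2 * (d - d./2))%N by lia.
have e1 : (excess W p1 <= 2 * g)%N.
  have := saturated_excess a1 s1; rewrite Wg'; nia.
have e2 : (missing W p1 <= 2 * g)%N.
  have := saturated_missing a1 s1; rewrite Wg; nia.
have [G3 [G4 [cG3 cG4 a2 s2]]] := stageP W_odd psi a1.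
set p2 := stage _ _ _ _ in a2 s2.
have e3 : (excess W p2 <= 2 * g)%N.
  have := saturated_excess a2 s2; rewrite Wg'; nia.
have e4 : (missing W p2 <= 2 * g)%N.
  have := saturated_missing a2 s2; rewrite Wg; nia.
pose c : code := [ffun i : 'I_7 => nth set0 [:: T; U; Rt; G1; G2; G3; G4] i].
have cE k : (k < 7)%N -> c (inord k) = nth set0 [:: T; U; Rt; G1; G2; G3; G4] k.
  by move=> k7; rewrite ffunE inordK.
have dE : decode psi c = p2 by rewrite /decode !cE.
exists c; rewrite dE; clear dE cE; move: @c; clearbody p2; clearbody p1 => c.
split; [|exact: a2|].
- have b1 : (#|T| <= m)%N by lia.
  have b2 : (#|U| <= m)%N by lia.
  have b3 : (#|Rt| <= m)%N.
    rewrite -(leq_pmul2r d0); apply: leq_trans cRt _.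
    have h3 : ((1 + 64 * (t + y)) * d <= m * d)%N by rewrite leq_mul2r m_rough orbT.
    have h4 : (y <= y * d)%N by rewrite leq_pmulr.
    move: Cc h3 h4; move: #|C| (m * d)%N => k q; rewrite mulnDl mul1n -mulnA mulnDl.
    rewrite (mulnC t); move: (d * t)%N (y * d)%N => td yd; lia.
  have half0 : (0 < d./2)%N by lia.
  have hC : (#|heavy W s| + 3 * #|C| <= m * d./2)%N.
    by apply: leq_trans m_half; apply: leq_add => //; rewrite leq_mul2l.
  have b4 : (#|G1| <= m)%N.
    by rewrite -(leq_pmul2r half0) (leq_trans cG1) // (leq_trans mR).
  have b5 : (#|G2| <= m)%N.
    by rewrite -(leq_pmul2r half0) (leq_trans cG2) // (leq_trans eR).
  have b6 : (#|G3| <= m)%N.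
    by rewrite -(leq_pmul2r psi_gt0) (leq_trans cG3) // (leq_trans e2).
  have b7 : (#|G4| <= m)%N.
    by rewrite -(leq_pmul2r psi_gt0) (leq_trans cG4) // (leq_trans e1).
  have hs : all (fun K : {set V} => (#|K| <= m)%N) [:: T; U; Rt; G1; G2; G3; G4].
    by rewrite /= b1 b2 b3 b4 b5 b6 b7.
  by move=> i; rewrite ffunE; apply: (allP hs); rewrite mem_nth.
- apply: leq_trans (saturated_gap W_odd a2 s2) _; rewrite leq_add2l.
  have : (psi * (excess W p2 + missing W p2) <= psi * (4 * g))%N by rewrite leq_mul2l; lia.
  by rewrite mulnCA.
Qed.

Variable lambda : R.
Hypothesis lambda_gt0 : 0 < lambda.

Definition even_weight A : R := lambda ^+ #|A| * (1 + lambda) ^- #|nb A|.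

(** Union over the codes, then [reveal_sum] in the container of each code. *)
Lemma container_sum :
  \sum_(A : {set V} | (A \subset evens) && (gap A == g)) even_weight A
  <= #|[set Y : {set V} | (#|Y| <= m)%N]|%:R ^+ 7
     * ((1 + lambda) ^+ (4 * (psi * g) %/ d) * gain lambda ^+ g).
Proof.
have d0 : (0 < d)%N by lia.
have l0 := lambda1_gt0 lambda_gt0.
have w0 A : 0 <= even_weight A.
  by rewrite mulr_ge0 ?invr_ge0 // exprn_ge0 // ltW.
pose ok (c : code) A := [&& A \subset evens, gap A == g,
  (decode psi c).1 \subset nb A, A \subset (decode psi c).2 &
  (#|(decode psi c).2| * d <= #|(decode psi c).1| * d + 4 * (psi * g))%N].
set Y := [set Y : {set V} | _].
pose D : {set code} := [set c in ffun_on (mem Y)].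
apply: (@le_trans _ _ (\sum_(c in D) \sum_(A : {set V} | ok c A) even_weight A)).
  rewrite (exchange_big_dep (fun A => (A \subset evens) && (gap A == g))) /=; last first.
    by move=> c A _ /and5P[-> ->].
  apply: ler_sum => A /andP[Ae /eqP Ag].
  have Wg := sum_bdeg_hull Ae; rewrite Ag in Wg.
  have [c [cm [c1 c2 _] c4]] := container_code (hull_odd_bounded Ae) Wg.
  rewrite hull_odd // in c1; rewrite hull_even // in c2.
  rewrite (bigD1 c) /=; first by rewrite lerDl; apply: sumr_ge0 => *; exact: w0.
  rewrite inE; apply/andP; split; first by apply/ffun_onP => i; rewrite inE; exact: cm.
  by rewrite /ok Ae Ag eqxx c1 c4 (subset_trans (sub_closure A) c2).
have cD : #|D| = (#|Y| ^ 7)%N.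
  by rewrite cardsE card_ffun_on card_ord; congr (_ ^ _)%N; apply: eq_card.
rewrite -natrX -cD mulr_natl -sumr_const; apply: ler_sum => c _.
have [/existsP[A0 /and5P[_ _ _ _ h]]|/existsPn none] := boolP [exists A, ok c A]; last first.
  rewrite big_pred0 => [|A]; last exact/negbTE/none.
  by rewrite mulr_ge0 // exprn_ge0 // ltW // gain_gt0.
apply: (le_trans _ (@reveal_sum R _ nbrs lambda lambda_gt0 (decode psi c).2 (decode psi c).1
   (ok c) g _ _ _)) => [||A /and5P[Ae /eqP Ag c1 c2 _]].
- by apply: ler_sum => A _; rewrite /even_weight nbhd_nbrs /vac exprVn.
- by rewrite -leq_subLR leq_divRL // mulnBl leq_subLR.
- rewrite nbhd_nbrs; split=> //.
  by rewrite -[X in (_ + X <= _)%N]/(#|closure A|) -Ag /gap subnK // closure_le.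
Qed.

End Containers.

Lemma nat_ceil (R : realType) (x : R) : 0 <= x -> exists k : nat, x <= k%:R /\ k%:R <= x + 1.
Proof.
move=> x0; exists (Num.truncn x).+1.
have /andP[h1 h2] := Num.Theory.truncn_itv x0.
by split; [exact: ltW | rewrite -natr1 lerD2r].
Qed.

Lemma gain_expR (R : realType) (lambda : R) (k : nat) : 0 < lambda ->
  gain lambda ^+ k <= expR (- (Num.min 1 (lambda ^+ 2) / 4 * k%:R)).
Proof.
move=> l0; have l1 : 0 < 1 + lambda by rewrite ltr_wpDl.
have -> : - (Num.min 1 (lambda ^+ 2) / 4 * k%:R) = k%:R * (- (Num.min 1 (lambda ^+ 2) / 4)).
  by ring.
rewrite expRM_natl; apply: lerXn2r; rewrite ?nnegrE ?expR_ge0 ?(ltW (gain_gt0 _)) //.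
apply: le_trans (expR_ge1Dx _).
have -> : gain lambda = 1 - lambda ^+ 2 / (1 + lambda) ^+ 2.
  by rewrite /gain; field; rewrite gt_eqF.
rewrite lerD2l lerN2 ler_pdivlMr ?exprn_gt0 // /Num.min.
have [h|h] := ltP 1 lambda; case: ifP => hm; move: hm; rewrite ?ltNge; nra.
Qed.

(** Serves to trade powers of [1 + lambda] for powers of [gain]. With
    [y = lambda^2 / (1 + 2 * lambda)] one has [gain = 1 / (1 + y)], and Bernoulli's inequality
    applies. *)
Lemma one_plus_le_gain (R : realType) (lambda : R) (k : nat) : 0 < lambda ->
  3 <= Num.min 1 lambda * k%:R -> (1 + lambda) * gain lambda ^+ k <= 1.
Proof.
move=> l0 hk; have l1 : 0 < 1 + lambda by rewrite ltr_wpDl.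
have l2 : 0 < 1 + 2 * lambda by lra.
set y := lambda ^+ 2 / (1 + 2 * lambda).
have y0 : 0 <= y by rewrite divr_ge0 ?sqr_ge0 // ltW.
have gE : gain lambda = (1 + y)^-1.
  have -> : 1 + y = (1 + lambda) ^+ 2 / (1 + 2 * lambda).
    by rewrite /y; field; rewrite gt_eqF.
  by rewrite invf_div.
have bern : 1 + k%:R * y <= (1 + y) ^+ k.
  elim: k {hk} => [|k IH]; first by rewrite mul0r addr0 expr0.
  rewrite exprS; apply: (@le_trans _ _ ((1 + y) * (1 + k%:R * y))).
    have h : 0 <= k%:R * y * y by exact: mulr_ge0 (mulr_ge0 (ler0n _ _) y0) y0.
    by rewrite -natr1; lra.
  by rewrite ler_wpM2l // addr_ge0.
rewrite gE exprVn ler_pdivrMr ?exprn_gt0 ?ltr_wpDr // mul1r.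
apply: le_trans bern; rewrite lerD2l.
have ky : k%:R * (lambda * Num.min 1 lambda / 3) <= k%:R * y.
  rewrite ler_wpM2l // /y ler_pdivlMr // /Num.min; case: ifP => hm; first by nra.
  by move: hm => /negbT; rewrite -leNgt => hm; nra.
apply: le_trans ky; move: hk; set mm := Num.min _ _ => hk; nra.
Qed.

Lemma expR_pow_ln (R : realType) (x : R) (k m : nat) : 0 < x ->
  (x ^+ k) ^+ m = expR (k%:R * m%:R * ln x).
Proof.
move=> x0; rewrite -exprM -[x in LHS]lnK ?posrE // -expRM_natl; congr expR.
by rewrite natrM.
Qed.

(** * Choice of the container parameters *)

Section GapSum.
Variables (R : realType) (d g : nat) (lambda w v : R).
Local Notation V := {ffun 'I_d -> bool}.
Hypotheses (w_d : w ^+ 8 = d%:R) (v_d : v ^+ 2 = ln d%:R).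
Hypotheses (w_large : 2 * 10 ^+ 4 <= w) (v_ge1 : 1 <= v) (v_w : v ^+ 2 <= 8 * w).
Hypothesis lambda_gt0 : 0 < lambda.
Hypothesis lambda_large : 10 ^+ 7 * v ^+ 3 <= lambda ^+ 2 * w ^+ 4.
Hypotheses (pow_large : (d ^ 16 <= 2 ^ d)%N).
Hypotheses (g_large : (2 ^ d <= g * d ^ 7)%N) (g_small : (g <= 2 ^ d)%N).

Let mu := Num.min 1 (lambda ^+ 2).

Let w0 : 0 < w. Proof. have := w_large; lra. Qed.
Let dR : 0 < d%:R :> R. Proof. by rewrite -w_d exprn_gt0. Qed.
Let w4 : 1 <= w ^+ 4. Proof. have := w_large => wl; by rewrite exprn_ege1 //; lra. Qed.
Let w48 : d%:R = w ^+ 4 * w ^+ 4. Proof. by rewrite -w_d -exprD. Qed.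

Let v3_w : v ^+ 3 <= 24 * w ^+ 2.
Proof.
have := w_large => wl; have := v_ge1 => vg; have := v_w => vw; have := w0 => w_0; have := dR => d_0; have := w4 => w_4.
have v3 : v <= 3 * w by rewrite -ler_sqr ?nnegrE; nra.
have -> : v ^+ 3 = v * v ^+ 2 by rewrite exprS.
have : v * v ^+ 2 <= (3 * w) * (8 * w) by rewrite ler_pM ?sqr_ge0 //; lra.
by nra.
Qed.

Let mu_large : 10 ^+ 7 * v ^+ 3 <= mu * w ^+ 4.
Proof.
have := w_large => wl; have := v_ge1 => vg; have := v_w => vw; have := w0 => w_0; have := dR => d_0; have := w4 => w_4. have := v3_w => v_3. have := lambda_gt0 => l_0.
rewrite /mu /Num.min; case: ifP => // _; rewrite mul1r.
have -> : w ^+ 4 = w ^+ 2 * w ^+ 2 by rewrite -exprD.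
have h : 10 ^+ 7 * 24 <= w ^+ 2 by nra.
by have := sqr_ge0 w; move: v3_w h; set a := v ^+ 3; set b := w ^+ 2; nra.
Qed.

Let mu0 : 0 < mu.
Proof. by rewrite /mu lt_min ltr01 exprn_gt0. Qed.
Let mu1 : mu <= 1.
Proof. by rewrite /mu ge_min lexx. Qed.

(** Order of magnitude of the sets in a code, [g * sqrt (ln d / d)]. *)
Let G := g%:R * v / w ^+ 4.

Let g_d9 : d%:R ^+ 9 <= g%:R :> R.
Proof.
have := w_large => wl; have := v_ge1 => vg; have := v_w => vw; have := w0 => w_0; have := dR => d_0; have := w4 => w_4.
rewrite -natrX ler_nat; have d0 : (0 < d)%N by rewrite -(ltr0n R).
rewrite -(@leq_pmul2r (d ^ 7)) ?expn_gt0 ?d0 // -expnD.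
exact: leq_trans pow_large g_large.
Qed.

Let g_w : w ^+ 4 * d%:R <= g%:R.
Proof.
have := w_large => wl; have := v_ge1 => vg; have := v_w => vw; have := w0 => w_0; have := dR => d_0; have := w4 => w_4.
apply: le_trans g_d9; rewrite (exprSr _ 8) ler_wpM2r ?(ltW dR) //.
have d1 : 1 <= d%:R :> R by rewrite w48; nra.
apply: (@le_trans _ _ d%:R); first by rewrite w48 ler_peMr // ltW // exprn_gt0.
by rewrite -[leLHS]expr1; apply: ler_weXn2l.
Qed.

Let G1 : 1 <= G.
Proof.
have := w_large => wl; have := v_ge1 => vg; have := v_w => vw; have := w0 => w_0; have := dR => d_0; have := w4 => w_4. have := g_w => g_w'.
rewrite /G ler_pdivlMr ?exprn_gt0 // mul1r.
have d1 : 1 <= d%:R :> R by rewrite w48; nra.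
have : w ^+ 4 <= g%:R by apply: le_trans g_w; rewrite ler_peMr // exprn_ge0 // ltW.
have : 0 <= g%:R :> R by [].
by nra.
Qed.

Let s_ex : exists s : nat, w ^+ 4 * v <= s%:R /\ (8 * s <= d)%N.
Proof.
have := w_large => wl; have := v_ge1 => vg; have := v_w => vw; have := w0 => w_0; have := dR => d_0; have := w4 => w_4.
have [|s [s1 s2]] := @nat_ceil R (w ^+ 4 * v); first by rewrite mulr_ge0 //; lra.
exists s; split=> //; rewrite -(ler_nat R) natrM w48.
have v3 : v <= 3 * w by rewrite -ler_sqr ?nnegrE; nra.
have h : 32 * w <= w ^+ 4.
  rewrite exprS mulrC; apply: ler_wpM2l; first exact: ltW.
  by rewrite exprS; nra.
have : 8 * s%:R <= 8 * (w ^+ 4 * (3 * w) + 1).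
  by rewrite ler_wpM2l //; apply: le_trans s2 _; rewrite lerD2r ler_wpM2l // exprn_ge0 // ltW.
move: h w4; set b := w ^+ 4; nra.
Qed.

Let gR : 0 < g%:R :> R.
Proof. by apply: lt_le_trans g_d9; rewrite exprn_gt0. Qed.

(** [s] is about [sqrt (d * ln d)] and [psi] about [sqrt d]. With [t] about [4 * (g / s) * ln d]
    picks the uncovered part shrinks by a factor [d], to at most [4 * g / s] vertices; [t] and [y]
    are then both of order [G]. *)
Let params_ex : exists s t y m psi : nat, [/\ [/\ (0 < s)%N, (8 * s <= d)%N, (0 < psi)%N & (psi <= d./2)%N],
  4 * d%:R * g%:R / s%:R * (1 - s%:R / (4 * g%:R)) ^+ t <= y%:R :> R,
  [/\ (1 + 64 * (t + y) <= m)%N, (4 * g + 3 * (d * t + y) <= m * d./2)%N & (2 * g <= m * psi)%N],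
  10 ^+ 3 * G <= m%:R & m%:R <= (10 ^+ 3 + 1) * G /\ psi%:R <= 2 * w ^+ 4].
Proof.
have wl := w_large; have vg := v_ge1; have w_0 := w0; have d_0 := dR; have w_4 := w4; have G_1 := G1; have g_w' := g_w.
have [s [s1 s8]] := s_ex.
have wv : 0 < w ^+ 4 * v by rewrite mulr_gt0 ?exprn_gt0 //; lra.
have sR : 0 < s%:R :> R := lt_le_trans wv s1.
have s0 : (0 < s)%N by rewrite -(ltr0n R).
have g_R := gR.
have g0 : (0 < g)%N by rewrite -(ltr0n R).
have d4 : (4 <= d)%N by clear -s0 s8; lia.
have w40 : 0 < w ^+ 4 by rewrite exprn_gt0.
have gs : g%:R / s%:R <= G / v ^+ 2.
  rewrite ler_pdivrMr // /G.
  have -> : g%:R * v / w ^+ 4 / v ^+ 2 * s%:R = g%:R * (s%:R / (w ^+ 4 * v)).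
    by field; rewrite !gt_eqF //; lra.
  by rewrite ler_peMr ?(ltW g_R) // ler_pdivlMr // mul1r.
have v2 : 1 <= v ^+ 2 by nra.
have gs0 : 0 <= g%:R / s%:R :> R by rewrite divr_ge0.
have [|t [t1 t2]] := @nat_ceil R (4 * (g%:R / s%:R) * v ^+ 2).
  by rewrite (mulr_ge0 (mulr_ge0 _ gs0) (sqr_ge0 v)).
have [|y [y1 y2]] := @nat_ceil R (4 * (g%:R / s%:R)).
  by rewrite (mulr_ge0 _ gs0).
have [|m [m1 m2]] := @nat_ceil R (10 ^+ 3 * G); first by lra.
have [|psi [p1 p2]] := @nat_ceil R (w ^+ 4); first by lra.
have gsv : g%:R / s%:R * v ^+ 2 <= G by rewrite -ler_pdivlMr //; lra.
have tG : t%:R <= 5 * G by lra.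
have yG : y%:R <= 5 * G by nra.
have d_half : d%:R / 3 <= d./2%:R :> R.
  rewrite ler_pdivrMr // -natrM ler_nat; clear -d4; lia.
have mG : m%:R <= (10 ^+ 3 + 1) * G by lra.
have G0 : 0 <= 10 ^+ 3 * G by lra.
have d30 : 0 <= d%:R / 3 :> R by lra.
have c1 : 4 * d%:R * g%:R / s%:R * (1 - s%:R / (4 * g%:R)) ^+ t <= y%:R :> R.
  apply: le_trans y1.
  have sg : s%:R / (4 * g%:R) <= 1 :> R.
    rewrite ler_pdivrMr ?mulr_gt0 // mul1r.
    have : s%:R <= d%:R :> R by rewrite ler_nat; clear -s8; lia.
    have : 1 <= w ^+ 4 by [].
    by move: g_w dR; nra.
  have : (1 - s%:R / (4 * g%:R)) ^+ t <= d%:R^-1 :> R.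
    apply: (@le_trans _ _ (expR (- (s%:R / (4 * g%:R))) ^+ t)).
      apply: lerXn2r; rewrite ?nnegrE ?expR_ge0 ?subr_ge0 //; exact: expR_ge1Dx.
    rewrite -expRM_natl -[d%:R]lnK ?posrE // -expRN ler_expR -v_d mulrN lerN2 mulrC.
    have -> : v ^+ 2 = s%:R / (4 * g%:R) * (4 * (g%:R / s%:R) * v ^+ 2).
      by field; rewrite !gt_eqF.
    by rewrite ler_wpM2l // divr_ge0 // mulr_ge0.
  move=> h; have -> : 4 * (g%:R / s%:R) = 4 * d%:R * g%:R / s%:R * d%:R^-1 :> R.
    by field; rewrite !gt_eqF.
  by rewrite ler_wpM2l // divr_ge0 // !mulr_ge0.
have c2 : (1 + 64 * (t + y) <= m)%N.
  by rewrite -(ler_nat R) natrD natrM natrD; lra.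
have gG : g%:R <= d%:R * G.
  have -> : d%:R * G = g%:R * (v * w ^+ 4) by rewrite /G w48; field; rewrite gt_eqF.
  by rewrite ler_peMr ?(ltW g_R) //; nra.
have c3 : (4 * g + 3 * (d * t + y) <= m * d./2)%N.
  rewrite -(ler_nat R) natrD !natrM natrD natrM.
  apply: (@le_trans _ _ (10 ^+ 3 * G * (d%:R / 3))); last exact: (ler_pM G0 d30 m1 d_half).
  have : d%:R * t%:R <= d%:R * (5 * G) by rewrite ler_wpM2l // ltW.
  have : y%:R <= d%:R * (5 * G).
    apply: le_trans yG _; rewrite ler_peMl //; first lra.
    by rewrite w48; nra.
  by move: g_R gG; lra.
have c4 : (2 * g <= m * psi)%N.
  rewrite -(ler_nat R) !natrM; apply: (@le_trans _ _ (10 ^+ 3 * G * w ^+ 4)).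
    rewrite /G; have -> : 10 ^+ 3 * (g%:R * v / w ^+ 4) * w ^+ 4 = g%:R * (10 ^+ 3 * v).
      by field; rewrite gt_eqF.
    by rewrite mulrC ler_wpM2l ?(ltW g_R) //; lra.
  exact: (ler_pM G0 (ltW w40) m1 p1).
have psi0 : (0 < psi)%N by rewrite -(ltr0n R); lra.
have c5 : (psi <= d./2)%N.
  rewrite -(ler_nat R); apply: le_trans d_half; rewrite w48; move: w4 p2.
  have : 2 * 10 ^+ 4 <= w ^+ 4 by apply: (le_trans w_large); rewrite -[leLHS]expr1; apply: ler_weXn2l => //; lra.
  by set b := w ^+ 4; nra.
have p3 : psi%:R <= 2 * w ^+ 4 by lra.
by exists s, t, y, m, psi; do !split.
Qed.

Lemma gap_sum :
  \sum_(A : {set V} | (A \subset evens d) && (gap A == g)) even_weight lambda A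
  <= expR (- (mu / 16 * g%:R)).
Proof.
have [s [t [y [m [psi [[s0 s8 psi0 c5] c1 [c2 c3 c4] m1 [mG p2]]]]]]] := params_ex.
have vg := v_ge1; have w_0 := w0; have d_0 := dR; have w_4 := w4; have l_0 := lambda_gt0; have mu_0 := mu0; have mu_1 := mu1; have G_1 := G1; have mu_l := mu_large; have g_R := gR.
have d4 : (4 <= d)%N by clear -s0 s8; lia.
have w40 : 0 < w ^+ 4 by rewrite exprn_gt0.
have g0 : (0 < g)%N by rewrite -(ltr0n R).
have := @container_sum R d d4 s t y m psi g s0 s8 g0 c1 c2 c3 c4 psi0 c5 lambda lambda_gt0.
move=> h; apply: le_trans h _.
have m0 : 0 < m%:R :> R by lra.
have n0 : 0 < (2 ^ d)%:R :> R by rewrite ltr0n expn_gt0.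
have cV : #|V| = (2 ^ d)%N by rewrite card_ffun card_bool card_ord.
have gG : g%:R <= d%:R * G.
  have -> : d%:R * G = g%:R * (v * w ^+ 4) by rewrite /G w48; field; rewrite gt_eqF.
  by rewrite ler_peMr ?(ltW g_R) //; nra.
have nd8 : (2 ^ d)%:R <= m%:R * d%:R ^+ 8 :> R.
  apply: (@le_trans _ _ (g%:R * d%:R ^+ 7)); first by rewrite -natrX -natrM ler_nat.
  rewrite (exprS _ 7) mulrA; apply: ler_wpM2r; first by rewrite exprn_ge0 // ltW.
  apply: le_trans gG _; rewrite mulrC; apply: ler_wpM2r; first exact: ltW.
  lra.
have mn : m%:R <= (2 ^ d)%:R :> R.
  apply: (le_trans mG); rewrite /G.
  apply: (@le_trans _ _ (g%:R * 1)); last by rewrite mulr1 ler_nat.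
  have -> : (10 ^+ 3 + 1) * (g%:R * v / w ^+ 4) = g%:R * ((10 ^+ 3 + 1) * v / w ^+ 4) by field; rewrite gt_eqF.
  rewrite ler_wpM2l ?(ltW g_R) // ler_pdivrMr // mul1r.
  have : v <= v ^+ 3 by rewrite -[leLHS]expr1; apply: ler_weXn2l.
  have : mu * w ^+ 4 <= w ^+ 4 by rewrite ger_pMl.
  move: mu_large; set a := v ^+ 3; set b := w ^+ 4; set e := mu * b; nra.
have cK : #|[set Y : {set V} | (#|Y| <= m)%N]|%:R <= expR (9 * m%:R * v ^+ 2).
  apply: (le_trans (@card_small_sets R _ m (m%:R / (2 ^ d)%:R) _ _)).
  - by rewrite divr_gt0.
  - by rewrite ler_pdivrMr // mul1r.
  rewrite cV; apply: (@le_trans _ _ ((d%:R ^+ 8) ^+ m * expR m%:R)).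
    apply: ler_pM; rewrite ?invr_ge0 ?exprn_ge0 ?addr_ge0 ?divr_ge0 //.
      rewrite -exprVn invf_div; apply: lerXn2r; rewrite ?nnegrE ?divr_ge0 ?exprn_ge0 ?(ltW dR) //.
      by rewrite ler_pdivrMr // mulrC.
    apply: (@le_trans _ _ (expR (m%:R / (2 ^ d)%:R) ^+ (2 ^ d))).
      apply: lerXn2r; rewrite ?nnegrE ?expR_ge0 ?addr_ge0 ?divr_ge0 //; exact: expR_ge1Dx.
    by rewrite -expRM_natl mulrC mulfVK // gt_eqF.
  rewrite expR_pow_ln // -expRD ler_expR -v_d.
  have : m%:R * 1 <= m%:R * v ^+ 2 by rewrite ler_wpM2l // exprn_ege1.
  lra.
(* The exponent [63 * m * ln d] is of order [g * v ^ 3 / w ^ 4]. Since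
   [63 * (10 ^ 3 + 1) * 128 < 10 ^ 7], this is the origin of the constant in [lambda_large], and of
   the exponents [-1/4] and [3/4] in the condition on [lambda]. *)
have cK7 : #|[set Y : {set V} | (#|Y| <= m)%N]|%:R ^+ 7 <= expR (mu / (16 * 8) * g%:R).
  apply: (@le_trans _ _ (expR (9 * m%:R * v ^+ 2) ^+ 7)).
    by apply: lerXn2r; rewrite ?nnegrE ?expR_ge0.
  rewrite -expRM_natl ler_expR mulrC.
  apply: (@le_trans _ _ (9 * ((10 ^+ 3 + 1) * G) * v ^+ 2 * 7)).
    by rewrite ler_wpM2r // ler_wpM2r ?sqr_ge0 // ler_wpM2l.
  rewrite /G; have -> : 9 * ((10 ^+ 3 + 1) * (g%:R * v / w ^+ 4)) * v ^+ 2 * 7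
     = ((63 * (10 ^+ 3 + 1)) * v ^+ 3 / w ^+ 4) * g%:R by field; rewrite gt_eqF.
  apply: ler_wpM2r; first exact: ltW.
  rewrite ler_pdivrMr //; move: mu_large; set a := v ^+ 3; set b := w ^+ 4.
  have : 0 <= a by rewrite exprn_ge0 //; lra.
  by clearbody a b; lra.
have lmu : mu <= Num.min 1 lambda * Num.min 1 lambda.
  rewrite /mu /Num.min; case: ifP => h1; case: ifP => h2 //; rewrite ?mul1r ?mulr1 //.
  - by move: h1 h2 => h1 /negbT; rewrite -leNgt => h2; nra.
  - by move: h1 => /negbT; rewrite -leNgt.
have ll0 : 0 < Num.min 1 lambda by rewrite lt_min ltr01.
have ll1 : Num.min 1 lambda <= 1 by rewrite ge_min lexx.
set ll := Num.min 1 lambda in lmu ll0 ll1.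
have ll_w : 200 <= ll * w ^+ 4.
  rewrite -ler_sqr ?nnegrE; last by rewrite mulr_ge0 // ltW.
    have v31 : 1 <= v ^+ 3 by rewrite exprn_ege1.
    have h1 : 10 ^+ 7 <= ll * ll * w ^+ 4.
      apply: (@le_trans _ _ (mu * w ^+ 4)); first by apply: le_trans mu_large; rewrite ler_peMr.
      by apply: ler_wpM2r => //; exact: ltW.
    have -> : (ll * w ^+ 4) ^+ 2 = (ll * ll * w ^+ 4) * w ^+ 4 by ring.
    move: h1 w4; set a := ll * ll * w ^+ 4; set b := w ^+ 4; nra.
  by [].
have [|K [K1 K2]] := @nat_ceil R (3 / ll); first by rewrite divr_ge0 // ltW.
have hK : (1 + lambda) * gain lambda ^+ K <= 1.
  by apply: one_plus_le_gain => //; rewrite mulrC -ler_pdivrMr.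
set delta := (4 * (psi * g) %/ d)%N.
(* Absorbing [(1 + lambda) ^+ delta] uses up [K * delta] powers of [gain], at most half of those
   available: [delta] is at most [8 * g / sqrt d] and [K] of order [1 / min 1 lambda]. *)
have Kd : (2 * (K * delta) <= g)%N.
  have hd : delta%:R * d%:R <= 4 * (psi%:R * g%:R) :> R.
    by rewrite -!natrM ler_nat; exact: leq_trunc_div.
  have hK4 : K%:R * ll <= 4.
    have : K%:R * ll <= (3 / ll + 1) * ll by rewrite ler_wpM2r // ltW.
    by rewrite mulrDl mul1r divfK ?gt_eqF //; lra.
  rewrite -(ler_nat R) !natrM.
  have hdd : delta%:R <= 8 * g%:R / w ^+ 4.
    rewrite ler_pdivlMr //.
    rewrite -(ler_pM2r w40) -mulrA -w48; apply: le_trans hd _.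
    have : psi%:R <= 2 * w ^+ 4 by [].
    by move: g_R; set b := w ^+ 4; set gg := g%:R; set pp := psi%:R; nra.
  have h3 : K%:R <= 4 / ll by rewrite ler_pdivlMr.
  apply: (@le_trans _ _ (2 * (4 / ll * (8 * g%:R / w ^+ 4)))).
    by rewrite ler_wpM2l // ler_pM.
  have -> : 2 * (4 / ll * (8 * g%:R / w ^+ 4)) = g%:R * (64 / (ll * w ^+ 4)).
    by field; rewrite !gt_eqF.
  rewrite ger_pMr // ler_pdivrMr ?mulr_gt0 //; lra.
have main : (1 + lambda) ^+ delta * gain lambda ^+ g <= expR (- (mu / 8 * g%:R)).
  have l1 : 0 <= 1 + lambda by lra.
  have g0' := gain_gt0 lambda_gt0.
  have gE : g = (K * delta + (g - K * delta))%N by clear -Kd; lia.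
  rewrite [in X in X <= _]gE.
  rewrite exprD mulrA exprM -exprMn.
  apply: (@le_trans _ _ (1 * gain lambda ^+ (g - K * delta))).
    apply: ler_wpM2r; first by rewrite exprn_ge0 // ltW.
    by apply: exprn_ile1 => //; rewrite mulr_ge0 // exprn_ge0 // ltW.
  rewrite mul1r; apply: le_trans (gain_expR _ lambda_gt0) _; rewrite -/mu.
  rewrite ler_expR lerN2.
  have : g%:R <= 2 * (g - K * delta)%:R :> R by rewrite -natrM ler_nat; clear -Kd; lia.
  by move: mu0; set gg := g%:R; set hh := (_ - _)%N%:R; nra.
apply: (@le_trans _ _ (expR (mu / (16 * 8) * g%:R) * expR (- (mu / 8 * g%:R)))).
  apply: ler_pM; [exact: exprn_ge0 | | exact: cK7 | exact: main].
  by apply: mulr_ge0; apply: exprn_ge0; [lra | exact/ltW/gain_gt0].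
rewrite -expRD ler_expR.
have : 0 <= mu * g%:R by rewrite mulr_ge0 // ltW.
by lra.
Qed.

End GapSum.

(** * Hard-core sums over the hypercube *)

Lemma sum_subsetsU (M : nmodType) (V : finType) (S T : {set V}) (f : {set V} -> M) :
  [disjoint S & T] ->
  \sum_(A : {set V} | A \subset S :|: T) f A
  = \sum_(A : {set V} | A \subset S) \sum_(B : {set V} | B \subset T) f (A :|: B).
Proof.
have [m] := ubnP #|S|; elim: m S f => // m IH S f; rewrite ltnS => Sm dST.
have [->|/set0Pn[u uS]] := eqVneq S set0.
  rewrite set0U [RHS](big_pred1 set0) => [|A]; last by rewrite subset0.
  by apply: eq_bigr => B _; rewrite set0U.
have uT : u \notin T by rewrite (disjointFr dST).
rewrite (sum_subsets_split _ (_ : u \in S :|: T)) ?in_setU ?uS //.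
have -> : (S :|: T) :\ u = S :\ u :|: T.
  apply/setP => z; rewrite !inE; case: eqP => [->|//]; by rewrite (negPf uT).
rewrite IH; last 2 first.
- by rewrite (cardsD1 u) uS in Sm.
- by apply: disjointWl dST; exact: subsetDl.
rewrite (sum_subsets_split _ uS); apply: eq_bigr => A _.
rewrite -big_split; apply: eq_bigr => B _; congr (f _ + _).
by rewrite setUA.
Qed.

Lemma pow2_pred k : (0 < k)%N -> (2 ^ k = 2 ^ k.-1 + 2 ^ k.-1)%N.
Proof. by move=> k0; rewrite -{1}(prednK k0) expnS mul2n addnn. Qed.

Section CubeWeights.
Variables (R : realType) (d : nat).
Local Notation V := {ffun 'I_d -> bool}.
Implicit Types (x y z : V) (i j : 'I_d) (A B I : {set V}).

Definition odds : {set V} := [set u | par u].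
Definition face i (b : bool) : {set V} := [set x : V | x i == b].
Definition cindep I := [forall x in I, forall i, flip x i \notin I].

Lemma cindepP I : reflect (forall x i, x \in I -> flip x i \notin I) (cindep I).
Proof.
apply: (iffP forall_inP) => [h x i /h /forallP|h x xI]; first exact.
by apply/forallP => i; apply: h.
Qed.

Lemma card_evens : (0 < d)%N -> #|evens d| = (2 ^ d.-1)%N.
Proof.
case: d => // d' _ /=.
have h : #|evens d'.+1| = #|[set u : {ffun 'I_d'.+1 -> bool} | par u]|.
  rewrite -[LHS](card_imset _ (@flip_inj _ ord0)); apply: eq_card => u; rewrite [RHS]inE.
  apply/imsetP/idP => [[v]|pu]; first by rewrite inE => pv ->; rewrite par_flip.
  by exists (flip u ord0); rewrite ?flipK // inE par_flip pu.
have := cardsC (evens d'.+1); rewrite card_ffun card_bool card_ord.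
have -> : #|~: evens d'.+1| = #|evens d'.+1|.
  by rewrite h; apply: eq_card => u; rewrite !inE negbK.
by rewrite expnS mul2n addnn => /double_inj.
Qed.

Lemma card_odds : (0 < d)%N -> #|odds| = (2 ^ d.-1)%N.
Proof.
move=> d0; have := cardsC (evens d); rewrite card_ffun card_bool card_ord card_evens //.
have -> : ~: evens d = odds by apply/setP => u; rewrite !inE negbK.
by rewrite (pow2_pred d0) => /eqP; rewrite eqn_add2l => /eqP.
Qed.

Variable lambda : R.
Hypothesis lambda_gt0 : 0 < lambda.

(** Given the even part [A], the odd vertices off [nb A] are free. *)
Lemma cube_sum_even (Q : pred {set V}) : (0 < d)%N ->
  \sum_(I : {set V} | cindep I && Q (I :&: evens d)) lambda ^+ #|I|
  <= (1 + lambda) ^+ (2 ^ d.-1) * \sum_(A : {set V} | (A \subset evens d) && Q A) even_weight lambda A.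
Proof.
move=> d0; have l0 := lambda_gt0; have l1 : 0 < 1 + lambda by lra.
have EO : [disjoint evens d & odds].
  by rewrite -setI_eq0; apply/eqP/setP => u; rewrite !inE andNb.
have EOT : evens d :|: odds = [set: V] by apply/setP => u; rewrite !inE orNb.
pose F (I : {set V}) := if cindep I && Q (I :&: evens d) then lambda ^+ #|I| else 0.
have -> : \sum_(I : {set V} | cindep I && Q (I :&: evens d)) lambda ^+ #|I|
   = \sum_(I : {set V} | I \subset evens d :|: odds) F I.
  by rewrite big_mkcond [RHS]big_mkcond /=; apply: eq_bigr => I _; rewrite EOT subsetT.
rewrite sum_subsetsU // mulr_sumr big_mkcondr /=; apply: ler_sum => A Ae.
have AE B : B \subset odds -> (A :|: B) :&: evens d = A.
  move=> Bo; rewrite setIUl (setIidPl Ae).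
  suff -> : B :&: evens d = set0 by rewrite setU0.
  apply/eqP; rewrite setI_eq0 disjoint_sym; exact: disjointWr EO.
case QA: (Q A); last first.
  by rewrite big1 // => B Bo; rewrite /F AE // QA andbF.
rewrite /even_weight mulrCA.
have nbo : nb A \subset odds.
  by apply/subsetP => v /nbP[i /(subsetP Ae)]; rewrite !inE par_flip negbK.
have -> : (1 + lambda) ^+ (2 ^ d.-1) * (1 + lambda) ^- #|nb A| = (1 + lambda) ^+ #|odds :\: nb A|.
  rewrite cardsD (setIidPr nbo) card_odds // -{1}(subnK (_ : #|nb A| <= 2 ^ d.-1)%N).
    by rewrite exprD mulfK // expf_neq0 // gt_eqF.
  by rewrite -card_odds // subset_leq_card.
rewrite -sum_subsets_pow mulr_sumr [leRHS]big_mkcond [leLHS]big_mkcond /=; apply: ler_sum => B _.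
case: ifP => Bo; last by case: ifP => // _; rewrite mulr_ge0 // exprn_ge0 // ltW.
rewrite /F AE // QA andbT; case: ifP => ind; last first.
  by case: ifP => // _; rewrite mulr_ge0 // exprn_ge0 // ltW.
have -> : B \subset odds :\: nb A.
  apply/subsetP => u uB; rewrite inE (subsetP Bo) // andbT; apply/nbP => -[i hi].
  have := cindepP _ ind (flip u i) i; rewrite flipK !in_setU hi uB orbT.
  by move=> /(_ isT).
rewrite -exprD.
suff dAB : [disjoint A & B] by rewrite cardsU disjoint_setI0 // cards0 subn0.
by apply: disjointWl Ae _; apply: disjointWr Bo EO.
Qed.

Lemma even_weight_ge0 A : 0 <= even_weight lambda A.
Proof.
have l0 := lambda_gt0; have l1 : 0 <= 1 + lambda by lra.
by rewrite /even_weight mulr_ge0 ?invr_ge0 ?exprn_ge0 // ltW.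
Qed.

(** Every such [A] is a subset of the even vertices whose neighbours all lie in [F], and flipping
    one coordinate embeds these vertices in [F]. *)
Lemma even_weight_fiber (F : {set V}) : (0 < d)%N ->
  \sum_(A : {set V} | (A \subset evens d) && (nb A == F)) even_weight lambda A <= 1.
Proof.
move=> d0; have l0 := lambda_gt0; have l1 : 0 < 1 + lambda by lra.
pose S := [set u in evens d | nbrs u \subset F].
have [/existsP[A0 /andP[A0e /eqP A0F]]|/existsPn none] :=
    boolP [exists A : {set V}, (A \subset evens d) && (nb A == F)]; last first.
  by rewrite big_pred0 => [|A]; [exact: ler01 | exact/negbTE/none].
have SF : (#|S| <= #|F|)%N.
  have i : 'I_d by case: d d0 => // d' _; exact: ord0.
  rewrite -[leqLHS](card_imset _ (@flip_inj _ i)); apply: subset_leq_card; apply/subsetP => v.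
  case/imsetP => u; rewrite inE => /andP[_ /subsetP h] ->; apply: h.
  by apply/imsetP; exists i.
apply: (@le_trans _ _ (\sum_(A : {set V} | A \subset S) lambda ^+ #|A| * (1 + lambda) ^- #|F|)).
  rewrite [leLHS]big_mkcond [leRHS]big_mkcond /=; apply: ler_sum => A _.
  have h0 : 0 <= lambda ^+ #|A| * (1 + lambda) ^- #|F|.
    by rewrite mulr_ge0 ?invr_ge0 // exprn_ge0 // ltW.
  case: ifP => [/andP[Ae /eqP AF]|_]; last by case: ifP.
  rewrite /even_weight AF ifT //; apply/subsetP => u uA; rewrite inE (subsetP Ae) //=.
  apply/subsetP => v /imsetP[i _ ->]; rewrite -AF; apply/nbP; exists i.
  by rewrite flipK.
rewrite -mulr_suml sum_subsets_pow ler_pdivrMr ?exprn_gt0 // mul1r.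
by apply: ler_weXn2l => //; lra.
Qed.

(* Each edge in the direction [j] of the face carries at most one vertex of [I]. *)
Lemma face_sum (P : pred {set V}) i j b : (1 < d)%N -> i != j ->
  \sum_(I : {set V} | cindep I && P (I :&: face i b)) lambda ^+ #|I|
  <= (\sum_(A : {set V} | (A \subset face i b) && P A) lambda ^+ #|A|)
     * (1 + 2 * lambda) ^+ (2 ^ d.-2).
Proof.
move=> d1 ij; have l0 := lambda_gt0; have l1 : 0 < 1 + lambda by lra.
pose T := face i (~~ b).
pose TE := T :&: evens d; pose TO := T :&: odds.
have dis1 : [disjoint face i b & T].
  by rewrite -setI_eq0; apply/eqP/setP => u; rewrite !inE; case: (u i); case: (b).
have cov1 : face i b :|: T = [set: V].
  by apply/setP => u; rewrite !inE; case: (u i); case: (b).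
have TEO : T = TE :|: TO by apply/setP => u; rewrite !inE; case: (par u); rewrite ?andbT ?andbF ?orbF.
have dis2 : [disjoint TE & TO].
  by rewrite -setI_eq0; apply/eqP/setP => u; rewrite !inE; case: (par u); rewrite ?andbF.
have flipT u : (flip u j \in T) = (u \in T).
  by rewrite !inE flipE (negPf ij).
have cTE : #|TE| = #|TO|.
  rewrite -[LHS](card_imset _ (@flip_inj _ j)); apply: eq_card => u.
  apply/imsetP/idP => [[v]|]; rewrite !inE.
    by move=> /andP[vT pv] ->; rewrite par_flip pv flipE (negPf ij) vT.
  move=> /andP[uT pu]; exists (flip u j); rewrite ?flipK //.
  by rewrite !inE par_flip pu flipE (negPf ij) uT.
have cT : (#|TE| + #|TO| = 2 ^ d.-1)%N.
  have -> : (#|TE| + #|TO| = #|T|)%N.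
    by rewrite [in RHS]TEO cardsU disjoint_setI0 // cards0 subn0.
  have e : #|face i b| = #|T|.
    rewrite -[LHS](card_imset _ (@flip_inj _ i)); apply: eq_card => u.
    apply/imsetP/idP => [[v]|]; rewrite !inE.
      by move=> /eqP <- ->; rewrite flipE eqxx; case: (v i).
    move=> /eqP uT; exists (flip u i); rewrite ?flipK //.
    by rewrite !inE flipE eqxx uT; case: (b).
  have := cardsT V; rewrite -cov1 cardsU disjoint_setI0 // cards0 subn0 e.
  rewrite card_ffun card_bool card_ord (pow2_pred (ltnW d1)); lia.
have cTE' : #|TE| = (2 ^ d.-2)%N.
  have := @pow2_pred d.-1; move: cT; rewrite -cTE; lia.
pose F (I : {set V}) := if cindep I && P (I :&: face i b) then lambda ^+ #|I| else 0.
have -> : \sum_(I : {set V} | cindep I && P (I :&: face i b)) lambda ^+ #|I|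
   = \sum_(I : {set V} | I \subset face i b :|: T) F I.
  by rewrite big_mkcond [RHS]big_mkcond /=; apply: eq_bigr => I _; rewrite cov1 subsetT.
rewrite sum_subsetsU // mulr_suml [leRHS]big_mkcondr /=; apply: ler_sum => A Ae.
have AE B : B \subset T -> (A :|: B) :&: face i b = A.
  move=> BT; rewrite setIUl (setIidPl Ae).
  suff -> : B :&: face i b = set0 by rewrite setU0.
  apply/eqP; rewrite setI_eq0 disjoint_sym; exact: disjointWr dis1.
case PA: (P A); last by rewrite big1 // => B BT; rewrite /F AE // PA andbF.
apply: (@le_trans _ _ (\sum_(B : {set V} | B \subset T)
   if cindep B then lambda ^+ #|A| * lambda ^+ #|B| else 0)).
  apply: ler_sum => B BT; rewrite /F AE // PA andbT.
  have [ind|_] := boolP (cindep (A :|: B)); last first.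
    by case: ifP => // _; rewrite mulr_ge0 // exprn_ge0 // ltW.
  have -> : cindep B.
    apply/cindepP => x k xB; have := cindepP _ ind x k; rewrite !in_setU xB orbT negb_or.
    by move=> /(_ isT) /andP[].
  rewrite -exprD.
  suff dAB : [disjoint A & B] by rewrite cardsU disjoint_setI0 // cards0 subn0.
  by apply: disjointWl Ae _; apply: disjointWr BT dis1.
rewrite {1}TEO sum_subsetsU //.
have -> : (1 + 2 * lambda) ^+ (2 ^ d.-2) = (1 + lambda) ^+ #|TE| * (1 + occ lambda) ^+ #|TE|.
  by rewrite cTE' -exprMn; congr (_ ^+ _); rewrite /occ; field; rewrite gt_eqF.
rewrite -(sum_subsets_pow TE (occ lambda)) !mulr_sumr; apply: ler_sum => B BT.
have imB : [set flip x j | x in B] \subset TO.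
  apply/subsetP => u /imsetP[v /(subsetP BT)]; rewrite !inE => /andP[vT pv] ->.
  by rewrite par_flip pv flipE (negPf ij) vT.
have cB : #|[set flip x j | x in B]| = #|B| by rewrite card_imset //; exact: flip_inj.
have BTE := subset_leq_card BT.
apply: (@le_trans _ _ (\sum_(C : {set V} | C \subset TO :\: [set flip x j | x in B])
    lambda ^+ #|A| * lambda ^+ #|B| * lambda ^+ #|C|)).
  rewrite [leLHS]big_mkcond [leRHS]big_mkcond /=; apply: ler_sum => C _.
  have h0 : 0 <= lambda ^+ #|A| * lambda ^+ #|B| * lambda ^+ #|C|.
    by rewrite !mulr_ge0 // exprn_ge0 // ltW.
  case: ifP => CT; last by case: ifP.
  case: ifP => ind; last by case: ifP.
  have -> : C \subset TO :\: [set flip x j | x in B].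
    apply/subsetP => u uC; rewrite inE (subsetP CT) // andbT.
    apply/imsetP => -[v vB uE]; have := cindepP _ ind v j.
    by rewrite !in_setU vB -uE uC orbT => /(_ isT).
  suff dBC : [disjoint B & C] by rewrite cardsU disjoint_setI0 // cards0 subn0 exprD mulrA.
  by apply: disjointWl BT _; apply: disjointWr CT dis2.
rewrite -mulr_sumr sum_subsets_pow cardsD (setIidPr imB) cB -cTE.
rewrite -mulrA ler_wpM2l ?exprn_ge0 ?(ltW l0) // /occ expr_div_n.
have -> : (1 + lambda) ^+ #|TE| = (1 + lambda) ^+ (#|TE| - #|B|) * (1 + lambda) ^+ #|B|.
  by rewrite -exprD subnK.
have : (1 + lambda) ^+ #|B| != 0 by rewrite expf_neq0 // gt_eqF.
move: (_ ^+ (_ - _)) (_ ^+ #|B|) (lambda ^+ _) => p q r q0.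
by have -> : p * q * (r / q) = r * p by field.
Qed.

End CubeWeights.

Lemma mul_two_sides (R : realDomainType) (c p q : R) :
  0 <= c -> c <= p -> c <= q -> c * (p + q) <= 2 * (p * q).
Proof.
move=> c0 cp cq; have p0 := le_trans c0 cp; have q0 := le_trans c0 cq.
have := ler_wpM2r p0 cq; have := ler_wpM2r q0 cp; lra.
Qed.

Section CubeEstimates.
Variables (R : realType) (d : nat).
Local Notation V := {ffun 'I_d -> bool}.
Implicit Types (x y z : V) (i j : 'I_d) (A B I : {set V}).

(* [w] and [v] stand for [d^(1/8)] and [sqrt (ln d)]. *)
Definition regime (lambda w v : R) : Prop :=
  [/\ [/\ w ^+ 8 = d%:R, v ^+ 2 = ln d%:R & 2 * 10 ^+ 4 <= w],
      1 <= v, v ^+ 2 <= 8 * w,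
      0 < lambda /\ 10 ^+ 7 * v ^+ 3 <= lambda ^+ 2 * w ^+ 4
    & (d ^ 16 <= 2 ^ d)%N].

Variables (lambda w v : R).
Hypothesis reg : regime lambda w v.
Local Notation n := ((2 ^ d)%:R : R).
Local Notation mu := (Num.min 1 (lambda ^+ 2)).

Lemma w_gt0 : 0 < w.
Proof. by case: reg => -[_ _ h] _ _ _ _; apply: lt_le_trans h; rewrite mulr_gt0 // exprn_gt0. Qed.

Lemma w_large k : 2 * 10 ^+ 4 <= w ^+ k.+1.
Proof.
case: reg => -[_ _ h] _ _ _ _; apply: (le_trans h).
have w1 : 1 <= w by lra.
by rewrite -[leLHS]expr1; apply: ler_weXn2l.
Qed.

Lemma lambda_pos : 0 < lambda.
Proof. by case: reg => _ _ _ [h _] _. Qed.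

Lemma d_pos : (0 < d)%N.
Proof.
case: reg => -[h _ _] _ _ _ _; rewrite -(ltr0n R) -h.
by rewrite exprn_gt0 // w_gt0.
Qed.

Lemma d_large : 2 * 10 ^+ 4 <= d%:R :> R.
Proof. by case: reg => -[<- _ _] _ _ _ _; exact: w_large. Qed.

Lemma d_ge4 : (4 <= d)%N.
Proof. by rewrite -(ler_nat R); apply: le_trans d_large; lra. Qed.

Lemma mu_gt0 : 0 < mu.
Proof. by rewrite lt_min ltr01 exprn_gt0 // lambda_pos. Qed.

Lemma v3_bound : v ^+ 3 <= 24 * w ^+ 2.
Proof.
case: reg => _ v1 vw _ _; have w0 := w_gt0; have wl := w_large 0; rewrite expr1 in wl.
have v3 : v <= 3 * w by rewrite -ler_sqr ?nnegrE; nra.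
have -> : v ^+ 3 = v * v ^+ 2 by rewrite exprS.
have : v * v ^+ 2 <= (3 * w) * (8 * w) by rewrite ler_pM ?sqr_ge0 //; lra.
by nra.
Qed.

Lemma mu_w4 : 10 ^+ 7 * v ^+ 3 <= mu * w ^+ 4.
Proof.
rewrite /Num.min; case: ifP => [_|_]; last by case: reg => _ _ _ [].
rewrite mul1r; have wl := w_large 0; rewrite expr1 in wl.
have -> : w ^+ 4 = w ^+ 2 * w ^+ 2 by rewrite -exprD.
have h : 10 ^+ 7 * 24 <= w ^+ 2 by nra.
have := v3_bound; move: h; set a := v ^+ 3; set b := w ^+ 2; nra.
Qed.

Lemma v3_ge1 : 1 <= v ^+ 3.
Proof. by case: reg => _ v1 _ _ _; rewrite exprn_ege1. Qed.

Lemma mu_w4' : 10 ^+ 7 <= mu * w ^+ 4.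
Proof. by apply: le_trans mu_w4; rewrite ler_peMr // v3_ge1. Qed.

Lemma n_large : d%:R ^+ 16 <= n.
Proof. by case: reg => _ _ _ _ h; rewrite -natrX ler_nat. Qed.

Lemma n_le_exp : n <= expR d%:R.
Proof.
rewrite natrX -[d%:R]mulr1 expRM_natl; apply: lerXn2r; rewrite ?nnegrE ?expR_ge0 //.
by apply: le_trans (expR_ge1Dx _); lra.
Qed.

Lemma n_div (k : nat) : (k <= 15)%N -> d%:R <= n / d%:R ^+ k.
Proof.
move=> k15; have d0 : 0 < d%:R :> R by rewrite ltr0n d_pos.
rewrite ler_pdivlMr ?exprn_gt0 // -exprS; apply: le_trans n_large.
by apply: ler_weXn2l => //; rewrite ler1n d_pos.
Qed.

Lemma gap_le A : (gap A <= 2 ^ d)%N.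
Proof.
apply: leq_trans (leq_subr _ _) _.
by apply: leq_trans (max_card _) _; rewrite card_ffun card_bool card_ord.
Qed.

Lemma large_gap_sum (t : R) : n / d%:R ^+ 7 <= t ->
  \sum_(A : {set V} | (A \subset evens d) && (t <= (gap A)%:R)) even_weight lambda A
  <= (n + 1) * expR (- (mu / 16 * t)).
Proof.
move=> ht; have l0 := lambda_pos; have d0 : 0 < d%:R :> R by rewrite ltr0n d_pos.
rewrite (partition_big (fun A => inord (gap A) : 'I_(2 ^ d).+1) xpredT) //=.
rewrite (_ : n + 1 = #|'I_(2 ^ d).+1|%:R); last by rewrite card_ord natr1.
rewrite mulr_natl -sumr_const; apply: ler_sum => k _.
have gE A : (inord (gap A) == k :> 'I_(2 ^ d).+1) = (gap A == k).
  by rewrite -val_eqE /= inordK // ltnS gap_le.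
have [kt|kt] := leP t k%:R; last first.
  rewrite big_pred0 ?expR_ge0 // => A; rewrite gE.
  by apply/negbTE; apply: contraTN kt => /andP[/andP[_ h] /eqP <-]; rewrite -leNgt.
case: reg => -[h1 h2 h3] h4 h5 [h6 h7] h8.
have := @gap_sum R d k lambda w v h1 h2 h3 h4 h5 h6 h7 h8.
have -> : (2 ^ d <= k * d ^ 7)%N.
  rewrite -(ler_nat R) natrM (natrX _ d) -ler_pdivrMr ?exprn_gt0 //; exact: le_trans kt.
have -> : (k <= 2 ^ d)%N by rewrite -ltnS.
move=> /(_ isT isT) h; apply: le_trans (_ : _ <= expR (- (mu / 16 * k%:R))) _; last first.
  by rewrite ler_expR lerN2 ler_wpM2l // divr_ge0 // ltW // mu_gt0.
apply: le_trans h; rewrite le_eqVlt; apply/orP; left; apply/eqP; apply: eq_bigl => A.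
by rewrite gE; case: eqP => [->|]; rewrite ?andbF // kt !andbT.
Qed.

Lemma hull_iso A : A \subset evens d ->
  (#|hull A| * (2 ^ d - #|hull A|) <= 2 * 2 ^ d * (d * gap A))%N.
Proof.
move=> Ae; have tr : forall a b : bool, fconnect negb a b.
  move=> a c; case: (eqVneq a c) => [->|ac]; first exact: connect0.
  have -> : c = ~~ a by move: ac; case: a; case: c.
  exact: fconnect1.
have := @edge_iso R bool d negb tr _ (hull A); rewrite card_bool => /(_ isT).
rewrite card_ffun card_bool card_ord -natr_sum.
have -> : (\sum_x #|[set i | exits negb (hull A) x i]| = d * gap A)%N.
  rewrite -(sum_bdeg_hull d_ge4 Ae) [RHS]big_mkcond; apply: eq_bigr => x _.
  case: ifP => hx; last by apply: eq_card0 => i; rewrite [LHS]in_set /exits hx.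
  by apply: eq_card => i; rewrite [LHS]in_set [RHS]in_set /exits hx /flip; case: (_ \in hull A).
rewrite -natrB; first by rewrite -!natrM ler_nat.
by apply: leq_trans (max_card _) _; rewrite card_ffun card_bool card_ord.
Qed.

Let k0 := (4 * 2 ^ d %/ d ^ 6)%N.

(** Isoperimetry turns a small gap into a hull that is tiny or has a tiny complement. In the first
    case [A] itself has at most [k0] points. In the second [odds d] minus [nb A] has; it determines
    [nb A], and [even_weight_fiber] bounds the sum over each fiber by 1. *)
Lemma small_gap_sum :
  \sum_(A : {set V} | (A \subset evens d) && ~~ (n / d%:R ^+ 7 <= (gap A)%:R))
     even_weight lambda A
  <= 2 * #|[set Y : {set V} | (#|Y| <= k0)%N]|%:R.
Proof.
have l0 := lambda_pos; have d0 := d_pos; have dR : 0 < d%:R :> R by rewrite ltr0n.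
set Y := [set Y : {set V} | _].
have key A : A \subset evens d -> ~~ (n / d%:R ^+ 7 <= (gap A)%:R) ->
    (A \in Y) || (~: nb A :&: odds d \in Y).
  move=> Ae; rewrite -ltNge ltr_pdivlMr ?exprn_gt0 // -natrX -natrM ltr_nat => hg.
  have := hull_iso Ae; set W := hull A => hW.
  have cW : (#|W| <= 2 ^ d)%N by apply: leq_trans (max_card _) _; rewrite card_ffun card_bool card_ord.
  have n0 : (0 < 2 ^ d)%N by rewrite expn_gt0.
  have d6 : (0 < d ^ 6)%N by rewrite expn_gt0 d0.
  have h2 : (minn #|W| (2 ^ d - #|W|) * d ^ 6 <= 4 * 2 ^ d)%N.
    have h3 : (minn #|W| (2 ^ d - #|W|) * 2 ^ d <= 2 * (#|W| * (2 ^ d - #|W|)))%N.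
      by clear -cW; move: (2 ^ d)%N #|W| cW => q p; rewrite /minn; case: ifP; nia.
    have h4 : (minn #|W| (2 ^ d - #|W|) <= 4 * (d * gap A))%N.
      rewrite -(leq_pmul2r n0); apply: (leq_trans h3).
      have -> : (4 * (d * gap A) * 2 ^ d = 2 * (2 * 2 ^ d * (d * gap A)))%N by ring.
      by rewrite leq_mul2l hW orbT.
    apply: (leq_trans (leq_mul h4 (leqnn (d ^ 6)))).
    have -> : (4 * (d * gap A) * d ^ 6 = 4 * (gap A * d ^ 7))%N by rewrite (expnS d 6); ring.
    by rewrite leq_mul2l ltnW ?orbT.
  have h5 : (minn #|W| (2 ^ d - #|W|) <= k0)%N by rewrite /k0 leq_divRL.
  have AW : A \subset W by apply: subset_trans (sub_closure A) (subsetUl _ _).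
  have BW : ~: nb A :&: odds d \subset ~: W.
    apply/subsetP => u; rewrite in_setI !in_setC in_setU => /andP[h6 h7].
    rewrite negb_or h6 andbT; apply: contraL h7 => /(closure_even d_ge4 Ae).
    by rewrite in_set.
  have cW' : #|~: W| = (2 ^ d - #|W|)%N.
    by have := cardsC W; rewrite card_ffun card_bool card_ord => <-; rewrite addKn.
  apply/orP; rewrite !in_set; move: h5; rewrite geq_min => /orP[h5|h5]; [left|right].
    exact: leq_trans (subset_leq_card AW) h5.
  by apply: leq_trans (subset_leq_card BW) _; rewrite cW'.
have w0 A : 0 <= even_weight lambda A by exact: even_weight_ge0.
have w1 A : A \subset evens d -> even_weight lambda A <= 1.
  move=> Ae; have l1 : 0 < 1 + lambda by lra.
  rewrite /even_weight ler_pdivrMr ?exprn_gt0 // mul1r.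
  apply: (@le_trans _ _ ((1 + lambda) ^+ #|A|)).
    by apply: lerXn2r; rewrite ?nnegrE; lra.
  apply: ler_weXn2l; first lra.
  apply: leq_trans (subset_leq_card (sub_closure A)) _; exact: (closure_le d_ge4 Ae).
rewrite (_ : 2 = 1 + 1) // mulrDl mul1r.
apply: (@le_trans _ _ (\sum_(A : {set V} | (A \subset evens d) && (A \in Y)) even_weight lambda A
   + \sum_(A : {set V} | (A \subset evens d) && (~: nb A :&: odds d \in Y)) even_weight lambda A)).
  rewrite [X in _ <= X + _]big_mkcond [X in _ <= _ + X]big_mkcond -big_split [leLHS]big_mkcond /=; apply: ler_sum => A _.
  case Ae: (A \subset evens d) => /=; last by rewrite addr0.
  case: ifP => [hA|_]; last by rewrite addr_ge0 //; case: ifP.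
  case/orP: (key A Ae hA) => ->; first by rewrite lerDl; case: ifP.
  by rewrite lerDr; case: ifP.
apply: lerD.
  rewrite -sum1_card natr_sum [leLHS]big_mkcond [leRHS]big_mkcond /=; apply: ler_sum => A _.
  case: ifP => [/andP[Ae ->]|_]; first exact: w1.
  by case: ifP.
rewrite (partition_big (fun A => ~: nb A :&: odds d) (mem Y)) /=; last by move=> A /andP[].
rewrite -sum1_card natr_sum; apply: ler_sum => C _.
apply: le_trans (even_weight_fiber l0 (odds d :\: C) d0).
rewrite [leLHS]big_mkcond [leRHS]big_mkcond /=; apply: ler_sum => A _.
case: ifP => [/andP[/andP[Ae _] /eqP <-]|_]; last by case: ifP.
rewrite Ae ifT //; apply/eqP/setP => u; rewrite in_setD in_setI in_setC negb_and negbK.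
case: (boolP (u \in odds d)) => uo; rewrite ?orbF ?andbT ?andbF //.
apply: contraNF uo => /(nb_even Ae); by rewrite inE.
Qed.

Lemma exp_d_le (t : R) : d%:R <= t -> n + 1 <= expR (2 * t).
Proof.
move=> dt; have dl := d_large.
apply: (@le_trans _ _ (expR (d%:R + 1))).
  rewrite expRD; have := n_le_exp.
  have : 1 + 1 <= expR 1 :> R by exact: expR_ge1Dx.
  have : 1 <= expR d%:R :> R by rewrite -expR0 ler_expR.
  set a := expR 1; set b := expR _; nra.
by rewrite ler_expR; lra.
Qed.

Lemma even_weight_total :
  \sum_(A : {set V} | A \subset evens d) even_weight lambda A <= expR (n / d%:R ^+ 5).
Proof.
have d0 := d_pos; have dR : 0 < d%:R :> R by rewrite ltr0n.
have dl := d_large; have wl := w_large 0; rewrite expr1 in wl.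
have n0 : 0 < n by rewrite ltr0n expn_gt0.
case: reg => -[h1 h2 h3] h4 h5 [h6 h7] h8.
set a := n / (2 * d%:R ^+ 5).
have hn5 := @n_div 5 isT.
have aE : n / d%:R ^+ 5 = 2 * a by rewrite /a; field; rewrite gt_eqF.
have a2 : 2 <= a by rewrite aE in hn5; lra.
have cY : #|[set Y : {set V} | (#|Y| <= k0)%N]|%:R <= expR a.
  set y := 4 / d%:R ^+ 6 : R.
  have d6 : 0 < d%:R ^+ 6 :> R by rewrite exprn_gt0.
  have y0 : 0 < y by rewrite divr_gt0.
  have y1 : y <= 1.
    rewrite ler_pdivrMr // mul1r; apply: (@le_trans _ _ d%:R); first lra.
    by rewrite -[leLHS]expr1; apply: ler_weXn2l => //; rewrite ler1n.
  apply: (le_trans (@card_small_sets R _ k0 y y0 y1)).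
  rewrite card_ffun card_bool card_ord.
  apply: (@le_trans _ _ ((d%:R ^+ 6) ^+ k0 * expR (n * y))).
    apply: ler_pM; rewrite ?invr_ge0 ?exprn_ge0 ?addr_ge0 ?(ltW y0) //.
      rewrite -exprVn; apply: lerXn2r; rewrite ?nnegrE ?invr_ge0 ?(ltW y0) ?(ltW d6) //.
      by rewrite invf_div ler_pdivrMr // ler_peMr ?(ltW d6) //; lra.
    rewrite expRM_natl; apply: lerXn2r; rewrite ?nnegrE ?expR_ge0 ?addr_ge0 ?(ltW y0) //.
    exact: expR_ge1Dx.
  rewrite expR_pow_ln // -expRD ler_expR -h2.
  have hk : k0%:R <= 4 * n / d%:R ^+ 6.
    by rewrite ler_pdivlMr // -natrX -!natrM ler_nat; exact: leq_trunc_div.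
  have v20 : 0 <= v ^+ 2 by exact: sqr_ge0.
  apply: (@le_trans _ _ (6 * (4 * n / d%:R ^+ 6) * v ^+ 2 + n * y)).
    by rewrite lerD2r ler_wpM2r // ler_wpM2l.
  have -> : 6 * (4 * n / d%:R ^+ 6) * v ^+ 2 + n * y = (4 * n / d%:R ^+ 6) * (6 * v ^+ 2 + 1).
    by rewrite /y; field; rewrite gt_eqF.
  have -> : a = (4 * n / d%:R ^+ 6) * (d%:R / 8) by rewrite /a; field; rewrite gt_eqF.
  apply: ler_wpM2l; first by rewrite divr_ge0 ?mulr_ge0 // ltW.
  have : 2 * 10 ^+ 4 * w <= d%:R.
    rewrite -h1 (exprSr w 7); apply: ler_wpM2r; first exact: ltW w_gt0.
    exact: w_large.
  by move: h5; set b := v ^+ 2; lra.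
rewrite (bigID (fun A => n / d%:R ^+ 7 <= (gap A)%:R)) /=.
have big1 : \sum_(A : {set V} | (A \subset evens d) && (n / d%:R ^+ 7 <= (gap A)%:R))
   even_weight lambda A <= 1.
  apply: le_trans (large_gap_sum (lexx _)) _.
  have w0 := w_gt0; have mw := mu_w4'; have w40 : 0 < w ^+ 4 by rewrite exprn_gt0.
  have hd : 2 * d%:R <= mu / 16 * (n / d%:R ^+ 7).
    have -> : mu / 16 * (n / d%:R ^+ 7) = (mu * w ^+ 4) * (n / (16 * w ^+ 4 * d%:R ^+ 7)).
      by field; rewrite !gt_eqF.
    apply: (@le_trans _ _ (10 ^+ 7 * (n / (16 * w ^+ 4 * d%:R ^+ 7)))); last first.
      by apply: ler_wpM2r => //; rewrite divr_ge0 // ?mulr_ge0 // ?exprn_ge0 // ltW.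
    have hn8 := @n_div 8 isT.
    have : n / d%:R ^+ 8 <= n / (w ^+ 4 * d%:R ^+ 7).
      rewrite ler_wpM2l ?(ltW n0) // lef_pV2 ?posrE ?mulr_gt0 ?exprn_gt0 //.
      rewrite (exprS _ 7) ler_wpM2r ?exprn_ge0 // ?(ltW dR) // -h1.
      by apply: ler_weXn2l => //; lra.
    have -> : n / (16 * w ^+ 4 * d%:R ^+ 7) = n / (w ^+ 4 * d%:R ^+ 7) / 16.
      by field; rewrite !gt_eqF.
    by move: hn8; set b := n / d%:R ^+ 8; set c := n / (w ^+ 4 * _); lra.
  have := exp_d_le (lexx d%:R).
  move=> h; apply: le_trans (ler_wpM2r (expR_ge0 _) h) _.
  by rewrite -expRD -[leRHS]expR0 ler_expR; lra.
apply: le_trans (lerD big1 small_gap_sum) _.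
apply: (@le_trans _ _ (3 * expR a)).
  have : 1 <= expR a by rewrite -expR0 ler_expR; lra.
  by move: cY; set c := #|_|%:R; set b := expR a; lra.
rewrite aE (_ : 2 * a = a + a); last by ring.
rewrite expRD ler_wpM2r ?expR_ge0 //; apply: le_trans (expR_ge1Dx _); lra.
Qed.

Lemma cube_total :
  \sum_(I : {set V} | cindep I) lambda ^+ #|I|
  <= (1 + lambda) ^+ (2 ^ d.-1) * expR (n / d%:R ^+ 5).
Proof.
have := cube_sum_even lambda_pos (fun=> true) d_pos.
rewrite (eq_bigl (@cindep d)); last by move=> I; rewrite andbT.
rewrite [X in _ * X](eq_bigl (fun A => A \subset evens d)); last by move=> I; rewrite andbT.
move=> h; apply: (le_trans h); apply: ler_wpM2l; last exact: even_weight_total.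
by rewrite exprn_ge0 //; have := lambda_pos; lra.
Qed.

Variable k : nat.
Hypothesis kP : k%:R <= n / (16 * w ^+ 4) /\ n / (16 * w ^+ 4) < k.+1%:R.

(** By [kP], [k] is the integer part of [2^d / (16 * sqrt d)]. It is small enough that cubes with at
    most [k] points of one parity cannot account for a part of [N / (4 * sqrt d)] points of the
    torus. *)
Definition mixed I := (k < #|I :&: evens d|)%N && (k < #|I :&: odds d|)%N.
Definition thin I := [exists i, exists b, (#|I :&: face i b| <= 2 * k)%N].

(** The even part lies in its hull and the odd part outside it, so both the hull and its complement
    exceed [k]. Isoperimetry then forces a gap of at least [t], and large gaps have small weight. *)
Lemma mixed_sum :
  \sum_(I : {set V} | cindep I && mixed I) lambda ^+ #|I|
  <= (1 + lambda) ^+ (2 ^ d.-1) * expR (- (2 * (n / d%:R ^+ 2))).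
Proof.
have d0 := d_pos; have dR : 0 < d%:R :> R by rewrite ltr0n.
have l0 := lambda_pos; have w0 := w_gt0; have n0 : 0 < n by rewrite ltr0n expn_gt0.
have dl := d_large; case: reg => -[h1 h2 h3] h4 h5 [h6 h7] h8.
have dE : d%:R = w ^+ 4 * w ^+ 4 by rewrite -exprD h1.
set t := n / (64 * w ^+ 12).
pose Q A := t <= (gap A)%:R.
have w40 : 0 < w ^+ 4 by rewrite exprn_gt0.
have w12 : w ^+ 12 = w ^+ 4 * w ^+ 4 * w ^+ 4 by rewrite -!exprD.
apply: (@le_trans _ _ (\sum_(I : {set V} | cindep I && Q (I :&: evens d)) lambda ^+ #|I|)).
  rewrite [leLHS]big_mkcond [leRHS]big_mkcond /=; apply: ler_sum => I _.
  have lI : 0 <= lambda ^+ #|I| by rewrite exprn_ge0 // ltW.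
  case: ifP => [/andP[ind /andP[hA hB]]|_]; last by case: ifP.
  rewrite ind /= ifT // /Q.
  set A := I :&: evens d in hA *; set B := I :&: odds d in hB.
  have Ae : A \subset evens d by exact: subsetIr.
  have AW : (#|A| <= #|hull A|)%N.
    by apply: subset_leq_card; apply: subset_trans (sub_closure A) (subsetUl _ _).
  have BW : (#|B| <= 2 ^ d - #|hull A|)%N.
    have -> : (2 ^ d - #|hull A| = #|~: hull A|)%N.
      by have := cardsC (hull A); rewrite card_ffun card_bool card_ord => <-; rewrite addKn.
    apply: subset_leq_card; apply/subsetP => u; rewrite in_setI in_setC in_setU => /andP[uI uo].
    rewrite negb_or; apply/andP; split.
      by apply: contraL uo => /(closure_even d_ge4 Ae); rewrite in_set.
    apply/nbP => -[i]; rewrite in_setI => /andP[h9 _].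
    by have := cindepP _ ind u i uI; rewrite h9.
  have hW := hull_iso Ae.
  have hk : n / (16 * w ^+ 4) * n <= 2 * (#|hull A|%:R * (2 ^ d - #|hull A|)%:R).
    have b1 : n / (16 * w ^+ 4) <= #|hull A|%:R.
      by apply: le_trans (ltW (proj2 kP)) _; rewrite ler_nat; exact: leq_trans AW.
    have b2 : n / (16 * w ^+ 4) <= (2 ^ d - #|hull A|)%:R.
      by apply: le_trans (ltW (proj2 kP)) _; rewrite ler_nat; exact: leq_trans BW.
    have b3 : n = #|hull A|%:R + (2 ^ d - #|hull A|)%:R.
      rewrite -natrD subnKC //.
      by apply: leq_trans (max_card _) _; rewrite card_ffun card_bool card_ord.
    have c0 : 0 <= n / (16 * w ^+ 4) by rewrite divr_ge0 ?mulr_ge0 // ltW.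
    move: c0 b1 b2; set c := n / (16 * w ^+ 4); rewrite [X in c * X]b3; clearbody c.
    by move=> c0 b1 b2; apply: mul_two_sides.
  have hk2 : n / (16 * w ^+ 4) * n <= 4 * n * (d%:R * (gap A)%:R).
    apply: (le_trans hk).
    have : (#|hull A| * (2 ^ d - #|hull A|))%:R <= (2 * 2 ^ d * (d * gap A))%:R :> R by rewrite ler_nat.
    rewrite !natrM => h.
    have -> : 4 * n * (d%:R * (gap A)%:R) = 2 * (2 * n * (d%:R * (gap A)%:R)).
      by move: ((2 ^ d)%:R : R) (d%:R * _) => p q; ring.
    by rewrite ler_pM2l.
  have e1 : n / (16 * w ^+ 4) * n = 4 * n * (d%:R * t).
    by rewrite /t dE w12; field; rewrite gt_eqF.
  by move: hk2; rewrite e1 ler_pM2l ?mulr_gt0 // ler_pM2l.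
apply: (le_trans (cube_sum_even l0 Q d0)); apply: ler_wpM2l.
  by rewrite exprn_ge0 //; lra.
apply: (le_trans (large_gap_sum _)).
  rewrite /t ler_wpM2l ?(ltW n0) // lef_pV2 ?posrE ?mulr_gt0 ?exprn_gt0 //.
  have w24 : d%:R ^+ 3 <= d%:R ^+ 7 :> R by apply: ler_weXn2l => //; rewrite ler1n.
  apply: le_trans w24; rewrite (_ : d%:R ^+ 3 = w ^+ 12 * w ^+ 12); last by rewrite -h1 -exprM -exprD.
  rewrite ler_wpM2r ?exprn_ge0 ?(ltW w0) //.
  by apply: le_trans (w_large 11); lra.
have mw := mu_w4'.
have tE : 4 * (n / d%:R ^+ 2) <= mu / 16 * t.
  have -> : mu / 16 * t = (mu * w ^+ 4) * (n / d%:R ^+ 2 / (16 * 64)).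
    by rewrite /t w12 dE; field; rewrite gt_eqF.
  have c0 : 0 <= n / d%:R ^+ 2 by rewrite divr_ge0 ?exprn_ge0 // ltW.
  apply: (@le_trans _ _ (10 ^+ 7 * (n / d%:R ^+ 2 / (16 * 64)))); first by lra.
  by apply: ler_wpM2r => //; rewrite divr_ge0 // mulr_ge0.
have := exp_d_le (@n_div 2 isT) => h; apply: le_trans (ler_wpM2r (expR_ge0 _) h) _.
by rewrite -expRD ler_expR; move: tE; set c := n / _; lra.
Qed.

End CubeEstimates.

Lemma thin_exponent (R : realFieldType) (N m : R) : 0 <= m * N ->
  m / (8 * 10 ^+ 7) * N + (N * (m / 80) + - (m / 32 * N)) <= - (m / 100 * N).
Proof. by move=> h; lra. Qed.

Lemma gain_face (R : realType) (d : nat) (lambda : R) : (1 < d)%N -> 0 < lambda ->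
  (1 + 2 * lambda) ^+ (2 ^ d.-2) = (1 + lambda) ^+ (2 ^ d.-1) * gain lambda ^+ (2 ^ d.-2).
Proof.
move=> d1 l0; have l1 : 0 < 1 + lambda by lra.
have -> : (2 ^ d.-1 = 2 * 2 ^ d.-2)%N.
  by case: d d1 => [|[|d']] // _; rewrite expnS.
rewrite exprM -exprMn /gain; congr (_ ^+ _); field.
by rewrite gt_eqF.
Qed.

Lemma scale_exponent (R : realFieldType) (a c m : R) :
  10 ^+ 7 * a <= m * c -> a <= m / (8 * 10 ^+ 7) * (8 * c).
Proof. by move=> h; lra. Qed.

Lemma leq_double_sub (p x : nat) : (2 * x <= p -> p <= 2 * (p - x))%N.
Proof. lia. Qed.

Lemma quarter_exponent (R : realFieldType) (m p q : R) :
  0 < m -> p <= 2 * q -> m / 32 * (4 * p) <= m / 4 * q.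
Proof. by move=> m0 pq; have := ler_wpM2l (ltW m0) pq; lra. Qed.

Lemma small_subsets_sum (R : realFieldType) (V : finType) (S : {set V}) (m : nat) (lambda z : R) :
  0 < lambda -> 0 < z -> z <= 1 ->
  \sum_(A : {set V} | (A \subset S) && (#|A| <= m)%N) lambda ^+ #|A|
  <= z^-1 ^+ m * (1 + z * lambda) ^+ #|S|.
Proof.
move=> l0 z0 z1; rewrite -sum_subsets_pow mulr_sumr big_mkcondr /=.
apply: ler_sum => A _; rewrite exprMn mulrA; case: ifP => [Am|_]; last first.
  by rewrite mulr_ge0 ?exprn_ge0 ?(ltW l0) // mulr_ge0 // exprn_ge0 // ?invr_ge0 ltW.
rewrite ler_peMl ?exprn_ge0 ?(ltW l0) // exprVn mulrC ler_pdivlMr ?exprn_gt0 // mul1r.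
by apply: ler_wiXn2l => //; exact: ltW.
Qed.

Section ThinFaces.
Variables (R : realType) (d : nat) (lambda w v : R) (k : nat).
Hypothesis reg : regime d lambda w v.
Local Notation V := {ffun 'I_d -> bool}.
Local Notation n := ((2 ^ d)%:R : R).
Local Notation mu := (Num.min 1 (lambda ^+ 2)).
Hypothesis kP : k%:R <= n / (16 * w ^+ 4) /\ n / (16 * w ^+ 4) < k.+1%:R.

Lemma mu_le_lambda : mu <= lambda.
Proof. by have l0 := lambda_pos reg; rewrite /Num.min; case: ifP => h; nra. Qed.

Lemma lambda_w2 : 1 <= Num.min 1 lambda * w ^+ 2.
Proof.
have l0 := lambda_pos reg; have w0 := w_gt0 reg; have wl := w_large reg 1.
have mw := mu_w4' reg; rewrite {1}/Num.min; case: ifP => h; first by lra.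
move: h => /negbT; rewrite -leNgt => h.
rewrite -ler_sqr ?nnegrE ?mulr_ge0 ?exprn_ge0 ?(ltW l0) ?(ltW w0) //.
rewrite expr1n exprMn -exprM; apply: (@le_trans _ _ (10 ^+ 7)); first lra.
apply: le_trans mw _; rewrite ler_wpM2r ?exprn_ge0 ?(ltW w0) //.
by rewrite ge_min lexx orbT.
Qed.

Lemma thin_gain : (1 + lambda) ^+ (2 * k) * gain lambda ^+ (2 ^ d.-2) <= expR (- (mu / 32 * n)).
Proof.
have l0 := lambda_pos reg; have w0 := w_gt0 reg; have l1 : 0 < 1 + lambda by lra.
have g0 := gain_gt0 l0; have lw := lambda_w2.
set ll := Num.min 1 lambda in lw.
have ll0 : 0 < ll by rewrite lt_min ltr01.
have [|K [K1 K2]] := @nat_ceil R (3 / ll); first by rewrite divr_ge0 // ltW.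
have hK : (1 + lambda) * gain lambda ^+ K <= 1.
  by apply: one_plus_le_gain => //; rewrite mulrC -ler_pdivrMr.
have w2 := w_large reg 1.
have n0 : 0 < n by rewrite ltr0n expn_gt0.
have n4 : n = 4 * (2 ^ d.-2)%:R.
  rewrite -natrM; congr (_%:R); have := d_ge4 reg => d4.
  by rewrite -[in LHS](subnK (ltnW (ltnW d4))) subn2 addn2 !expnS mulnA.
have hKm : (2 * (K * (2 * k)) <= 2 ^ d.-2)%N.
  rewrite -(ler_nat R) !natrM.
  have K3 : K%:R <= 4 * w ^+ 2.
    apply: (le_trans K2); have : 3 / ll <= 3 * w ^+ 2.
      by rewrite ler_pdivrMr // -mulrA ler_peMr // mulrC.
    by lra.
  have k3 : k%:R <= (2 ^ d.-2)%:R / (4 * w ^+ 4).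
    apply: le_trans (proj1 kP) _; rewrite n4 le_eqVlt; apply/orP; left; apply/eqP.
    by field; rewrite gt_eqF.
  have e : K%:R * k%:R <= (4 * w ^+ 2) * ((2 ^ d.-2)%:R / (4 * w ^+ 4)) by exact: ler_pM.
  have e2 : (4 * w ^+ 2) * ((2 ^ d.-2)%:R / (4 * w ^+ 4)) * w ^+ 2 = (2 ^ d.-2)%:R.
    by field; rewrite gt_eqF.
  have e3 : K%:R * k%:R * w ^+ 2 <= (2 ^ d.-2)%:R.
    by rewrite -e2; apply: ler_wpM2r => //; rewrite exprn_ge0 // ltW.
  apply: le_trans e3.
  have -> : 2 * (K%:R * (2 * k%:R)) = K%:R * k%:R * 4 :> R by ring.
  by apply: ler_wpM2l; [rewrite mulr_ge0 | lra].
have Kle : (K * (2 * k) <= 2 ^ d.-2)%N := leq_trans (leq_pmull _ (isT : 0 < 2)%N) hKm.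
rewrite -(subnK Kle) addnC exprD (exprM (gain lambda)) mulrA -exprMn.
apply: (@le_trans _ _ (1 * gain lambda ^+ (2 ^ d.-2 - K * (2 * k)))).
  apply: ler_wpM2r; first by rewrite exprn_ge0 // ltW.
  by apply: exprn_ile1 => //; rewrite mulr_ge0 // ?exprn_ge0 // ltW.
rewrite mul1r; apply: le_trans (gain_expR _ l0) _; rewrite ler_expR lerN2 n4.
have hh : (2 ^ d.-2)%:R <= 2 * (2 ^ d.-2 - K * (2 * k))%:R :> R.
  by rewrite -natrM ler_nat leq_double_sub.
exact: quarter_exponent (mu_gt0 reg) hh.
Qed.

(** The opposite face has weight at most [(1 + 2 * lambda) ^ (n / 4)], which is a factor
    [gain ^ (n / 4)] below the ground state weight [(1 + lambda) ^ (n / 2)]; the few points on the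
    thin face cannot make up for it. *)
Lemma thin_face_sum i b :
  \sum_(I : {set V} | cindep I && (#|I :&: face i b| <= 2 * k)%N) lambda ^+ #|I|
  <= (1 + lambda) ^+ (2 ^ d.-1) * expR (- (mu / 100 * n)).
Proof.
have l0 := lambda_pos reg; have w0 := w_gt0 reg; have l1 : 0 < 1 + lambda by lra.
have m0 := mu_gt0 reg; have ml := mu_le_lambda; have d4 := d_ge4 reg.
have d1 : (1 < d)%N by lia.
have n0 : 0 < n by rewrite ltr0n expn_gt0.
have [j ij] : exists j : 'I_d, i != j.
  have hd : (1 < #|'I_d|)%N by rewrite card_ord.
  case/card_gt1P: hd => j1 [j2 [_ _ j12]]; have [e|] := eqVneq i j1; last by exists j1.
  by exists j2; rewrite e.
apply: (le_trans (@face_sum R d lambda l0 (fun A => (#|A| <= 2 * k)%N) i j b d1 ij)).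
(* Chernoff parameter: [(1 + z * lambda) ^ n] costs less than the factor gained from [gain], while
   [z^-1] is at most [d * (1 + lambda)], which is affordable to the power [2 * k]. *)
set z := mu / (80 * lambda).
have z0 : 0 < z by rewrite divr_gt0 // mulr_gt0.
have z1 : z <= 1 by rewrite ler_pdivrMr ?mulr_gt0 // mul1r; lra.
have zl : z * lambda = mu / 80 by rewrite /z; field; rewrite gt_eqF.
have zi : z^-1 <= d%:R * (1 + lambda).
  have dE : d%:R = w ^+ 4 * w ^+ 4 by case: reg => -[<- _ _] *; rewrite -exprD.
  rewrite /z invf_div ler_pdivrMr //.
  have mw := mu_w4' reg; have w4 := w_large reg 3.
  have -> : d%:R * (1 + lambda) * mu = (mu * w ^+ 4) * (w ^+ 4 * (1 + lambda)) by rewrite dE; ring.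
  apply: ler_pM; [lra|lra|lra|].
  by apply: (@le_trans _ _ (1 * (1 + lambda))); [lra | apply: ler_wpM2r; lra].
have s1 := @small_subsets_sum R _ (face i b) (2 * k) lambda z l0 z0 z1.
have fn : (#|face i b| <= 2 ^ d)%N.
  by apply: leq_trans (max_card _) _; rewrite card_ffun card_bool card_ord.
have s2 : (1 + z * lambda) ^+ #|face i b| <= expR (n * (mu / 80)).
  rewrite zl; apply: (@le_trans _ _ ((1 + mu / 80) ^+ (2 ^ d))).
    by apply: (ler_weXn2l _ fn); rewrite lerDl divr_ge0 // ltW.
  rewrite expRM_natl; apply: lerXn2r; rewrite ?nnegrE ?expR_ge0 //.
    by rewrite addr_ge0 // divr_ge0 // ltW.
  exact: expR_ge1Dx.
have s3 : z^-1 ^+ (2 * k) <= expR (mu / (8 * 10 ^+ 7) * n) * (1 + lambda) ^+ (2 * k).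
  apply: (@le_trans _ _ ((d%:R * (1 + lambda)) ^+ (2 * k))).
    apply: lerXn2r; [|  |exact: zi]; rewrite nnegrE; first by rewrite invr_ge0 ltW.
    by apply: mulr_ge0; [exact: ler0n | exact: ltW].
  rewrite exprMn; apply: ler_wpM2r; first by rewrite exprn_ge0 // ltW.
  have dR : 0 < d%:R :> R by rewrite ltr0n (d_pos reg).
  rewrite -[d%:R]expr1 expR_pow_ln // ler_expR mul1r.
  case: (reg) => -[_ <- _] v1 _ _ _.
  rewrite natrM; have k2 := proj1 kP; have mw := mu_w4 reg.
  have w40 : 0 < w ^+ 4 by rewrite exprn_gt0.
  apply: (@le_trans _ _ (2 * (n / (16 * w ^+ 4)) * v ^+ 3)).
    have hk0 : 0 <= 2 * k%:R :> R by rewrite mulr_ge0.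
    have hk2 : 2 * k%:R <= 2 * (n / (16 * w ^+ 4)) by apply: ler_wpM2l.
    have hv : v ^+ 2 <= v ^+ 3 by exact: ler_weXn2l.
    exact: (ler_pM hk0 (sqr_ge0 v) hk2 hv).
  have -> : 2 * (n / (16 * w ^+ 4)) * v ^+ 3 = n * (v ^+ 3 / (8 * w ^+ 4)).
    by field; rewrite gt_eqF.
  rewrite mulrC; apply: ler_wpM2r; first exact: ltW.
  rewrite ler_pdivrMr ?mulr_gt0 //; exact: scale_exponent mw.
have gE := gain_face d1 l0.
rewrite gE mulrCA; apply: ler_wpM2l; first by rewrite exprn_ge0 // ltW.
have g0 := gain_gt0 l0.
have tg := thin_gain.
apply: (@le_trans _ _ (expR (mu / (8 * 10 ^+ 7) * n) * (1 + lambda) ^+ (2 * k)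
    * expR (n * (mu / 80)) * gain lambda ^+ (2 ^ d.-2))).
  apply: ler_wpM2r; first by rewrite exprn_ge0 // ltW.
  apply: (le_trans s1); apply: ler_pM; [| |exact: s3|exact: s2].
    by rewrite exprn_ge0 // invr_ge0 ltW.
  by apply: exprn_ge0; rewrite zl addr_ge0 // divr_ge0 // ltW.
have assoc (p q r t : R) : p * q * r * t = p * (r * (q * t)) by ring.
rewrite assoc.
apply: (@le_trans _ _ (expR (mu / (8 * 10 ^+ 7) * n) * (expR (n * (mu / 80)) * expR (- (mu / 32 * n))))).
  by apply: ler_wpM2l; [exact: expR_ge0 | apply: ler_wpM2l; [exact: expR_ge0 | exact: tg]].
rewrite -!expRD ler_expR.
by apply: thin_exponent; rewrite mulr_ge0 // ltW.
Qed.

Lemma bad_sum :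
  \sum_(I : {set V} | cindep I && (mixed k I || thin k I)) lambda ^+ #|I|
  <= (1 + lambda) ^+ (2 ^ d.-1) * expR (- (n / d%:R ^+ 2)).
Proof.
have l0 := lambda_pos reg; have w0 := w_gt0 reg; have l1 : 0 < 1 + lambda by lra.
have n0 : 0 < n by rewrite ltr0n expn_gt0.
have dR : 0 < d%:R :> R by rewrite ltr0n (d_pos reg).
have m0 := mu_gt0 reg.
set a := n / d%:R ^+ 2.
have da : d%:R <= a by exact: (n_div reg).
have dl := d_large reg.
have mn : 3 * a <= mu / 100 * n.
  have -> : mu / 100 * n = (mu * w ^+ 4) * (w ^+ 12 / 100 * a).
    have dE : d%:R = w ^+ 4 * w ^+ 4 by case: reg => -[<- _ _] *; rewrite -exprD.
    by rewrite /a dE; field; rewrite gt_eqF.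
  have mw := mu_w4' reg; have w12 := w_large reg 11.
  have a0 : 0 <= a by lra.
  apply: (@le_trans _ _ (10 ^+ 7 * (1 * a))); first by lra.
  apply: ler_pM => //; [by rewrite mul1r | apply: ler_wpM2r => //; lra].
have l2 I : 0 <= lambda ^+ #|I : {set V}| by rewrite exprn_ge0 // ltW.
have thin_sum : \sum_(I : {set V} | cindep I && thin k I) lambda ^+ #|I|
   <= d%:R * (2 * ((1 + lambda) ^+ (2 ^ d.-1) * expR (- (mu / 100 * n)))).
  apply: (@le_trans _ _ (\sum_(i < d) \sum_(b : bool)
     \sum_(I : {set V} | cindep I && (#|I :&: face i b| <= 2 * k)%N) lambda ^+ #|I|)).
    have -> : \sum_(i < d) \sum_(b : bool)
       \sum_(I : {set V} | cindep I && (#|I :&: face i b| <= 2 * k)%N) lambda ^+ #|I|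
     = \sum_(I : {set V}) \sum_(i < d) \sum_(b : bool)
         if cindep I && (#|I :&: face i b| <= 2 * k)%N then lambda ^+ #|I| else 0.
      rewrite [RHS]exchange_big; apply: eq_bigr => i _ /=.
      by rewrite [RHS]exchange_big; apply: eq_bigr => b _; rewrite /= -big_mkcond.
    rewrite big_mkcond; apply: ler_sum => I _.
    have nn i b : 0 <= if cindep I && (#|I :&: face i b| <= 2 * k)%N then lambda ^+ #|I| else 0.
      by case: ifP.
    case: ifP => [/andP[ind /existsP[i /existsP[b hb]]]|_].
      rewrite (bigD1 i) //= (bigD1 b) //= ind hb /= -addrA lerDl addr_ge0 //.
        by apply: sumr_ge0 => *; case: ifP.
      by apply: sumr_ge0 => *; apply: sumr_ge0 => *; case: ifP.
    by apply: sumr_ge0 => i _; apply: sumr_ge0 => *; exact: nn.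
  rewrite -[X in X%:R * _](card_ord d) mulr_natl -sumr_const; apply: ler_sum => i _.
  rewrite big_bool mulr_natl mulr2n; apply: lerD; exact: thin_face_sum.
have lM : 0 <= (1 + lambda) ^+ (2 ^ d.-1) by rewrite exprn_ge0 // ltW.
apply: (@le_trans _ _ ((1 + lambda) ^+ (2 ^ d.-1) * expR (- (2 * a)) + d%:R * (2 * ((1 + lambda) ^+ (2 ^ d.-1) * expR (- (mu / 100 * n)))))).
  apply: le_trans (lerD (mixed_sum reg kP) thin_sum).
  rewrite [X in _ <= X + _]big_mkcond [X in _ <= _ + X]big_mkcond -big_split big_mkcond /=.
  apply: ler_sum => I _; case: (cindep I); rewrite ?addr0 //=.
  by case: (mixed k I); case: (thin k I); rewrite /= ?addr0 ?add0r // lerDl.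
rewrite (_ : d%:R * _ = (1 + lambda) ^+ (2 ^ d.-1) * (2 * d%:R * expR (- (mu / 100 * n)))); last by ring.
rewrite -mulrDr; apply: ler_wpM2l => //.
have h2d : 2 * d%:R <= expR a.
  apply: (@le_trans _ _ (expR d%:R)); last by rewrite ler_expR.
  apply: le_trans (n_le_exp R d); rewrite -natrM ler_nat; have d4 := d_ge4 reg.
  have : (d <= 2 ^ d.-1)%N by rewrite -{1}(ltn_predK d4) ltn_expl.
  by rewrite (pow2_pred (d_pos reg)); lia.
have : 2 * d%:R * expR (- (mu / 100 * n)) <= expR a * expR (- (3 * a)).
  by apply: ler_pM; rewrite ?expR_ge0 ?mulr_ge0 // ler_expR lerN2.
rewrite -expRD (_ : a + - (3 * a) = - (2 * a)); last by ring.
move=> h; apply: (@le_trans _ _ (2 * expR (- (2 * a)))); first by lra.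
have : 2 <= expR a by apply: le_trans (expR_ge1Dx a); lra.
rewrite (_ : - (2 * a) = - a + - a); last by ring.
rewrite expRD => h2.
have e1 : expR a * expR (- a) = 1 by rewrite -expRD subrr expR0.
have e2 : 0 <= expR (- a) by exact: expR_ge0.
have := ler_wpM2r e2 h2; rewrite e1 => h3.
by rewrite mulrA -[leRHS]mul1r; apply: ler_wpM2r.
Qed.

End ThinFaces.

(** * Reflection positivity and the chessboard estimate on the torus *)

Lemma cauchy_schwarz_sum (R : realFieldType) (I : finType) (P : pred I) (c a b : I -> R) :
  (forall i, P i -> 0 <= c i) ->
  (\sum_(i | P i) c i * (a i * b i)) ^+ 2
  <= (\sum_(i | P i) c i * a i ^+ 2) * (\sum_(i | P i) c i * b i ^+ 2).
Proof.
move=> c0; rewrite -subr_ge0.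
suff -> : (\sum_(i | P i) c i * a i ^+ 2) * (\sum_(i | P i) c i * b i ^+ 2)
   - (\sum_(i | P i) c i * (a i * b i)) ^+ 2
   = 2^-1 * \sum_(i | P i) \sum_(j | P j) c i * c j * (a i * b j - a j * b i) ^+ 2.
  rewrite mulr_ge0 // sumr_ge0 // => i Pi; apply: sumr_ge0 => j Pj.
  by rewrite mulr_ge0 ?sqr_ge0 // mulr_ge0 // c0.
set X := \sum_(i | P i) c i * a i ^+ 2; set Y := \sum_(i | P i) c i * b i ^+ 2.
set Z := \sum_(i | P i) c i * (a i * b i).
have -> : \sum_(i | P i) \sum_(j | P j) c i * c j * (a i * b j - a j * b i) ^+ 2
  = \sum_(i | P i) (c i * a i ^+ 2 * Y + c i * b i ^+ 2 * X - 2 * (c i * (a i * b i)) * Z).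
  apply: eq_bigr => i _; rewrite !mulr_sumr -big_split -sumrB; apply: eq_bigr => j _ /=.
  ring.
by rewrite sumrB big_split /= -!mulr_suml -mulr_sumr -/X -/Y -/Z; field.
Qed.

(* Reflection positivity of the hard-core model: [theta] reflects the vertex set, [H] is one
   closed half, the fixed vertices of the reflection separate the two halves, and [tau]
   reflects the labels of the observables [f], half of which ([left]) live on [H]. *)
Section ReflectionPositivity.
Variables (R : realFieldType) (T : finType) (e : rel T) (lambda : R).
Variables (theta tau : T -> T) (H left : {set T}) (f : T -> {set T} -> R).
Implicit Types (I X Y S s A : {set T}).
Hypothesis lambda_gt0 : 0 < lambda.
Hypotheses (thetaK : involutive theta) (tauK : involutive tau).
Hypothesis H_cover : forall x, (x \in H) || (theta x \in H).
Hypothesis H_fix : forall x, x \in H -> theta x \in H -> theta x = x.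
Hypothesis e_theta : forall x y, e (theta x) (theta y) = e x y.
Hypothesis e_half : forall x y, e x y -> (x \in H) && (y \in H) || (theta x \in H) && (theta y \in H).
Hypothesis left_tau : forall x, (tau x \in left) = (x \notin left).
Hypothesis f_left : forall x I, x \in left -> f x I = f x (I :&: H).
Hypothesis f_tau : forall x I, f (tau x) (theta @: I) = f x I.

Definition observable_sum S := \sum_(I : {set T} | independent e I)
  lambda ^+ #|I| * \prod_(x in S) f x I.

Let P := [set x in H | theta x \in H].
Let X0 := [set x in H | theta x \notin H].
Let Y0 := [set x | x \notin H].
Let th (I : {set T}) := theta @: I.

Let th_mem I x : (theta x \in th I) = (x \in I).
Proof. by rewrite mem_imset //; exact: inv_inj. Qed.

Let thK I : th (th I) = I.
Proof. by apply/setP => x; rewrite -{1}(thetaK x) !th_mem. Qed.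

Let th_card I : #|th I| = #|I|.
Proof. by rewrite card_imset //; exact: inv_inj. Qed.

Let indepP I : reflect (forall x y, x \in I -> y \in I -> ~~ e x y) (independent e I).
Proof.
apply: (iffP forall_inP) => [h x y xI yI|h x xI]; first exact: (forall_inP (h x xI)).
by apply/forall_inP => y; apply: h.
Qed.

Let part S s X : R :=
  if independent e (s :|: X) then lambda ^+ #|X| * \prod_(x in S :&: left) f x (s :|: X) else 0.

Let U S s := \sum_(X : {set T} | X \subset X0) part S s X.

Let fix_s s : s \subset P -> th s = s.
Proof.
move=> sP; have fx x : x \in s -> theta x = x.
  by move=> /(subsetP sP); rewrite inE => /andP[]; exact: H_fix.
apply/setP => x; apply/imsetP/idP => [[y ys ->]|xs]; first by rewrite fx.
by exists x; rewrite ?fx.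
Qed.

Let thY Y : (th Y \subset X0) = (Y \subset Y0).
Proof.
apply/subsetP/subsetP => h x.
  move=> xY; have := h (theta x); rewrite th_mem => /(_ xY).
  by rewrite !inE thetaK => /andP[].
move=> xY; have := h (theta x); rewrite -th_mem thetaK => /(_ xY); rewrite !inE => xH.
by rewrite xH andbT; have := H_cover x; rewrite (negPf xH) orbF.
Qed.

(** Given the configuration [s] on the fixed vertices the two halves are independent; the right
    half, transported by [theta], is a left half with labels [tau @: S]. *)
Lemma observable_sumE S : observable_sum S
  = \sum_(s : {set T} | s \subset P) lambda ^+ #|s| * (U S s * U (tau @: S) s).
Proof.
have d1 : [disjoint P & X0 :|: Y0].
  rewrite -setI_eq0; apply/eqP/setP => x; rewrite /P /X0 /Y0 !in_setI in_setU !in_set.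
  by case: (x \in H); case: (theta x \in H).
have d2 : [disjoint X0 & Y0].
  rewrite -setI_eq0; apply/eqP/setP => x; rewrite /X0 /Y0 !in_setI !in_set.
  by case: (x \in H); rewrite ?andbF.
have cov : P :|: (X0 :|: Y0) = [set: T].
  apply/setP => x; rewrite /P /X0 /Y0 !in_setU !in_set.
  by case: (x \in H); case: (theta x \in H).
pose F (I : {set T}) := if independent e I then lambda ^+ #|I| * \prod_(x in S) f x I else 0.
have -> : observable_sum S = \sum_(I : {set T} | I \subset P :|: (X0 :|: Y0)) F I.
  by rewrite /observable_sum big_mkcond [RHS]big_mkcond cov; apply: eq_bigr => I _; rewrite subsetT.
rewrite sum_subsetsU //; apply: eq_bigr => s sP.
rewrite sum_subsetsU // /U big_distrlr mulr_sumr /=; apply: eq_bigr => X XX.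
rewrite mulr_sumr (reindex_inj (inv_inj thK)) /=.
apply: eq_big => [Y|Y YY]; first by rewrite -thY thK.
have YY' : th Y \subset Y0 by [].
have XH : s :|: X \subset H.
  rewrite subUset; apply/andP; split; apply/subsetP => x.
    by move=> /(subsetP sP); rewrite inE => /andP[].
  by move=> /(subsetP XX); rewrite inE => /andP[].
have YH : s :|: Y \subset H.
  rewrite subUset; apply/andP; split; apply/subsetP => x.
    by move=> /(subsetP sP); rewrite inE => /andP[].
  move: YY'; rewrite -thY thK => /subsetP YX /YX.
  by rewrite inE => /andP[].
have IH : (s :|: (X :|: th Y)) :&: H = s :|: X.
  apply/setP => x; rewrite !inE; case xH: (x \in H); rewrite ?andbT ?andbF.
    suff -> : (x \in th Y) = false by rewrite orbF.
    by apply/negbTE; apply: contraTN xH => /(subsetP YY'); rewrite inE.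
  by apply/esym/negbTE; apply: contraFN xH => h; apply: (subsetP XH); rewrite inE.
have Ith : th (s :|: (X :|: th Y)) :&: H = s :|: Y.
  have -> : th (s :|: (X :|: th Y)) = s :|: (th X :|: Y).
    by rewrite /th !imsetU -/(th _) -/(th _) -/(th _) thK fix_s.
  apply/setP => x; rewrite !inE; case xH: (x \in H); rewrite ?andbT ?andbF.
    suff -> : (x \in th X) = false by [].
    apply/negbTE/imsetP => -[y /(subsetP XX)]; rewrite inE => /andP[yH tyH] xE.
    by rewrite -xE xH in tyH.
  by apply/esym/negbTE; apply: contraFN xH => h; apply: (subsetP YH); rewrite inE.
set I := s :|: (X :|: th Y) in IH Ith *.
have indE : independent e I = independent e (s :|: X) && independent e (s :|: Y).
  apply/idP/andP => [/indepP h|[/indepP hX /indepP hY]].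
    split; first by apply/indepP => x y; rewrite -IH !in_setI => /andP[xI _] /andP[yI _]; apply: h.
    apply/indepP => x y; rewrite -Ith !in_setI => /andP[xI _] /andP[yI _].
    rewrite -(thetaK x) -(thetaK y) e_theta; apply: h.
      by rewrite -th_mem thetaK.
    by rewrite -th_mem thetaK.
  apply/indepP => x y xI yI; apply/negP => exy.
  case/orP: (e_half exy) => /andP[xH yH].
    by have := hX x y; rewrite -IH !in_setI xI yI xH yH exy => /(_ isT isT).
  have := hY (theta x) (theta y); rewrite -Ith !in_setI !th_mem xI yI xH yH e_theta exy.
  by move=> /(_ isT isT).
have cardE : #|I| = (#|s| + (#|X| + #|Y|))%N.
  have dsX : [disjoint s & X :|: th Y].
    apply: disjointWl sP _; apply: disjointWr d1; exact: setUSS.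
  have dXY : [disjoint X & th Y] by apply: disjointWl XX _; apply: disjointWr YY' d2.
  by rewrite /I cardsU disjoint_setI0 // cards0 subn0 cardsU disjoint_setI0 // cards0 subn0 th_card.
have prodE : \prod_(x in S) f x I
   = \prod_(x in S :&: left) f x (s :|: X) * \prod_(x in tau @: S :&: left) f x (s :|: Y).
  rewrite (bigID (mem left)) /=; congr (_ * _).
    apply: eq_big => [x|x /andP[_ xl]]; first by rewrite in_setI.
    by rewrite f_left // IH.
  rewrite (reindex_inj (inv_inj tauK)) /=; apply: eq_big => [x|x /andP[_]].
    rewrite in_setI left_tau negbK; congr (_ && _).
    by rewrite -{2}(tauK x) mem_imset //; exact: inv_inj.
  rewrite left_tau negbK => xl; rewrite -[I]thK f_tau f_left //.
  by rewrite Ith.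
rewrite /F indE /part.
case: (independent e (s :|: X)); rewrite ?mul0r ?mulr0 //=.
case: (independent e (s :|: Y)); rewrite ?mul0r ?mulr0 //=.
by rewrite cardE prodE !exprD; ring.
Qed.

Definition fold_left S := [set x | (if x \in left then x else tau x) \in S].
Definition fold_right S := [set x | (if x \in left then tau x else x) \in S].

Let U_ext S S' s : S :&: left = S' :&: left -> U S s = U S' s.
Proof. by move=> h; apply: eq_bigr => X _; rewrite /part h. Qed.

Lemma reflection_positivity S :
  observable_sum S ^+ 2 <= observable_sum (fold_left S) * observable_sum (fold_right S).
Proof.
have tm A x : (x \in tau @: A) = (tau x \in A).
  by rewrite -{1}(tauK x) mem_imset //; exact: inv_inj.
have eL1 : fold_left S :&: left = S :&: left.
  by apply/setP => x; rewrite !inE; case: (x \in left); rewrite ?andbF.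
have eL2 : tau @: fold_left S :&: left = S :&: left.
  apply/setP => x; rewrite !inE tm inE left_tau tauK.
  by case: (x \in left); rewrite ?andbF.
have eR1 : fold_right S :&: left = tau @: S :&: left.
  by apply/setP => x; rewrite !inE tm; case: (x \in left); rewrite ?andbF.
have eR2 : tau @: fold_right S :&: left = tau @: S :&: left.
  by apply/setP => x; rewrite !inE !tm inE left_tau; case: (x \in left); rewrite ?andbF.
rewrite !observable_sumE.
under [X in _ <= X * _]eq_bigr => s _ do rewrite (U_ext s eL1) (U_ext s eL2) -expr2.
under [X in _ <= _ * X]eq_bigr => s _ do rewrite (U_ext s eR1) (U_ext s eR2) -expr2.
by apply: cauchy_schwarz_sum => s _; rewrite exprn_ge0 // ltW.
Qed.

Lemma card_folds S : (#|fold_left S| + #|fold_right S| = 2 * #|S|)%N.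
Proof.
have cE A : #|A| = (#|A :&: left| + #|A :\: left|)%N by rewrite cardsID.
have h1 : #|fold_left S :&: left| = #|S :&: left|.
  by apply: eq_card => x; rewrite !inE; case: (x \in left); rewrite ?andbF.
have h2 : #|fold_left S :\: left| = #|S :&: left|.
  rewrite -[RHS](card_imset _ (inv_inj tauK)); apply: eq_card => x.
  rewrite -{2}(tauK x) mem_imset; last exact: inv_inj.
  by rewrite !inE left_tau; case: (x \in left); rewrite ?andbF //= andbT.
have h3 : #|fold_right S :\: left| = #|S :\: left|.
  by apply: eq_card => x; rewrite !inE; case: (x \in left).
have h4 : #|fold_right S :&: left| = #|S :\: left|.
  rewrite -[RHS](card_imset _ (inv_inj tauK)); apply: eq_card => x.
  rewrite -{2}(tauK x) mem_imset; last exact: inv_inj.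
  by rewrite !inE left_tau; case: (x \in left); rewrite ?andbF //= andbT.
by rewrite (cE (fold_left S)) (cE (fold_right S)) h1 h2 h3 h4 (cE S) mul2n -addnn addnACA.
Qed.

End ReflectionPositivity.

(** * Reflections of the torus and the chessboard estimate *)

Section Torus.
Variables (d L' h : nat).
Hypotheses (L_even : L'.+2 = h.*2) (h_ge2 : (2 <= h)%N).
Local Notation L := L'.+2.
Local Notation Z := 'I_L'.+2.
Local Notation T := {ffun 'I_d -> 'I_L'.+2}.
Local Notation cube := {ffun 'I_d -> bool}.
Local Notation tadj := (@torus_adj L'.+2 d).
Implicit Types (x y t : T) (a b c : Z) (i j : 'I_d) (I S : {set T}) (eps : cube).

Definition zp (n : nat) : Z := inZp n.

Lemma zpD m n : zp (m + n) = zp m + zp n.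
Proof. by apply/val_inj; rewrite /= modnDm. Qed.

Lemma zpL : zp L = 0. Proof. by apply/val_inj; rewrite /= modnn. Qed.
Lemma zp0 : zp 0 = 0. Proof. by apply/val_inj; rewrite /= mod0n. Qed.
Lemma zp_val a : zp (val a) = a. Proof. exact: valZpK. Qed.
Lemma val_zp n : (n < L)%N -> val (zp n) = n. Proof. exact: modn_small. Qed.

Lemma val_lt c : (val c < L)%N. Proof. exact: ltn_ord. Qed.

Lemma zp_split c a : c = a + zp (val (c - a)%R).
Proof. by rewrite zp_val addrC subrK. Qed.

Lemma zp_opp n : (n <= L)%N -> - zp n = zp (L - n).
Proof.
move=> nL; apply/eqP; rewrite eq_sym -subr_eq0 opprK -zpD subnK //.
by rewrite zpL.
Qed.

Lemma val_opp a : val a != 0%N -> val (- a) = (L - val a)%N.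
Proof.
move=> a0; rewrite -{1}(zp_val a) zp_opp ?val_zp //; last exact: ltnW (ltn_ord a).
by rewrite ltn_subrL lt0n a0.
Qed.

Lemma zp1_neq0 : zp 1 != 0.
Proof. by apply/eqP => /(congr1 val); rewrite val_zp //; lia. Qed.

Definition unitv i : T := [ffun j => if j == i then zp 1 else 0].
Definition vec eps : T := [ffun j => zp (eps j)].

Lemma torus_adjP x y :
  reflect (exists i, y = x + unitv i \/ x = y + unitv i) (tadj x y).
Proof.
have addE z i j : (z + unitv i : T) j = if j == i then z j + zp 1 else z j.
  by rewrite !ffunE; case: eqP => // _; rewrite addr0.
have mE a b : (a.+1 == b %[mod L])%N = (b == a + zp 1).
  rewrite -{2}(zp_val a) -zpD addn1 -val_eqE /= eq_sym; congr (_ == _).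
  by rewrite modn_small.
have ne z : (z != z + zp 1 :> Z).
  by apply: contraNneq zp1_neq0 => e; rewrite -(inj_eq (addrI z)) addr0 -e.
have ne' z : (z + zp 1 != z :> Z) by rewrite eq_sym ne.
apply: (iffP existsP) => [[i /andP[/forallP h1]]|[i hi]].
  rewrite !mE => h2; exists i; case/orP: h2 => /eqP h2; [left|right]; apply/ffunP => j;
    rewrite addE; case: (eqVneq j i) => [->|ji] //; have := h1 j;
    by rewrite (negPf ji) eqbF_neg negbK => /eqP ->.
exists i; rewrite !mE; case: hi => ->; apply/andP; split; try (by rewrite !addE !eqxx ?orbT);
  apply/forallP => j; rewrite addE; case: (j == i); rewrite ?eqxx ?ne ?ne' //.
Qed.

Definition pull I x : {set cube} := [set eps | x + vec eps \in I].

Section Reflection.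
Variables (i : 'I_d) (a : Z).
Definition theta x := upd x i (a + a - x i).
(** Action on base points of cubes: [theta] carries the edge from [x i] to [x i + 1] to the one
    based at [2 * a - 1 - x i]. *)
Definition tau x := upd x i (a + a - zp 1 - x i).
Definition half : {set T} := [set x : T | (val (x i - a)%R <= h)%N].
(** The bound is strict, unlike in [half], so that the whole cube based at such a point lies in the
    closed half. *)
Definition left_half : {set T} := [set x : T | (val (x i - a)%R < h)%N].

Lemma thetaK : involutive theta.
Proof. by move=> x; rewrite /theta upd_upd updE opprB addrC subrK upd_id. Qed.

Lemma tauK : involutive tau.
Proof. by move=> x; rewrite /tau upd_upd updE opprB addrC subrK upd_id. Qed.

Lemma offset_theta x : theta x i - a = - (x i - a).
Proof. by rewrite /theta updE opprB addrAC addrK. Qed.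

Lemma offset_tau x : val (tau x i - a) = (L.-1 - val (x i - a)%R)%N.
Proof.
have -> : tau x i - a = zp (L.-1 - val (x i - a)%R).
  set u := val (x i - a)%R.
  have uL : (u <= L.-1)%N by rewrite -ltnS; exact: ltn_ord.
  have e : zp 1 + zp u + zp (L.-1 - u) = 0 by rewrite -!zpD -addnA subnKC // add1n zpL.
  rewrite /tau updE (zp_split (x i) a) -/u -[RHS]addr0 -[in RHS]oppr0 -[in RHS]e; ring.
rewrite val_zp //; lia.
Qed.

Lemma theta_add_unitv j x :
  theta (x + unitv j) = if j == i then theta x - unitv i else theta x + unitv j.
Proof.
apply/ffunP => l; case: (eqVneq j i) => [->|ji]; rewrite /theta !ffunE;
  case: (eqVneq l i) => [li|li]; rewrite ?eqxx ?(negPf li) //=; try ring.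
by rewrite li eq_sym (negPf ji) addr0; ring.
Qed.

Lemma theta_adj x y : tadj (theta x) (theta y) = tadj x y.
Proof.
have imp u v : tadj u v -> tadj (theta u) (theta v).
  move=> /torus_adjP[j hj]; apply/torus_adjP; exists j.
  by case: hj => ->; rewrite theta_add_unitv; case: eqP => [->|_]; rewrite ?subrK; tauto.
by apply/idP/idP => [/imp|/imp //]; rewrite !thetaK.
Qed.

Lemma val_add1 (c : Z) : val (c + zp 1) = if val c == L.-1 then 0%N else (val c).+1.
Proof.
have cL := val_lt c; rewrite -{1}(zp_val c) -zpD addn1.
case: eqP => [->|ne]; first by rewrite zpL.
rewrite val_zp //; move: ne cL => /=; lia.
Qed.

Lemma val_oppE (c : Z) : val (- c) = if val c == 0%N then 0%N else (L - val c)%N.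
Proof.
case: eqP => [/eqP c0|/eqP c0]; last exact: val_opp.
by rewrite (_ : c = 0) ?oppr0 //; apply/eqP.
Qed.

Lemma half_cover x : (x \in half) || (theta x \in half).
Proof.
rewrite !inE offset_theta val_oppE; have := val_lt (x i - a); move: (val (x i - a)%R) => u.
case: eqP => [->|] //; lia.
Qed.

Lemma half_fix x : x \in half -> theta x \in half -> theta x = x.
Proof.
rewrite !inE => xh txh; suff e : theta x i - a = x i - a.
  apply/ffunP => l; case: (eqVneq l i) => [->|li]; first exact: (addIr (- a) e).
  by rewrite /theta ffunE (negPf li).
apply/val_inj; move: txh; rewrite offset_theta val_oppE.
have := val_lt (x i - a); case: eqP => [-> //|]; move: xh; lia.
Qed.

Lemma offset_unitv j x : (x + unitv j) i - a = if j == i then x i - a + zp 1 else x i - a.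
Proof. by rewrite !ffunE eq_sym; case: eqP => _; rewrite ?addr0 // addrAC. Qed.

Lemma adj_half x y : tadj x y -> (x \in half) && (y \in half)
  || (theta x \in half) && (theta y \in half).
Proof.
have step z j : (z \in half) && (z + unitv j \in half)
    || (theta z \in half) && (theta (z + unitv j) \in half).
  rewrite !inE !offset_theta !offset_unitv; case: eqP => _.
    rewrite !val_oppE !val_add1; have := val_lt (z i - a).
    move: (val (z i - a)%R) => u uL.
    case: (ltnP u h) => uh; first by rewrite (ltnW uh) /=; case: (u == _); rewrite ?uh ?leq0n.
    apply/orP; right; apply/andP; split; first by case: eqP => //; lia.
    by case: (u == _) => //=; lia.
  by have := half_cover z; rewrite !inE offset_theta !andbb.
case/torus_adjP => j [] ->; first exact: step.
by rewrite andbC [X in _ || X]andbC; exact: step.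
Qed.

Lemma left_half_tau x : (tau x \in left_half) = (x \notin left_half).
Proof. rewrite !inE offset_tau; have := val_lt (x i - a); lia. Qed.

Lemma pull_left x I : x \in left_half -> pull I x = pull (I :&: half) x.
Proof.
rewrite inE => xl; apply/setP => eps; rewrite 2![LHS]inE [RHS]inE in_setI.
suff -> : x + vec eps \in half by rewrite andbT.
rewrite inE !ffunE addrAC; case: (eps i); last by rewrite zp0 addr0 ltnW.
by rewrite val_add1; case: eqP.
Qed.

Lemma theta_tau x eps : theta (tau x + vec eps) = x + vec (flip eps i).
Proof.
apply/ffunP => l; rewrite /theta /tau /flip !ffunE; case: (eqVneq l i) => [->|li]; rewrite ?eqxx //=.
by case: (eps i); rewrite ?zp0 /=; ring.
Qed.

Lemma pull_tau x I : pull (theta @: I) (tau x) = [set eps | flip eps i \in pull I x].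
Proof.
apply/setP => eps; rewrite !inE -theta_tau -{1}(thetaK (tau x + vec eps)) mem_imset //.
exact: inv_inj thetaK.
Qed.

End Reflection.

Section Chessboard.
Variables (R : realFieldType) (lambda q : R) (g : {set cube} -> R).
Hypotheses (lambda_gt0 : 0 < lambda) (q_gt0 : 0 < q) (g_gt0 : forall J, 0 < g J).
Hypothesis g_flip : forall i (J : {set cube}), g [set eps | flip eps i \in J] = g J.

Definition cube_sum S := observable_sum tadj lambda (fun x I => g (pull I x)) S.
Let psi S := cube_sum S / q ^+ #|S|.
Let maximizer S := forall S', psi S' <= psi S.
Let fold i a S := fold_left (tau i a) (left_half i a) S.

Lemma cube_sum_gt0 S : 0 < cube_sum S.
Proof.
rewrite /cube_sum /observable_sum (bigD1 finset.set0) /=; last first.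
  by apply/forall_inP => x; rewrite inE.
apply: ltr_wpDr.
  apply: sumr_ge0 => I _; rewrite mulr_ge0 ?exprn_ge0 ?(ltW lambda_gt0) //.
  by apply: prodr_ge0 => x _; exact: ltW.
by rewrite mulr_gt0 ?exprn_gt0 //; apply: prodr_gt0.
Qed.

(** By [card_folds], reflection positivity reads [psi S ^ 2 <= psi (left fold) * psi (right fold)],
    and neither factor exceeds the maximum [psi S]. *)
Lemma maximizer_fold i a S : maximizer S -> maximizer (fold i a S).
Proof.
move=> mS; have rp := @reflection_positivity R T tadj lambda (theta i a) (tau i a) (half i a)
  (left_half i a) (fun x I => g (pull I x)) lambda_gt0 (thetaK i a) (tauK i a)
  (half_cover i a) (@half_fix i a) (theta_adj i a) (@adj_half i a) (left_half_tau i a).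
have {}rp := rp (fun x I xl => congr1 g (pull_left I xl)).
have {}rp := rp (fun x I => etrans (congr1 g (pull_tau i a x I)) (g_flip i _)).
have psi_gt0 X : 0 < psi X by rewrite divr_gt0 ?cube_sum_gt0 ?exprn_gt0.
have le2 : psi S ^+ 2 <= psi (fold i a S) * psi (fold_right (tau i a) (left_half i a) S).
  rewrite /psi expr_div_n -exprM mulnC -(card_folds (tauK i a) (left_half_tau i a) S) exprD.
  rewrite mulf_div ler_pM2r ?invr_gt0 ?mulr_gt0 ?exprn_gt0 //; exact: rp.
have le1 : psi S <= psi (fold i a S).
  rewrite -(ler_pM2r (psi_gt0 S)) -expr2; apply: le_trans le2 _.
  by rewrite ler_pM2l.
by move=> S'; apply: le_trans (mS S') le1.
Qed.

(** Folding a nonempty maximizer of [psi] again and again spreads it over the whole torus. So the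
    empty set or the full set is a maximizer, and the hypothesis says that the full set does not
    beat the empty one. *)
Lemma chessboard : cube_sum [set: T] <= cube_sum finset.set0 * q ^+ #|T| ->
  forall S, cube_sum S <= cube_sum finset.set0 * q ^+ #|S|.
Proof.
move=> hall; suff hm : maximizer finset.set0.
  move=> S; have := hm S; rewrite /psi cards0 expr0 divr1 ler_pdivrMr ?exprn_gt0 //.
have [S0 mS0] : exists S, maximizer S.
  by case: (arg_maxP psi (erefl : xpredT (finset.set0 : {set T}))) => S _ hS; exists S => S'; apply: hS.
case: (set_0Vmem S0) => [<- //|[t tS0]].
have final S : maximizer S -> S = [set: T] -> maximizer finset.set0.
  move=> mS e S'; apply: le_trans (mS S') _; rewrite e /psi cards0 expr0 divr1 cardsT.
  by rewrite ler_pdivrMr ?exprn_gt0.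
(* The first [n] coordinates are already arbitrary, the others are still those of [t]. *)
have grow n : (n <= d)%N -> exists2 S, maximizer S & forall x,
    (forall i : 'I_d, (n <= i)%N -> x i = t i) -> x \in S.
  elim: n => [_|n IH nd].
    by exists S0 => // x e; rewrite (_ : x = t) //; apply/ffunP => i; apply: e.
  have [S mS hS] := IH (ltnW nd); pose i := Ordinal nd.
  (* Along coordinate [n], the fold at [t i - k] extends the filled interval from [t i - k] to [t i]
     by one point on the left. *)
  have agree k : (k < h)%N -> exists2 S', maximizer S' & forall x,
      (forall j : 'I_d, (n < j)%N -> x j = t j) -> (val (x i - (t i - zp k))%R <= k)%N -> x \in S'.
    elim: k => [_|k IHk kh].
      exists S => // x xt; rewrite zp0 subr0 leqn0 => /eqP e; apply: hS => j.
      rewrite leq_eqVlt => /orP[/eqP nj|]; last exact: xt.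
      have -> : j = i by apply/val_inj; rewrite /= nj.
      by apply/eqP; rewrite -subr_eq0; apply/eqP/val_inj.
    have [S' mS' hS'] := IHk (ltnW kh).
    exists (fold i (t i - zp k) S'); first exact: maximizer_fold.
    move=> x xt xk; rewrite inE; have e : x i - (t i - zp k.+1) = x i - (t i - zp k) + zp 1.
      by rewrite -(addn1 k) zpD; ring.
    move: xk; rewrite e val_add1; case: ifP => [|] xl; rewrite [X in if X then _ else _]inE.
      case: ifP => [l|_ _]; first by move/eqP: xl l kh; lia.
      apply: hS' => [j nj|]; last by rewrite offset_tau (eqP xl) subnn.
      by rewrite /tau ffunE (_ : j == i = false) ?xt // -val_eqE /=; move: nj; lia.
    move=> xk; case: ifP => [_|]; first by apply: hS' => //; rewrite ltnS in xk.
    by move: xk kh; lia.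
  have h0 : (h.-1 < h)%N by move: h_ge2; case: h.
  have [S' mS' hS'] := agree h.-1 h0.
  (* The filled interval is now exactly a left half, so one more fold fills the circle. *)
  exists (fold i (t i - zp h.-1) S'); first exact: maximizer_fold.
  move=> x xt; rewrite inE; case: ifP => l; move: (l); rewrite [_ \in left_half _ _]inE => {}l; apply: hS' => //.
  - by move: l h_ge2; lia.
  - by move=> j nj; rewrite /tau ffunE (_ : j == i = false) ?xt // -val_eqE /=; move: nj; lia.
  - by rewrite offset_tau; move: l L_even h_ge2; lia.
have [S mS hS] := grow d (leqnn d).
apply: final mS _; apply/setP => x; rewrite in_setT; apply: hS => i.
by rewrite leqNgt ltn_ord.
Qed.

End Chessboard.
End Torus.

(* AM-GM, used to replace the product over all cubes by products over disjoint cubes. *)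
Lemma prod_le_mean_exp (R : realFieldType) (I : finType) (E : I -> R) :
  (0 < #|I|)%N -> (forall i, 0 <= E i) ->
  \prod_i E i <= (\sum_i E i ^+ #|I|) / #|I|%:R.
Proof.
move=> I0 E0; have En i : 0 <= E i ^+ #|I| by rewrite exprn_ge0.
rewrite -(ler_pXn2r I0); last 2 first.
- by rewrite nnegrE prodr_ge0.
- by rewrite nnegrE divr_ge0 // sumr_ge0.
have [le _] := leif_AGM (A := I) (E := fun i => E i ^+ #|I|) (fun i _ => En i).
by rewrite -prodrXl.
Qed.

Lemma sum_fold_fiber (R : realFieldType) (A B C : finType) (P : pred A) (D : {pred C}) (b0 : B)
    (phi : A -> C -> B) (F : B -> R) :
  (forall b, 0 <= F b) ->
  (forall a a', P a -> P a' -> {in D, phi a =1 phi a'} -> a = a') ->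
  \sum_(a | P a) \prod_(c in D) F (phi a c) <= (\sum_b F b) ^+ #|D|.
Proof.
move=> F0 inj; pose ph a : {ffun C -> B} := [ffun c => if c \in D then phi a c else b0].
have phE a : {in D, ph a =1 phi a} by move=> c cD; rewrite ffunE cD.
have -> : \sum_(a | P a) \prod_(c in D) F (phi a c)
   = \sum_(f in ph @: [set a | P a]) \prod_(c in D) F (f c).
  rewrite big_imset /=.
    apply: eq_big => [a|a Pa]; first by rewrite inE.
    by apply: eq_bigr => c cD; rewrite phE.
  move=> a a'; rewrite !inE => Pa Pa' e; apply: inj => // c cD.
  by rewrite -!phE // e.
rewrite -prodr_const (big_distr_big_dep b0) /=.
rewrite [leRHS](bigID (mem (ph @: [set a | P a]))) /=.
rewrite -[leLHS]addr0; apply: lerD; last by apply: sumr_ge0 => f _; apply: prodr_ge0 => *.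
rewrite [leLHS]big_mkcond [leRHS]big_mkcond /= ; apply: ler_sum => f _.
case: ifPn => fi; last first.
  by rewrite andbF.
suff -> : f \in pfamily b0 (fun c => c \in D) (fun _ _ => true) by rewrite andTb.
case/imsetP: fi => a _ ->; apply/pfamilyP; split=> //; apply/subsetP => c.
by rewrite inE ffunE; case: ifP => //; rewrite eqxx.
Qed.

(** * Disjoint cubes and the exponential moment of bad cubes *)

Section Parity.
Variables (d L' h : nat).
Hypotheses (L_even : L'.+2 = h.*2) (h_ge2 : (2 <= h)%N).
Local Notation L := L'.+2.
Local Notation Z := 'I_L'.+2.
Local Notation T := {ffun 'I_d -> 'I_L'.+2}.
Local Notation cube := {ffun 'I_d -> bool}.
Local Notation tadj := (@torus_adj L'.+2 d).
Implicit Types (x y t : T) (i j : 'I_d) (I S : {set T}) (eps o : cube).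

Definition tpar x := \big[addb/false]_i odd (val (x i)).

Lemma odd_add1 (c : Z) : odd (val (c + zp L' 1)) = ~~ odd (val c).
Proof.
rewrite (val_add1 L_even h_ge2); case: eqP => [->|_] //=.
by have := congr1 odd L_even; rewrite odd_double /= negbK => ->.
Qed.

Lemma odd_addb (c : Z) (b : bool) : odd (val (c + zp L' b)) = odd (val c) (+) b.
Proof. by case: b; rewrite ?zp0 ?addr0 ?addbF // addbT odd_add1. Qed.

Lemma tpar_vec x eps : tpar (x + vec L' eps) = tpar x (+) par eps.
Proof. by rewrite /tpar /par -big_split; apply: eq_bigr => i _; rewrite !ffunE odd_addb. Qed.

Lemma tpar_unitv x i : tpar (x + unitv L' i) = ~~ tpar x.
Proof.
have -> : unitv L' i = vec L' (flip [ffun=> false] i).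
  apply/ffunP => j; rewrite [RHS]ffunE /flip !ffunE.
  by case: (j == i); rewrite ?zp0.
rewrite tpar_vec par_flip (_ : par _ = false) ?addbT //.
by rewrite /par big1 // => j _; rewrite ffunE.
Qed.

Lemma tpar_adj x y : tadj x y -> tpar y = ~~ tpar x.
Proof. by case/torus_adjP => i [] ->; rewrite tpar_unitv ?negbK. Qed.

Lemma card_tpar b : (0 < d)%N -> (2 * #|[set x | tpar x == b]| = L ^ d)%N.
Proof.
move=> d0; have e : #|[set x | tpar x == b]| = #|[set x | tpar x == ~~ b]|.
  rewrite -(card_imset _ (@addIr T (unitv L' (Ordinal d0)))).
  apply: eq_card => x; rewrite !inE; apply/imsetP/idP => [[y]|xb].
    by rewrite inE => /eqP <- ->; rewrite tpar_unitv.
  exists (x - unitv L' (Ordinal d0)); last by rewrite subrK.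
  by rewrite inE -[tpar _]negbK -(tpar_unitv _ (Ordinal d0)) subrK (eqP xb) negbK.
rewrite mul2n -addnn {2}e; have := cardsC [set x | tpar x == b].
rewrite card_ffun !card_ord => <-; congr (_ + _)%N.
by apply: eq_card => x; rewrite !inE; case: (tpar x); case: b {e}.
Qed.

(** As [L] is even, the cubes based at the points of one class partition the torus. *)
Definition parity_class o : {set T} := [set x : T | [forall i, odd (val (x i)) == o i]].

Lemma sum_parity_class (M : nmodType) o (F : T -> M) :
  \sum_(x in parity_class o) \sum_eps F (x + vec L' eps) = \sum_y F y.
Proof.
rewrite pair_big_dep /=; pose sh y : cube := [ffun i => odd (val (y i)) (+) o i].
rewrite [RHS](reindex_onto (fun p : T * cube => p.1 + vec L' p.2)
  (fun y => (y - vec L' (sh y), sh y))) /=; last by move=> y _; rewrite subrK.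
apply: eq_bigl => -[x eps] /=; rewrite andbT inE.
have shE : [forall i, odd (val (x i)) == o i] = (sh (x + vec L' eps) == eps).
  apply/forallP/eqP => [e|/ffunP e i].
    by apply/ffunP => i; rewrite !ffunE odd_addb (eqP (e i)) addbC addKb.
  by move: (e i); rewrite !ffunE odd_addb; case: (odd _); case: (eps i) => //; case: (o i).
rewrite shE; apply/eqP/eqP => [->|[_ ->]] //; by rewrite addrK.
Qed.

Lemma card_parity_class o : (#|parity_class o| * 2 ^ d = L ^ d)%N.
Proof.
have e : (\sum_(x in parity_class o) \sum_(eps : cube) 1 = \sum_(y : T) 1)%N
  := sum_parity_class o (fun=> 1%N).
have <- : (\sum_(y : T) 1 = L ^ d)%N by rewrite sum1_card card_ffun !card_ord.
rewrite -e -sum_nat_const.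
by apply: eq_bigr => x _; rewrite sum1_card card_ffun card_bool card_ord.
Qed.

Lemma pull_inj o I I' : {in parity_class o, pull I =1 pull I'} -> I = I'.
Proof.
move=> e; apply/setP => y.
have := sum_parity_class o (fun z => ((z == y) && ((z \in I) != (z \in I')))%:R : int).
rewrite [RHS](bigD1 y) //= eqxx /= [X in _ = (_ + X)%R]big1 ?addr0; last by move=> z /negPf ->.
rewrite big1 => [|x xo].
  by case: (y \in I); case: (y \in I').
by rewrite big1 // => eps _; have /setP/(_ eps) := e x xo; rewrite !inE => ->; rewrite eqxx andbF.
Qed.

Lemma sum_card_pull o I : (\sum_(x in parity_class o) #|pull I x| = #|I|)%N.
Proof.
have e : (\sum_(x in parity_class o) \sum_(eps : cube) (if (x + vec L' eps)%R \in I then 1 else 0)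
  = \sum_(y : T) if y \in I then 1 else 0)%N
  := sum_parity_class o (fun z => if z \in I then 1%N else 0%N).
rewrite -[RHS]sum1_card [RHS]big_mkcond -[RHS]e /=.
apply: eq_bigr => x _; rewrite -sum1_card big_mkcond /=.
by apply: eq_bigr => eps _; rewrite inE.
Qed.

Lemma pull_cindep I x : independent tadj I -> cindep (pull I x).
Proof.
move/forall_inP => ind; apply/cindepP => eps i; rewrite !inE => xI; apply/negP => yI.
have /forall_inP/(_ _ yI)/negP := ind _ xI; apply.
apply/torus_adjP; exists i; case e: (eps i); [right|left]; apply/ffunP => j;
  rewrite /flip !ffunE; case: eqP => [->|_]; rewrite ?addr0 // e zp0 addr0; ring.
Qed.
End Parity.

Section BadMoment.
Variables (d L' h : nat).
Hypotheses (L_even : L'.+2 = h.*2) (h_ge2 : (2 <= h)%N).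
Local Notation L := L'.+2.
Local Notation T := {ffun 'I_d -> 'I_L'.+2}.
Local Notation cube := {ffun 'I_d -> bool}.
Local Notation tadj := (@torus_adj L'.+2 d).
Local Notation N := (L ^ d)%N.
Implicit Types (x y t : T) (i j : 'I_d) (I S : {set T}) (eps o : cube).

Section Weights.
Variables (R : realType) (lambda : R).
Hypothesis lambda_gt0 : 0 < lambda.

Definition hc_total := \sum_(I : {set T} | independent tadj I) lambda ^+ #|I|.

Lemma class_sum o (G : {set cube} -> R) : (forall J, 0 <= G J) ->
  \sum_(I : {set T} | independent tadj I) lambda ^+ #|I| * \prod_(x in parity_class L' o) G (pull I x)
  <= (\sum_(J : {set cube} | cindep J) lambda ^+ #|J| * G J) ^+ #|parity_class L' o|.
Proof.
move=> G0; pose F (J : {set cube}) := if cindep J then lambda ^+ #|J| * G J else 0.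
have -> : \sum_(J : {set cube} | cindep J) lambda ^+ #|J| * G J = \sum_J F J by rewrite big_mkcond.
rewrite (eq_bigr (fun I => \prod_(x in parity_class L' o) F (pull I x))); last first.
  move=> I ind; rewrite -(sum_card_pull L_even h_ge2 o I) -prodrXr -big_split /=.
  by apply: eq_bigr => x _; rewrite /F (pull_cindep _ ind).
apply: (sum_fold_fiber finset.set0) => [J|I I' _ _ e].
  rewrite /F; case: ifP => // _; rewrite mulr_ge0 // exprn_ge0 //; exact: ltW.
exact: (pull_inj L_even h_ge2 (o:=o)).
Qed.

(** The base points split into [2 ^ d] parity classes. The mean inequality bounds the product over
    all cubes by the average over classes of the product of [g ^+ (2 ^ d)] over one class, where the
    cubes are disjoint and the sum factorizes. *)
Lemma all_cubes_sum (g : {set cube} -> R) m : (forall J, 0 <= g J) ->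
  (m * 2 ^ d = N)%N ->
  cube_sum lambda g [set: T]
  <= (\sum_(J : {set cube} | cindep J) lambda ^+ #|J| * g J ^+ (2 ^ d)) ^+ m.
Proof.
move=> g0 mN; have cardC : #|{: cube}| = (2 ^ d)%N by rewrite card_ffun card_bool card_ord.
have n0 : (0 < 2 ^ d)%N by rewrite expn_gt0.
have mE o : #|parity_class L' o| = m.
  by apply/eqP; rewrite -(eqn_pmul2r n0) (card_parity_class L_even h_ge2) mN.
set W := \sum_(J | _) _.
pose p I o := \prod_(x in parity_class L' o) g (pull I x).
have p0 I o : 0 <= p I o by apply: prodr_ge0.
have step : cube_sum lambda g [set: T] <= \sum_(I : {set T} | independent tadj I)
    (\sum_o lambda ^+ #|I| * \prod_(x in parity_class L' o) g (pull I x) ^+ (2 ^ d)) / (2 ^ d)%:R.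
  apply: ler_sum => I _; rewrite -mulr_sumr -mulrA ler_pM2l ?exprn_gt0 //.
  rewrite (partition_big (fun x : T => [ffun i => odd (val (x i))] : cube) xpredT) //=.
  rewrite (eq_bigr (p I)) => [|o _]; last first.
    apply: eq_bigl => x; rewrite !inE /=; apply/eqP/forallP => [<- i|e]; first by rewrite ffunE.
    by apply/ffunP => i; rewrite ffunE (eqP (e i)).
  have := prod_le_mean_exp (E := p I); rewrite cardC => /(_ n0 (p0 I)) le.
  apply: le_trans le _; apply: ler_wpM2r; first by rewrite invr_ge0.
  by apply: ler_sum => o _; rewrite /p prodrXl.
apply: le_trans step _; rewrite -mulr_suml exchange_big /= ler_pdivrMr ?ltr0n //.
apply: (@le_trans _ _ (\sum_(o : cube) W ^+ m)); last by rewrite sumr_const cardC mulr_natr.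
apply: ler_sum => o _; rewrite -(mE o).
by apply: (@class_sum o (fun J => g J ^+ (2 ^ d))) => J; rewrite exprn_ge0.
Qed.

Lemma hc_total_ge : (0 < d)%N -> (1 + lambda) ^+ (N %/ 2) <= hc_total.
Proof.
move=> d0; pose E := [set x : T | tpar x == false].
have -> : (N %/ 2)%N = #|E| by rewrite -(card_tpar L_even h_ge2 false d0) mulKn.
rewrite -sum_subsets_pow /hc_total [leRHS](bigID (fun I : {set T} => I \subset E)) /=.
rewrite -[leLHS]addr0; apply: lerD; last first.
  by apply: sumr_ge0 => I _; rewrite exprn_ge0 // ltW.
rewrite le_eqVlt; apply/orP; left; apply/eqP; apply: eq_bigl => I.
case IE: (I \subset E); rewrite ?andbF // andbT; apply/esym.
apply/forall_inP => x xI; apply/forall_inP => y yI; apply/negP => /(tpar_adj L_even h_ge2).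
have := subsetP IE _ xI; have := subsetP IE _ yI; rewrite !inE.
by move=> /eqP -> /eqP ->.
Qed.

End Weights.

Lemma card_flip_preim (J B : {set cube}) i :
  #|[set eps | flip eps i \in J] :&: B| = #|J :&: [set eps | flip eps i \in B]|.
Proof.
rewrite -(card_imset _ (@flip_inj d i)); apply: eq_card => eps; apply/imsetP/idP => [[e]|].
  by rewrite !inE => /andP[? ?] ->; rewrite flipK; apply/andP.
by rewrite !inE => /andP[? ?]; exists (flip eps i); rewrite ?inE ?flipK //; apply/andP.
Qed.

Definition bad k (J : {set cube}) := mixed k J || thin k J.

Lemma bad_flip k i (J : {set cube}) : bad k [set eps | flip eps i \in J] = bad k J.
Proof.
have imp (J' : {set cube}) : bad k J' -> bad k [set eps | flip eps i \in J'].
  case/orP => [/andP[ev od]|/existsP[j /existsP[b jb]]]; apply/orP; [left|right].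
    apply/andP; rewrite !card_flip_preim.
    have -> : [set eps | flip eps i \in evens d] = odds d.
      by apply/setP => e; rewrite !inE par_flip negbK.
    have -> : [set eps | flip eps i \in odds d] = evens d.
      by apply/setP => e; rewrite !inE par_flip.
    by split.
  apply/existsP; exists j; apply/existsP; exists (b (+) (i == j)).
  rewrite card_flip_preim (_ : [set eps | _] = face j b) //.
  apply/setP => e; rewrite !inE flipE ?[j == i]eq_sym; case: (i == j); rewrite ?addbF //.
  by case: (e j); case: b {jb}.
apply/idP/idP => [/imp|/imp //].
suff -> : [set eps | flip eps i \in [set eps0 | flip eps0 i \in J]] = J by [].
by apply/setP => e; rewrite !inE flipK.
Qed.

Definition bad_cubes k I : {set T} := [set x | bad k (pull I x)].

Section Moment.
Variables (R : realType) (lambda w v : R) (k : nat).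
Hypothesis reg : regime d lambda w v.
Hypothesis kP : k%:R <= (2 ^ d)%:R / (16 * w ^+ 4) /\ (2 ^ d)%:R / (16 * w ^+ 4) < k.+1%:R.
Local Notation n := ((2 ^ d)%:R : R).

(** The exponent is chosen so that the power [2 ^ d] coming from [all_cubes_sum] is exactly
    compensated by [bad_sum]. *)
Definition bad_factor (J : {set cube}) : R := if bad k J then expR (1 / d%:R ^+ 2) else 1.

Lemma cube_moment : \sum_(J : {set cube} | cindep J) lambda ^+ #|J| * bad_factor J ^+ (2 ^ d)
  <= (1 + lambda) ^+ (2 ^ d.-1) * expR (2 * (n / d%:R ^+ 5)).
Proof.
have l0 := lambda_pos reg.
have tot := cube_total reg; have bd := bad_sum reg kP.
have un := n_div reg (k:=5) isT.
have u1 : 1 <= n / d%:R ^+ 5.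
  by apply: le_trans un; rewrite ler1n (d_pos reg).
set u := n / d%:R ^+ 5 in tot un u1 *; set A := (1 + lambda) ^+ _ in tot bd *.
have A0 : 0 < A by rewrite exprn_gt0 // addr_gt0.
have fE J : bad_factor J ^+ (2 ^ d) <= 1 + (if bad k J then expR (n / d%:R ^+ 2) else 0).
  rewrite /bad_factor; case: ifP => _; last by rewrite expr1n addr0.
  by rewrite -expRM_natl mul1r ler_wpDl.
apply: (@le_trans _ _ (\sum_(J : {set cube} | cindep J) lambda ^+ #|J|
   + \sum_(J : {set cube} | cindep J && (mixed k J || thin k J)) lambda ^+ #|J| * expR (n / d%:R ^+ 2))).
  rewrite [X in _ <= _ + X]big_mkcondr -big_split /=; apply: ler_sum => J _.
  apply: (@le_trans _ _ (lambda ^+ #|J| * (1 + (if bad k J then expR (n / d%:R ^+ 2) else 0)))).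
    by rewrite ler_pM2l ?exprn_gt0.
  by rewrite mulrDr mulr1 /bad; case: (mixed k J || thin k J); rewrite ?mulr0.
rewrite -mulr_suml.
have b2 : (\sum_(J : {set cube} | cindep J && (mixed k J || thin k J)) lambda ^+ #|J|) * expR (n / d%:R ^+ 2) <= A.
  rewrite -ler_pdivlMr ?expR_gt0 // -expRN; exact: bd.
apply: le_trans (lerD tot b2) _; rewrite -{2}(mulr1 A) -mulrDr ler_pM2l //.
have e1 := expR_ge1Dx u; rewrite mulr_natl mulr2n expRD; nra.
Qed.

End Moment.
End BadMoment.

Section BadTail.
Variables (d L' h : nat).
Hypotheses (L_even : L'.+2 = h.*2) (h_ge2 : (2 <= h)%N).
Local Notation L := L'.+2.
Local Notation T := {ffun 'I_d -> 'I_L'.+2}.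
Local Notation cube := {ffun 'I_d -> bool}.
Local Notation tadj := (@torus_adj L'.+2 d).
Local Notation N := (L ^ d)%N.
Variables (R : realType) (lambda w v : R) (k : nat).
Hypothesis reg : regime d lambda w v.
Hypothesis kP : k%:R <= (2 ^ d)%:R / (16 * w ^+ 4) /\ (2 ^ d)%:R / (16 * w ^+ 4) < k.+1%:R.
Local Notation n := ((2 ^ d)%:R : R).
Local Notation Z := (hc_total d L' lambda).
Implicit Types (I S : {set T}).

Lemma prod_bad_factor I S :
  \prod_(x in S) bad_factor R k (pull I x) = expR (#|bad_cubes k I :&: S|%:R / d%:R ^+ 2).
Proof.
rewrite (bigID (mem (bad_cubes k I))) /= [X in _ * X]big1 ?mulr1 => [|x /andP[_]]; last first.
  by rewrite inE /bad_factor => /negPf ->.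
rewrite (eq_bigr (fun=> expR (1 / d%:R ^+ 2))) => [|x /andP[_]]; last first.
  by rewrite inE /bad_factor => ->.
rewrite (eq_bigl (mem (bad_cubes k I :&: S))) => [|x]; last by rewrite /= in_setI andbC.
by rewrite prodr_const -expRM_natl mul1r.
Qed.

(** Chessboard with [q = exp (2 / d ^ 5)]. Its hypothesis on the full set holds because the even
    sublattice alone gives [Z >= (1 + lambda) ^ (N / 2)]. *)
Lemma bad_moment S :
  \sum_(I : {set T} | independent tadj I) lambda ^+ #|I| * expR (#|bad_cubes k I :&: S|%:R / d%:R ^+ 2)
  <= Z * expR (#|S|%:R * (2 / d%:R ^+ 5)).
Proof.
have l0 := lambda_pos reg.
have bf0 (J : {set cube}) : 0 < bad_factor R k J :> R by rewrite /bad_factor; case: ifP => _ //; exact: expR_gt0.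
have fl i (J : {set cube}) : bad_factor R k [set eps | flip eps i \in J] = bad_factor R k J.
  by rewrite /bad_factor bad_flip.
have e0 : cube_sum lambda (bad_factor R k) (finset.set0 : {set T}) = Z.
  by apply: eq_bigr => I _; rewrite big_set0 mulr1.
rewrite expRM_natl -e0.
have := chessboard L_even h_ge2 l0 (expR_gt0 (2 / d%:R ^+ 5)) bf0 fl => /(_ _ S) H.
apply: le_trans (H _).
  by apply: ler_sum => I _; rewrite prod_bad_factor.
have mN : (h ^ d * 2 ^ d = N)%N by rewrite -expnMn muln2 L_even.
have d0 := d_pos reg.
apply: le_trans (all_cubes_sum L_even h_ge2 l0 (fun J => ltW (bf0 J)) mN) _.
apply: (@le_trans _ _ (((1 + lambda) ^+ (2 ^ d.-1) * expR (2 * (n / d%:R ^+ 5))) ^+ (h ^ d))).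
  apply: lerXn2r (cube_moment reg kP); rewrite nnegrE.
    by apply: sumr_ge0 => J _; rewrite mulr_ge0 ?exprn_ge0 ?ltW.
  by rewrite mulr_ge0 ?exprn_ge0 ?expR_ge0 ?addr_ge0 ?ltW.
rewrite exprMn -exprM e0; apply: ler_pM.
- by rewrite exprn_ge0 ?addr_ge0 ?ltW.
- by rewrite exprn_ge0 ?expR_ge0.
- have -> : (2 ^ d.-1 * h ^ d = N %/ 2)%N.
    by rewrite -mN mulnC -(prednK d0) [(2 ^ _.+1)%N]expnS /= mulnCA mulKn.
  exact: (hc_total_ge L_even h_ge2 l0 d0).
rewrite -!expRM_natl card_ffun !card_ord -mN natrM ler_expR le_eqVlt; apply/orP; left; apply/eqP.
by field; rewrite pnatr_eq0 -lt0n.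
Qed.

Definition wt (Q : pred {set T}) : R :=
  \sum_(I : {set T} | independent tadj I && Q I) lambda ^+ #|I|.

Lemma wt_union (K : finType) (D : pred K) (Q0 : pred {set T}) (Q : K -> pred {set T}) :
  (forall I, Q0 I -> exists2 c, D c & Q c I) -> wt Q0 <= \sum_(c | D c) wt (Q c).
Proof.
move=> cov; rewrite /wt; have l0 := ltW (lambda_pos reg).
under [leRHS]eq_bigr do rewrite big_mkcondr.
rewrite exchange_big /= big_mkcondr; apply: ler_sum => I _; case: ifP => [Q0I|_].
  have [c Dc QI] := cov I Q0I; rewrite (bigD1 c) //= QI lerDl.
  by apply: sumr_ge0 => c' _; case: ifP; rewrite ?exprn_ge0.
by apply: sumr_ge0 => c _; case: ifP; rewrite ?exprn_ge0.
Qed.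

Lemma wt_mono (Q Q' : pred {set T}) : (forall I, Q I -> Q' I) -> wt Q <= wt Q'.
Proof.
move=> QQ; apply: le_trans (wt_union (D := predT) (Q := fun _ : unit => Q') _) _.
  by move=> I /QQ h'; exists tt.
by rewrite (bigD1 tt) //= big1 ?addr0 // => -[].
Qed.

Lemma bad_chernoff S (a : R) (Q : pred {set T}) :
  (forall I, Q I -> a <= #|bad_cubes k I :&: S|%:R) ->
  wt Q <= Z * expR (#|S|%:R * (2 / d%:R ^+ 5) - a / d%:R ^+ 2).
Proof.
move=> Qa; rewrite expRD expRN mulrA ler_pdivlMr ?expR_gt0 //.
apply: le_trans (bad_moment S); rewrite /wt mulr_suml big_mkcondr; apply: ler_sum => I _.
have l0 := ltW (lambda_pos reg).
case: ifP => [QI|_]; last by rewrite mulr_ge0 ?exprn_ge0 ?expR_ge0.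
rewrite ler_wpM2l ?exprn_ge0 // ler_expR ler_wpM2r ?invr_ge0 ?exprn_ge0 //.
exact: Qa.
Qed.

End BadTail.

(** * Multiscale types of cubes *)

Section HalfCube.
Variable d : nat.
Local Notation cube := {ffun 'I_d -> bool}.
Local Notation n := (2 ^ d)%N.
Implicit Types (A B : {set cube}) (eps : cube) (i : 'I_d).

Lemma card_cube : #|{: cube}| = n.
Proof. by rewrite card_ffun card_bool card_ord. Qed.

Lemma large_meet A B : (3 * n < 4 * #|A|)%N -> (3 * n < 4 * #|B|)%N ->
  (n < 2 * #|A :&: B|)%N.
Proof.
move=> hA hB; have := cardsUI A B; have : (#|A :|: B| <= #|{: cube}|)%N := max_card _; rewrite card_cube.
move: (n) hA hB => m; lia.
Qed.

Lemma large_meet_face A B i : (3 * n < 4 * #|A|)%N -> (3 * n < 4 * #|B|)%N ->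
  exists eps, [/\ eps i, eps \in A & flip eps i \in B].
Proof.
move=> hA hB; pose B' := [set eps | flip eps i \in B].
have eB : #|B'| = #|B|.
  rewrite -(card_imset _ (@flip_inj d i)); apply: eq_card => eps; apply/imsetP/idP => [[e]|eB].
    by rewrite inE => ? ->.
  by exists (flip eps i); rewrite ?inE flipK.
have := large_meet hA (B := B'); rewrite eB => /(_ hB) big.
case: (set_0Vmem ((A :&: B') :&: [set eps : cube | eps i])) => [e0|[eps]]; last first.
  by rewrite !inE => /andP[/andP[? ?] ?]; exists eps.
have sub : A :&: B' \subset [set eps : cube | ~~ eps i].
  apply/subsetP => eps ein; rewrite inE; apply/negP => ei.
  by have := in_set0 eps; rewrite -e0 inE ein inE ei.
have half : (2 * #|[set eps : cube | ~~ eps i]| = n)%N.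
  rewrite mul2n -addnn -card_cube -(cardsC [set eps : cube | eps i]).
  have eC : ~: [set eps : cube | eps i] = [set eps : cube | ~~ eps i].
    by apply/setP => e; rewrite !inE.
  rewrite eC; congr (_ + _)%N.
  rewrite -(card_imset _ (@flip_inj d i)); apply: eq_card => eps; apply/imsetP/idP => [[e]|ei].
    by rewrite !inE => ? ->; rewrite flipE eqxx.
  by exists (flip eps i); rewrite ?flipK //; move: ei; rewrite !inE flipE eqxx /= negbK.
have : (#|A :&: B'| <= #|[set eps : cube | ~~ eps i]|)%N := subset_leq_card sub.
move: big half; move: (#|A :&: B'|) (#|[set eps : cube | ~~ eps i]|) (n) => a b m; lia.
Qed.

(** Vertex isoperimetry for [~: A], which has at least a quarter of the cube; its exits form the
    outer boundary of [A]. *)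
Lemma cube_outer_boundary (R : rcfType) A B : (4 * #|A| <= 3 * n)%N ->
  (forall eps i, eps \notin A -> flip eps i \in A -> eps \in B) ->
  #|A|%:R <= 8 * Num.sqrt d%:R * #|B|%:R :> R.
Proof.
move=> small bnd.
have conn (a b : bool) : fconnect negb a b.
  case: (eqVneq a b) => [->|ab]; first exact: connect0.
  by apply: connect1; rewrite /=; case: a b ab => -[].
have X0 : (0 < #|{: bool}|)%N by rewrite card_bool.
have := vertex_iso R conn X0 (~: A); rewrite card_bool.
have -> : #|~: A| = (n - #|A|)%N by rewrite cardsCs setCK card_cube.
have An : (#|A| <= n)%N by rewrite -card_cube max_card.
rewrite card_cube natrB // subKr.
set a : R := #|A|%:R; set E : R := #|[set x | [exists i, _]]|%:R; set m : R := n%:R => iso.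
have m0 : 0 < m :> R by rewrite ltr0n expn_gt0.
have EB : E <= #|B|%:R.
  rewrite ler_nat; apply: subset_leq_card; apply/subsetP => eps; rewrite inE => /existsP[i].
  by rewrite /exits !in_setC negbK => /andP[]; apply: bnd.
have s4 : 4 * a <= 3 * m by rewrite -!natrM ler_nat.
have a0 : 0 <= a by rewrite ler0n.
have s0 : 0 <= Num.sqrt d%:R :> R by rewrite sqrtr_ge0.
have h1 : Num.sqrt d%:R * E <= Num.sqrt d%:R * #|B|%:R by rewrite ler_wpM2l.
move: iso h1; set u := Num.sqrt _ * E; set u' := Num.sqrt _ * _ => iso h1.
rewrite -mulrA -/u' -(ler_pM2l m0).
clear -iso h1 s4 a0 m0; nra.
Qed.

End HalfCube.

Section Types.
Variables (d L' h : nat).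
Hypotheses (L_even : L'.+2 = h.*2) (h_ge2 : (2 <= h)%N) (d_gt0 : (0 < d)%N).
Local Notation L := L'.+2.
Local Notation T := {ffun 'I_d -> 'I_L'.+2}.
Local Notation cube := {ffun 'I_d -> bool}.
Local Notation N := (L ^ d)%N.
Variables (k : nat) (I : {set T}).
Implicit Types (x y s : T) (i : 'I_d) (eps : cube) (b : bool).

Definition tor (u : 'I_d -> nat) : T := [ffun i => zp L' (u i)].
Definition svec j eps := tor (fun i => (2 ^ j * eps i)%N).
Definition sunit j i := tor (fun l => (2 ^ j * (l == i))%N).
Definition side x b : {set cube} := [set eps | par eps (+) tpar x == b].

(* [typ j b x]: the box of side [2 ^ j + 1] at [x] has few points of torus parity [b]; at level
   [j + 1] this is decided by a three quarters majority of its [2 ^ d] sub-boxes. Two boxes of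
   opposite types never meet, so a typed box next to a box of the other type forces untyped
   ([badl]) boxes in between. *)
Fixpoint typ (j : nat) b x : bool :=
  if j is j'.+1 then (3 * 2 ^ d < 4 * #|[set eps | typ j' b (x + svec j' eps)%R]|)%N
  else ~~ bad k (pull I x) && (#|pull I x :&: side x b| <= k)%N.

Definition badl j x := ~~ typ j true x && ~~ typ j false x.
Definition exclusive j s := forall b x, typ j b x -> ~~ typ j (~~ b) (x + s).

Lemma badl0 x : badl 0 x -> bad k (pull I x).
Proof.
rewrite /badl /=; case B : (bad k _) => //=; rewrite -!ltnNge => /andP[h1 h2].
rewrite -B /bad; apply/orP; left; apply/andP.
have e b : side x b = if tpar x (+) b then odds d else evens d.
  by apply/setP => eps; rewrite !inE; case: (tpar x); case: b; rewrite !inE; case: (par eps).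
by move: h1 h2; rewrite !e; case: (tpar x).
Qed.

(** The face shared by the two cubes would contain at most [k] points of each parity; this explains
    the threshold [2 * k] in [thin]. *)
Lemma exclusive0_unit i : exclusive 0 (unitv L' i).
Proof.
move=> b x /=; case: (boolP (bad k (pull I x))) => //= good hb.
rewrite negb_and negbK; apply/orP; right; apply/negP => hb'.
move: good; rewrite negb_or => /andP[_ /existsPn/(_ i)/existsPn/(_ true)/negP[]].
rewrite -[X in (X <= _)%N](cardsID (side x b)) mul2n -addnn; apply: leq_add.
  apply: leq_trans (subset_leq_card _) hb; apply/subsetP => eps.
  by case/setIP => /setIP[? _] ?; apply/setIP.
apply: leq_trans _ hb'; rewrite -(card_imset _ (@flip_inj d i)).
apply: subset_leq_card; apply/subsetP => _ /imsetP[eps /setDP[/setIP[eI ei] eb] ->].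
move: eb eI ei; rewrite !inE => eb eI /eqP ei; apply/andP; split.
  have -> // : x + unitv L' i + vec L' (flip eps i) = x + vec L' eps.
  apply/ffunP => l; rewrite !ffunE; case: (eqVneq l i) => [->|_]; last by rewrite addr0.
  by rewrite ei /= zp0 addr0.
rewrite par_flip (tpar_unitv L_even h_ge2); move: eb.
by case: (par eps); case: (tpar x); case: (b).
Qed.

Lemma exclusive0_zero : exclusive 0 0.
Proof.
move=> b x /=; rewrite addr0; case: (boolP (bad k (pull I x))) => //= good hb.
apply/negP => hb'.
move: good; rewrite negb_or => /andP[_ /existsPn/(_ (Ordinal d_gt0))/existsPn/(_ true)/negP[]].
apply: leq_trans (subset_leq_card (subsetIl _ _)) _.
rewrite -[X in (X <= _)%N](cardsID (side x b)) mul2n -addnn; apply: leq_add => //.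
apply: leq_trans (subset_leq_card _) hb'; apply/subsetP => eps.
rewrite in_setD in_setI => /andP[eb ->]; move: eb; rewrite !inE.
by case: (par eps); case: (tpar x); case: (b).
Qed.

Lemma exclusiveS j s : exclusive j s -> exclusive j.+1 s.
Proof.
move=> ex b x /= h1; apply/negP => h2; have := large_meet h1 h2.
case: (set_0Vmem ([set eps | typ j b (x + svec j eps)%R]
   :&: [set eps | typ j (~~ b) (x + s + svec j eps)%R])) => [->|[eps]]; first by rewrite cards0.
by rewrite !inE addrAC => /andP[/ex/negP].
Qed.

(** The three-quarters majority is made for this: more than half of the positions are of one type in
    the first box and have their mirror image of the other type in the second, so one of them
    touches the common face. *)
Lemma exclusiveS_step j i : exclusive j (sunit j i) -> exclusive j.+1 (sunit j.+1 i).
Proof.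
move=> ex b x /= h1; apply/negP => h2; have [eps [ei]] := large_meet_face i h1 h2.
rewrite !inE => /ex; have -> // : x + svec j eps + sunit j i = x + sunit j.+1 i + svec j (flip eps i).
  apply/ffunP => l; rewrite !ffunE -!addrA -!zpD; congr (_ + zp _ _).
  case: (eqVneq l i) => [->|_]; last by rewrite !muln0 addn0.
  by rewrite ei /= !muln1 muln0 addn0 expnS mul2n addnn.
by move/negP.
Qed.

Lemma sunit0 i : sunit 0 i = unitv L' i.
Proof. by apply/ffunP => l; rewrite !ffunE mul1n; case: (l == i); rewrite ?zp0. Qed.

Lemma exclusive_zero j : exclusive j 0.
Proof. by elim: j => [|j IH]; [exact: exclusive0_zero|exact: exclusiveS]. Qed.

Lemma exclusive_unit j i : exclusive j (unitv L' i).
Proof. by elim: j => [|j IH]; [exact: exclusive0_unit|exact: exclusiveS]. Qed.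

Lemma exclusive_step j i : exclusive j (sunit j i).
Proof. by elim: j => [|j IH]; [rewrite sunit0; exact: exclusive0_unit|exact: exclusiveS_step]. Qed.

Definition typs j b x : {set cube} := [set eps | typ j b (x + svec j eps)].
Definition bads j x : {set cube} := [set eps | badl j (x + svec j eps)].

Section Real.
Variable R : rcfType.
Local Notation sqd := (Num.sqrt d%:R : R).

(** A neighbour of a sub-box of type [b] never has the opposite type, so the outer boundary of these
    sub-boxes is untyped. *)
Lemma typs_boundary j b x : ~~ typ j.+1 b x -> #|typs j b x|%:R <= 8 * sqd * #|bads j x|%:R.
Proof.
rewrite /= -leqNgt => small; apply: cube_outer_boundary => // eps i; rewrite !inE => ne fe.
suff ne' : ~~ typ j (~~ b) (x + svec j eps).
  by rewrite /badl; move: ne ne'; case: b {small fe} => /= -> ->.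
case ei: (eps i).
  have := @exclusive_step j i _ _ fe; rewrite (_ : x + svec j (flip eps i) + _ = x + svec j eps) //.
  apply/ffunP => l; rewrite !ffunE -addrA -zpD; congr (_ + zp _ _).
  case: (eqVneq l i) => [->|_]; last by rewrite muln0 addn0.
  by rewrite ei /= muln0 muln1.
apply/negP => te; have := @exclusive_step j i _ _ te; rewrite negbK => /negP; apply.
have -> // : x + svec j eps + sunit j i = x + svec j (flip eps i).
apply/ffunP => l; rewrite !ffunE -addrA -zpD; congr (_ + zp _ _).
case: (eqVneq l i) => [->|_]; last by rewrite muln0 addn0.
by rewrite ei /= muln0 muln1.
Qed.

Lemma bads_many j x : badl j.+1 x -> (2 ^ d)%:R <= (16 * sqd + 1) * #|bads j x|%:R :> R.
Proof.
case/andP => /typs_boundary h1 /typs_boundary h2.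
have cov : (2 ^ d <= #|typs j true x| + #|typs j false x| + #|bads j x|)%N.
  rewrite -card_cube -cardsT; apply: leq_trans (_ : #|typs j true x :|: typs j false x :|: bads j x| <= _)%N.
    apply: subset_leq_card; apply/subsetP => eps _; rewrite !inE /badl.
    by case: (typ j true _); case: (typ j false _).
  apply: leq_trans (leq_card_setU _ _) _; rewrite leq_add2r; exact: leq_card_setU.
move: cov; rewrite -(ler_nat R) !natrD; nra.
Qed.

Definition ntyp j b := #|[set x | typ j b x]|.
Definition nbad j := #|[set x | badl j x]|.

Lemma sum_translates (P : pred T) j :
  (\sum_(x : T) #|[set eps : cube | P (x + svec j eps)%R]| = 2 ^ d * #|[set x | P x]|)%N.
Proof.
transitivity (\sum_(x : T) \sum_(eps : cube) P (x + svec j eps)%R)%N.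
  by apply: eq_bigr => x _; rewrite -sum1_card big_mkcond; apply: eq_bigr => eps _; rewrite inE; case: (P _).
rewrite exchange_big /= -card_cube -sum_nat_const; apply: eq_bigr => eps _.
rewrite (reindex_inj (addIr (- svec j eps))) -sum1_card [RHS]big_mkcond /=.
by apply: eq_bigr => x _; rewrite subrK inE; case: (P x).
Qed.

(** Every box of level [j] is a sub-box of [2 ^ d] boxes of the next level; those not of type [b]
    are handled by [typs_boundary]. *)
Lemma ntyp_step j b : (ntyp j b)%:R <= (ntyp j.+1 b)%:R + 8 * sqd * (nbad j)%:R :> R.
Proof.
have n0 : 0 < (2 ^ d)%:R :> R by rewrite ltr0n expn_gt0.
have e : (2 ^ d * ntyp j.+1 b = \sum_(x : T) if typ j.+1 b x then 2 ^ d else 0)%N.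
  by rewrite -big_mkcond sum_nat_const mulnC; congr (_ * _)%N; apply: eq_card => x; rewrite inE.
rewrite -(ler_pM2l n0) mulrDr [X in _ <= _ + X]mulrCA -!natrM e.
rewrite -(sum_translates (typ j b) j) -(sum_translates (badl j) j).
rewrite !natr_sum mulr_sumr -big_split /=.
apply: ler_sum => x _; case: ifPn => [_|nt].
  rewrite -[leLHS]addr0; apply: lerD; last by rewrite !mulr_ge0 ?sqrtr_ge0.
  by rewrite ler_nat; apply: leq_trans (max_card _) _; rewrite card_cube.
by rewrite add0r; exact: typs_boundary.
Qed.

(** Vertex isoperimetry in the torus for the boxes not of type [true]. Those with a successor of
    type [true] are not of type [false] either, hence bad. *)
Lemma final_boundary j :
  (ntyp j true)%:R * (N%:R - (ntyp j true)%:R) <= L%:R * N%:R * (sqd * (nbad j)%:R) :> R.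
Proof.
pose s (c : 'I_L'.+2) := c + zp L' 1.
have conn (a c : 'I_L'.+2) : fconnect s a c.
  rewrite (zp_split c a); move: (val _) => m; have -> : a + zp L' m = iter m s a.
    by elim: m => [|m IH]; rewrite ?zp0 ?addr0 //= -IH /s -(addn1 m) zpD addrA.
  exact: fconnect_iter.
have X0 : (0 < #|{: 'I_L'.+2}|)%N by rewrite card_ord.
have cT : #|{: T}| = N by rewrite card_ffun !card_ord.
have := vertex_iso R conn X0 (~: [set x | typ j true x]); rewrite cT card_ord.
have -> : #|~: [set x | typ j true x]| = (N - ntyp j true)%N by rewrite cardsCs setCK cT.
have le : (ntyp j true <= N)%N by rewrite -cT max_card.
rewrite natrB // subKr mulrC => iso; apply: le_trans iso _.
rewrite ler_wpM2l ?mulr_ge0 // ler_wpM2l ?sqrtr_ge0 // ler_nat.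
apply: subset_leq_card; apply/subsetP => x; rewrite inE => /existsP[i].
rewrite /exits !inE negbK => /andP[nx tx]; rewrite /badl nx; apply/negP => fx.
have := @exclusive_unit j i _ _ fx; rewrite /= (_ : x + unitv L' i = upd x i (s (x i))) ?tx //.
by apply/ffunP => l; rewrite !ffunE; case: eqP => [->|_]; rewrite ?addr0.
Qed.

End Real.

Lemma ntyp_disjoint j : (ntyp j true + ntyp j false <= N)%N.
Proof.
have cT : #|{: T}| = N by rewrite card_ffun !card_ord.
rewrite -cT -(cardsC [set x | typ j true x]) leq_add2l; apply: subset_leq_card.
apply/subsetP => x; rewrite !inE => fx; apply/negP => tx.
by have := @exclusive_zero j _ _ tx; rewrite addr0 fx.
Qed.

(** Each point lies in [2 ^ d] cubes. A cube of type [b] has at most [k] points of parity [b], any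
    other at most [2 ^ d.-1]. *)
Lemma side_total b : (2 ^ d * #|[set x in I | tpar x == b]|
  <= k * N + 2 ^ d.-1 * (ntyp 0 (~~ b) + nbad 0))%N.
Proof.
have cT : #|{: T}| = N by rewrite card_ffun !card_ord.
have nat_of_boolE (c : bool) : (c : nat) = if c then 1%N else 0%N by case: c.
rewrite -(sum_translates (fun x => (x \in I) && (tpar x == b)) 0).
have eS x : [set eps : cube | (x + svec 0 eps \in I) && (tpar (x + svec 0 eps)%R == b)]
    = pull I x :&: side x b.
  apply/setP => eps; rewrite !inE.
  have -> : svec 0 eps = vec L' eps by apply/ffunP => i; rewrite !ffunE mul1n.
  by rewrite (tpar_vec L_even h_ge2) addbC.
under eq_bigr => x _ do rewrite eS.
have half x : (#|side x b| = 2 ^ d.-1)%N.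
  have -> : side x b = if tpar x (+) b then odds d else evens d.
    by apply/setP => eps; rewrite !inE; case: (tpar x); case: (b); rewrite !inE; case: (par eps).
  by case: ifP => _; rewrite ?card_odds ?card_evens.
apply: (@leq_trans (\sum_(x : T) (k + 2 ^ d.-1 * (typ 0 (~~ b) x + badl 0 x)))%N).
  apply: leq_sum => x _; case: (boolP (typ 0 b x)) => [/andP[_ le]|nt].
    exact: leq_trans le (leq_addr _ _).
  have -> : (typ 0 (~~ b) x + badl 0 x = 1)%N.
    by rewrite /badl; move: nt; case: (b) => /= /negPf ->; case: (_ && _).
  rewrite muln1; apply: leq_trans (leq_addl _ _); rewrite -(half x).
  by apply: subset_leq_card; exact: subsetIr.
rewrite big_split sum_nat_const cT mulnC /= leq_add2l -big_distrr leq_mul2l big_split /=.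
apply/orP; right; apply: leq_add; rewrite ?/ntyp ?/nbad -sum1_card [leqRHS]big_mkcond.
  by apply/eq_leq/eq_bigr => x _; rewrite inE; exact: nat_of_boolE.
by apply/eq_leq/eq_bigr => x _; rewrite inE; exact: nat_of_boolE.
Qed.

End Types.

(** * Probability of bad boxes at each level *)

Section LevelTail.
Variables (d L' h : nat).
Hypotheses (L_even : L'.+2 = h.*2) (h_ge2 : (2 <= h)%N).
Local Notation L := L'.+2.
Local Notation T := {ffun 'I_d -> 'I_L'.+2}.
Local Notation cube := {ffun 'I_d -> bool}.
Local Notation N := (L ^ d)%N.
Variables (R : realType) (lambda w v : R) (k : nat).
Hypothesis reg : regime d lambda w v.
Hypothesis kP : k%:R <= (2 ^ d)%:R / (16 * w ^+ 4) /\ (2 ^ d)%:R / (16 * w ^+ 4) < k.+1%:R.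
Local Notation n := ((2 ^ d)%:R : R).
Local Notation Z := (hc_total d L' lambda).
Local Notation tor := (@tor d L').
Local Notation svec := (@svec d L').
Implicit Types (I S X : {set T}) (x y : T) (i : 'I_d) (eps : cube).

(** The half-open cells of side [2 ^ j] at the points of [X] are disjoint, and each embeds in the
    torus without wrapping around. *)
Definition separated j X := forall x y (u u' : 'I_d -> nat), x \in X -> y \in X ->
  (forall i, u i < 2 ^ j)%N -> (forall i, u' i < 2 ^ j)%N -> x + tor u = y + tor u' ->
  x = y /\ u =1 u'.

Lemma torD (u u' : 'I_d -> nat) : tor (fun i => u i + u' i)%N = tor u + tor u'.
Proof. by apply/ffunP => i; rewrite !ffunE zpD. Qed.

Lemma separated_sub j X X' : X' \subset X -> separated j X -> separated j X'.
Proof. by move=> /subsetP s sX x y u u' /s xX /s yX; exact: sX. Qed.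

Lemma separated_inj j X x y eps eps' : separated j.+1 X -> x \in X -> y \in X ->
  x + svec j eps = y + svec j eps' -> x = y /\ eps = eps'.
Proof.
move=> sX xX yX e; have lt (c : cube) i : (2 ^ j * c i < 2 ^ j.+1)%N.
  rewrite expnS mulnC ltn_pmul2r ?expn_gt0 //; by case: (c i).
have [-> uu] := sX _ _ _ _ xX yX (lt eps) (lt eps') e; split=> //.
apply/ffunP => i; have /eqP := uu i; rewrite eqn_pmul2l ?expn_gt0 //.
by case: (eps i); case: (eps' i).
Qed.

Definition blow j X (phi : T -> {set cube}) : {set T} :=
  (fun p : T * cube => p.1 + svec j p.2)
    @: [set p : T * cube | (p.1 \in X) && (p.2 \in phi p.1)].

Lemma card_blow j X phi : separated j.+1 X -> #|blow j X phi| = (\sum_(x in X) #|phi x|)%N.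
Proof.
move=> sX; rewrite card_in_imset => [|[x eps] [y eps'] /=]; last first.
  rewrite !inE /= => /andP[xX _] /andP[yX _] e.
  by have [-> ->] := separated_inj sX xX yX e.
under [RHS]eq_bigr => x _ do rewrite -sum1_card.
by rewrite pair_big_dep -sum1_card; apply: eq_bigl => -[x eps]; rewrite inE.
Qed.

Lemma blow_separated j X phi : separated j.+1 X -> separated j (blow j X phi).
Proof.
move=> sX z1 z2 u u' /imsetP[[x eps]]; rewrite inE /= => /andP[xX _] ->.
move=> /imsetP[[y eps']]; rewrite inE /= => /andP[yX _] -> lu lu'; rewrite -!addrA -!torD => e.
have lt (c : cube) (q : 'I_d -> nat) i : (q i < 2 ^ j)%N -> (2 ^ j * c i + q i < 2 ^ j.+1)%N.
  by rewrite expnS mul2n -addnn; case: (c i); rewrite ?muln1 ?muln0 ?ltn_add2l // => /leq_trans -> //; exact: leq_addl.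
have [-> uu] := sX _ _ _ _ xX yX (fun i => lt eps u i (lu i)) (fun i => lt eps' u' i (lu' i)) e.
have key i : eps i = eps' i /\ u i = u' i.
  move: (uu i) (lu i) (lu' i); case: (eps i); case: (eps' i); rewrite ?muln1 ?muln0 ?add0n.
  - by move/addnI.
  - by move=> <- _; rewrite ltnNge leq_addr.
  - by move=> -> ; rewrite ltnNge leq_addr.
  - by [].
split; last by move=> i; have [] := key i.
by congr (_ + svec j _); apply/ffunP => i; have [] := key i.
Qed.

(** Lower bound for [1 / (16 * sqrt d + 1)], the fraction of bad sub-boxes given by [bads_many]. *)
Definition dens : R := 1 / (20 * w ^+ 4).

Lemma sqrt_d : Num.sqrt d%:R = w ^+ 4.
Proof.
have [[e _ _] _ _ _ _] := reg; have w0 := w_gt0 reg.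
by rewrite -e -[8%N]/(4 * 2)%N exprM sqrtr_sqr ger0_norm // exprn_ge0 // ltW.
Qed.

Definition bset I j : {set T} := [set x | badl k I j x].

Lemma bads_dens I j x : x \in bset I j.+1 -> dens * n <= #|bads k I j x|%:R.
Proof.
rewrite inE => bx; have := bads_many L_even h_ge2 R bx; rewrite sqrt_d => le.
have w1 := w_large reg 3; have [w0 w40] : 1 <= w ^+ 4 /\ 0 < w ^+ 4.
  by split; [apply: le_trans w1; lra|apply: lt_le_trans w1; lra].
have w20 : 0 < 20 * w ^+ 4 by lra.
rewrite /dens mulrAC ler_pdivrMr // mul1r; apply: le_trans le _.
by rewrite mulrC ler_wpM2l //; lra.
Qed.

(* [ell j] is the cost in the exponent of one bad box of level [j + 1]: such a box contains at
   least [dens * n] bad boxes of level [j], chosen among [2 ^ n] sets. *)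
Fixpoint ell (j : nat) : R :=
  if j is j'.+1 then n * (dens * ell j' - ln 2) else dens * n / (2 * d%:R ^+ 2).

Lemma ell_ge j : n ^+ j.+1 / d%:R ^+ (j + 3) <= ell j /\ d%:R <= ell j.
Proof.
have d0 : 0 < d%:R :> R by rewrite ltr0n (d_pos reg).
have dl := d_large reg.
have wd : 40 * w ^+ 4 <= d%:R.
  have [[e _ _] _ _ _ _] := reg; have w1 := w_large reg 3.
  rewrite -e -[8%N]/(4 + 4)%N exprD; apply: ler_wpM2r; last by lra.
  by apply: le_trans w1.
have w40 : 0 < w ^+ 4 by rewrite exprn_gt0 // (w_gt0 reg).
have p_ge : 2 / d%:R <= dens.
  have w20 : 0 < 20 * w ^+ 4 by lra.
  by rewrite /dens ler_pdivlMr // mulrAC ler_pdivrMr //; lra.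
have n0 : 0 < n by rewrite ltr0n expn_gt0.
have nl := n_large reg.
have d1 : 1 <= d%:R :> R by lra.
have nd : d%:R ^+ 15 <= n / d%:R by rewrite ler_pdivlMr // -exprSr.
have big (q : nat) : d%:R <= n ^+ q.+1 / d%:R ^+ (q + 3).
  have -> : (q + 3 = q.+1 + 2)%N by rewrite addSnnS.
  rewrite exprD invfM mulrA -expr_div_n ler_pdivlMr ?exprn_gt0 // -exprS.
  apply: (@le_trans _ _ (d%:R ^+ 15)); first by rewrite ler_weXn2l.
  have nd1 : 1 <= n / d%:R by apply: le_trans nd; rewrite exprn_ege1.
  apply: le_trans nd _; rewrite exprS; exact: (ler_peMr (le_trans ler01 nd1) (exprn_ege1 q nd1)).
suff e : n ^+ j.+1 / d%:R ^+ (j + 3) <= ell j by split; [exact: e|exact: le_trans (big j) e].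
elim: j => [|j IH] /=.
  have -> : n ^+ 1 / d%:R ^+ (0 + 3) = n / d%:R ^+ 2 * (2 / d%:R / 2).
    by rewrite add0n; field; rewrite gt_eqF.
  have -> : dens * n / (2 * d%:R ^+ 2) = n / d%:R ^+ 2 * (dens / 2) by field; rewrite gt_eqF.
  by rewrite ler_wpM2l ?divr_ge0 ?exprn_ge0 ?ler0n // ler_wpM2r.
have ge : d%:R <= ell j := le_trans (big j) IH.
have l2 : ln 2 <= 1 :> R.
  by have := le_ln1Dx (x := 1 : R); rewrite (_ : 1 + 1 = 2 :> R) //; apply; lra.
have : ell j / d%:R <= dens * ell j - ln 2.
  have a1 : 1 <= ell j / d%:R by rewrite ler_pdivlMr // mul1r.
  have a2 : 2 / d%:R * ell j <= dens * ell j by rewrite ler_wpM2r // (le_trans _ ge) // ltW.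
  have a3 : 2 / d%:R * ell j = 2 * (ell j / d%:R) by rewrite mulrAC mulrA.
  rewrite a3 in a2; lra.
move=> hh; rewrite exprS addSn [d%:R ^+ _.+1]exprS invfM -mulrA ler_pM2l //.
apply: le_trans hh; rewrite mulrCA mulrC ler_wpM2r // invr_ge0 ltW //.
Qed.

(** Induction on the level by a union bound over the sets of bad sub-boxes. Separation makes the
    sub-boxes distinct and again separated, so their costs add up. *)
Lemma level_prob j X : separated j.+1 X ->
  wt lambda (fun I => X \subset bset I j.+1) <= Z * expR (- (ell j * #|X|%:R)).
Proof.
have n0 : 0 < n by rewrite ltr0n expn_gt0.
elim: j X => [|j IH] X sX.
  (* At the lowest level the exponential moment is applied to all cubes of the boxes; at least a
     fraction [dens] of them is bad. *)
  pose S := blow 0 X (fun=> [set: cube]).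
  have cS : #|S|%:R = n * #|X|%:R :> R.
    rewrite card_blow // (eq_bigr (fun=> 2 ^ d)%N) => [|x _]; last by rewrite cardsT card_cube.
    by rewrite sum_nat_const natrM mulrC.
  apply: le_trans (bad_chernoff L_even h_ge2 reg kP (S := S) (a := dens * n * #|X|%:R) _) _.
    move=> I /subsetP XB; apply: (@le_trans _ _ (#|blow 0 X (bads k I 0)|%:R)).
      rewrite card_blow // natr_sum mulr_natr -sumr_const; apply: ler_sum => x xX.
      exact: bads_dens (XB x xX).
    rewrite ler_nat; apply: subset_leq_card; apply/subsetP => z1 /imsetP[[x eps]].
    rewrite inE /= => /andP[xX]; rewrite inE => be ->; apply/setIP; split.
      by rewrite inE; exact: badl0 be.
    by apply/imsetP; exists (x, eps); rewrite // inE /= xX inE.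
  have Z0 : 0 <= Z by apply: sumr_ge0 => I _; rewrite exprn_ge0 // ltW // (lambda_pos reg).
  rewrite ler_wpM2l // ler_expR cS /=.
  have dl := d_large reg; have d0 : 0 < d%:R :> R by lra.
  have p_ge : 4 / d%:R ^+ 3 <= dens.
    have [[e _ _] _ _ _ _] := reg; have w1 := w_large reg 3.
    have w40 : 0 < w ^+ 4 by rewrite exprn_gt0 // (w_gt0 reg).
    have ed : d%:R = w ^+ 4 * w ^+ 4 by rewrite -exprD e.
    have w20 : 0 < 20 * w ^+ 4 by lra.
    rewrite /dens ler_pdivlMr // mulrAC ler_pdivrMr ?exprn_gt0 //.
    rewrite [d%:R ^+ 3]exprS mul1r {1}ed; have d2 : 1 <= d%:R ^+ 2 :> R by rewrite exprn_ege1 //; lra.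
    nra.
  have e3 : 2 / d%:R ^+ 5 <= dens / (2 * d%:R ^+ 2).
    rewrite ler_pdivlMr ?mulr_gt0 ?exprn_gt0 //; apply: le_trans p_ge; rewrite le_eqVlt.
    by apply/orP; left; apply/eqP; field; rewrite gt_eqF.
  have x0 : 0 <= n * #|X|%:R by rewrite mulr_ge0 // ltW.
  have := ler_wpM2l x0 e3; set t := n * _ * _; set y := n * _ * _ => ty.
  have -> : dens * n * #|X|%:R / d%:R ^+ 2 = 2 * y by rewrite /y; field; rewrite gt_eqF.
  have -> : dens * n / (2 * d%:R ^+ 2) * #|X|%:R = y by rewrite /y; field; rewrite gt_eqF.
  lra.
have l0 : 0 <= ell j by apply: le_trans (proj2 (ell_ge j)).
pose ok := fun _ : T => [pred B : {set cube} | dens * n <= #|B|%:R].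
pose D := [pred phi : {ffun T -> {set cube}} | phi \in pfamily finset.set0 (mem X) ok].
have cov : wt lambda (fun I => X \subset bset I j.+2) <=
    \sum_(phi | D phi) wt lambda (fun I => blow j.+1 X phi \subset bset I j.+1).
  apply: (wt_union reg) => I /subsetP XB.
  exists [ffun x => if x \in X then bads k I j.+1 x else finset.set0].
    apply/pfamilyP; split=> [|x xX]; last by rewrite ffunE xX; exact: bads_dens (XB x xX).
    by apply/subsetP => x; rewrite inE ffunE; case: ifP => //; rewrite eqxx.
  apply/subsetP => z1 /imsetP[[x eps]]; rewrite inE /= => /andP[xX]; rewrite ffunE xX inE => be ->.
  by rewrite inE.
apply: le_trans cov _.
apply: (@le_trans _ _ (\sum_(phi | D phi) Z * \prod_(x in X) expR (- (ell j * #|phi x|%:R)))).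
  apply: ler_sum => phi _; apply: le_trans (IH _ (blow_separated (phi:=phi) sX)) _.
  by rewrite card_blow // natr_sum mulr_sumr -sumrN expR_sum.
have Z0 : 0 <= Z by apply: sumr_ge0 => I _; rewrite exprn_ge0 // ltW // (lambda_pos reg).
rewrite -mulr_sumr ler_wpM2l // -(big_distr_big_dep finset.set0 (mem X) ok (fun _ B => expR (- (ell j * #|B|%:R)))) /=.
rewrite -[n * _ * _]/(ell j.+1 * #|X|%:R).
have -> : expR (- (ell j.+1 * #|X|%:R)) = \prod_(x in X) expR (- ell j.+1).
  by rewrite prodr_const -expRM_natl mulrN mulrC.
apply: ler_prod => x xX; rewrite sumr_ge0 /=; last first.
  by move=> B _; exact: expR_ge0.
apply: (@le_trans _ _ (\sum_(B : {set cube} | dens * n <= #|B|%:R) expR (- (ell j * (dens * n))))).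
  by apply: ler_sum => B hB; rewrite ler_expR lerN2 ler_wpM2l.
apply: (@le_trans _ _ (\sum_(B : {set cube}) expR (- (ell j * (dens * n))))).
  by rewrite big_mkcond /=; apply: ler_sum => B _; case: ifP; rewrite ?expR_ge0.
have cS : #|{set cube}| = (2 ^ (2 ^ d))%N.
  by rewrite -cardsT -powersetT card_powerset cardsT card_cube.
rewrite [leLHS](_ : _ = 2 ^+ (2 ^ d) * expR (- (ell j * (dens * n)))); last first.
  by rewrite sumr_const cS -[LHS]mulr_natl; congr (_ * _); exact: natrX.
have -> : 2 ^+ (2 ^ d) = expR (n * ln 2) :> R by rewrite expRM_natl lnK // posrE ltr0n.
by rewrite -expRD ler_expR le_eqVlt; apply/orP; left; apply/eqP; ring.
Qed.

Definition grid j m a : {set T} :=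
  [set a + tor (fun i => 2 ^ j * (g i : 'I_m))%N | g : {ffun 'I_d -> 'I_m}].

Lemma grid_coord j m (g : 'I_m) q : (m * 2 ^ j <= L)%N -> (q < 2 ^ j)%N -> (2 ^ j * g + q < L)%N.
Proof.
move=> mL qj; apply: leq_trans mL; apply: (@leq_trans (2 ^ j * g.+1)).
  by rewrite mulnS addnC ltn_add2r.
by rewrite mulnC leq_mul2r ltn_ord orbT.
Qed.

Lemma grid_unique j m (a : T) (g g' : {ffun 'I_d -> 'I_m}) (u u' : 'I_d -> nat) :
  (m * 2 ^ j <= L)%N -> (forall i, u i < 2 ^ j)%N -> (forall i, u' i < 2 ^ j)%N ->
  a + tor (fun i => 2 ^ j * g i)%N + tor u = a + tor (fun i => 2 ^ j * g' i)%N + tor u' ->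
  g = g' /\ u =1 u'.
Proof.
move=> mL lu lu'; rewrite -!addrA -!torD => /addrI e.
have eqn i : (2 ^ j * g i + u i = 2 ^ j * g' i + u' i)%N.
  have := congr1 (fun f : T => val (f i)) e.
  by rewrite /= !ffunE !val_zp //; exact: grid_coord.
have gg i : g i = g' i.
  apply: val_inj; have := congr1 (divn^~ (2 ^ j)%N) (eqn i).
  by rewrite /= ![(2 ^ j * _)%N]mulnC !divnMDl ?expn_gt0 // !divn_small ?addn0.
split; first by apply/ffunP.
by move=> i; have := eqn i; rewrite gg => /addnI.
Qed.

Lemma card_grid j m a : (m * 2 ^ j <= L)%N -> #|grid j m a| = (m ^ d)%N.
Proof.
move=> mL; rewrite card_imset ?card_ffun ?card_ord // => g g' e.
have z i : (0 < 2 ^ j)%N by rewrite expn_gt0.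
have /(_ z z) [] // := @grid_unique j m a g g' (fun=> 0%N) (fun=> 0%N) mL.
by rewrite e.
Qed.

Lemma grid_separated j m a : (m * 2 ^ j <= L)%N -> separated j (grid j m a).
Proof.
move=> mL x y u u' /imsetP[g _ ->] /imsetP[g' _ ->] lu lu' e.
by have [-> uu] := grid_unique mL lu lu' e.
Qed.

Lemma sum_grid j m (B : {set T}) : (m * 2 ^ j <= L)%N ->
  (\sum_(a : T) #|B :&: grid j m a| = m ^ d * #|B|)%N.
Proof.
move=> mL; transitivity (\sum_(a : T) \sum_(g : {ffun 'I_d -> 'I_m})
    (a + tor (fun i => 2 ^ j * (g i : 'I_m))%N \in B)%R)%N.
  apply: eq_bigr => a _; rewrite -sum1_card.
  rewrite (eq_bigl (fun y => (y \in grid j m a) && (y \in B))); last by move=> y; rewrite inE andbC.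
  rewrite big_mkcondr big_imset /=; first by apply: eq_bigr => g _; case: (_ \in B).
  move=> g g' _ _ e; have z i : (0 < 2 ^ j)%N by rewrite expn_gt0.
  have /(_ z z) [] // := @grid_unique j m a g g' (fun=> 0%N) (fun=> 0%N) mL.
  by rewrite e.
rewrite exchange_big /= -[X in (X * _)%N](_ : #|{ffun 'I_d -> 'I_m}| = _); last first.
  by rewrite card_ffun !card_ord.
rewrite -sum_nat_const; apply: eq_bigr => g _.
rewrite (reindex_inj (addIr (- tor (fun i => 2 ^ j * g i)%N))) -sum1_card [RHS]big_mkcond.
by apply: eq_bigr => a _; rewrite subrK; case: (a \in B).
Qed.

(** Some translate of the grid carries its share of bad boxes, and its boxes are separated. One half
    of the exponent of [level_prob] pays for the choice of the bad subset of the grid, the other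
    half gives the decay. *)
Lemma grid_tail j m (t : R) : (m * 2 ^ j.+1 <= L)%N -> 0 <= t ->
  wt lambda (fun I => t * N%:R <= (nbad k I j.+1)%:R)
  <= Z * (N%:R * expR ((m ^ d)%:R * expR (- (ell j / 2)) - ell j * t * (m ^ d)%:R / 2)).
Proof.
move=> mL t0; have Z0 : 0 <= Z.
  by apply: sumr_ge0 => I _; rewrite exprn_ge0 // ltW // (lambda_pos reg).
have cT : #|{: T}| = N by rewrite card_ffun !card_ord.
have l0 : 0 <= ell j by apply: le_trans (proj2 (ell_ge j)).
pose D := [pred c : T * {set T} | (c.2 \subset grid j.+1 m c.1) && (t * (m ^ d)%:R <= #|c.2|%:R)].
have cov : wt lambda (fun I => t * N%:R <= (nbad k I j.+1)%:R)
   <= \sum_(c | D c) wt lambda (fun I => c.2 \subset bset I j.+1).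
  apply: (wt_union reg) => I many.
  have [a ha] : exists a, t * (m ^ d)%:R <= #|bset I j.+1 :&: grid j.+1 m a|%:R.
    apply/existsP; apply: contraT; rewrite negb_exists => /forallP none; exfalso.
    have : \sum_(a : T) #|bset I j.+1 :&: grid j.+1 m a|%:R < \sum_(a : T) t * (m ^ d)%:R.
      apply: ltr_sum => [|a _]; last by rewrite ltNge; exact: none.
      by apply/hasP; exists (0 : T); rewrite ?mem_index_enum.
    rewrite -natr_sum sum_grid // sumr_const cT -[X in _ < X]mulr_natl natrM.
    rewrite (_ : N%:R * (t * (m ^ d)%:R) = (m ^ d)%:R * (t * N%:R)); last by ring.
    by rewrite ltNge (ler_wpM2l _ many).
  by exists (a, bset I j.+1 :&: grid j.+1 m a); rewrite /= ?subsetIl ?subsetIr.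
apply: le_trans cov _.
pose s := expR (- (ell j / 2)); have s0 : 0 < s := expR_gt0 _.
pose A := expR (- (ell j * t * (m ^ d)%:R / 2)); have A0 : 0 < A := expR_gt0 _.
apply: (@le_trans _ _ (\sum_(c | D c) Z * (A * s ^+ #|c.2|))).
  apply: ler_sum => -[a B] /= /andP[Bg Bt]; apply: le_trans (level_prob (separated_sub Bg _)) _.
    exact: grid_separated.
  rewrite ler_wpM2l // /A /s -expRM_natl -expRD ler_expR.
  have := ler_wpM2l l0 Bt; set b : R := #|B|%:R; set q : R := (m ^ d)%:R; lra.
rewrite -mulr_sumr ler_wpM2l //.
apply: (@le_trans _ _ (\sum_(c : T * {set T} | c.2 \subset grid j.+1 m c.1) A * s ^+ #|c.2|)).
  rewrite big_mkcondr /=; apply: ler_sum => c _; case: ifP => // _.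
  by rewrite mulr_ge0 ?ltW // exprn_gt0.
rewrite -(pair_big_dep xpredT (fun (a : T) (B : {set T}) => B \subset grid j.+1 m a) (fun _ B => A * s ^+ #|B|)) /=.
apply: (@le_trans _ _ (\sum_(a : T) expR ((m ^ d)%:R * s - ell j * t * (m ^ d)%:R / 2))); last first.
  by rewrite sumr_const cT -[leLHS]mulr_natl.
apply: ler_sum => a _; rewrite -mulr_sumr sum_subsets_pow card_grid //.
rewrite expRD mulrC; apply: ler_wpM2r; first exact: ltW.
rewrite expRM_natl; apply: lerXn2r; rewrite ?nnegrE ?expR_ge0 //; last exact: expR_ge1Dx.
by rewrite addr_ge0 // ltW.
Qed.

End LevelTail.

(** * Configurations with two large parity classes *)

Section BalancedRare.
Variables (d L' h : nat).
Hypotheses (L_even : L'.+2 = h.*2) (h_ge2 : (2 <= h)%N).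
Local Notation L := L'.+2.
Local Notation T := {ffun 'I_d -> 'I_L'.+2}.
Local Notation N := (L ^ d)%N.
Variables (R : realType) (lambda w v : R) (k : nat).
Hypothesis reg : regime d lambda w v.
Hypothesis kP : k%:R <= (2 ^ d)%:R / (16 * w ^+ 4) /\ (2 ^ d)%:R / (16 * w ^+ 4) < k.+1%:R.
Local Notation n := ((2 ^ d)%:R : R).
Local Notation Z := (hc_total d L' lambda).
Local Notation ell := (ell d w).
Local Notation D := (d%:R : R).
Implicit Types (I : {set T}) (b : bool).

Definition log_side : R := ln L%:R.
Local Notation nu := log_side.
Definition bottleneck : R := L%:R ^+ d.-1 / (D ^+ 4 * nu ^+ 2).
Local Notation X := bottleneck.

Lemma w4_large : 10 ^+ 4 <= w ^+ 4 /\ w ^+ 4 * w ^+ 4 = D.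
Proof.
have [[e _ _] _ _ _ _] := reg; have h1 := w_large reg 3.
by split; [apply: le_trans h1; lra|rewrite -exprD e].
Qed.

Lemma ell_geom j : 512 * (4 * D) * 2 ^+ j.+1 <= ell j.
Proof.
have [le _] := ell_ge reg j; apply: le_trans le.
have dl := d_large reg; have d0 : 0 < D by lra.
have nl := n_large reg.
have d1 : 1 <= D by lra.
have pw (q : nat) : D <= D ^+ q.+1 by rewrite exprS; exact: (ler_peMr (ltW d0) (exprn_ege1 q d1)).
have e1 : (2 * D ^+ 8) ^+ j.+1 <= (n / D) ^+ j.+1.
  apply: lerXn2r; rewrite ?nnegrE.
  - exact: (mulr_ge0 (ler0n _ 2) (exprn_ge0 8 (ltW d0))).
  - exact: (divr_ge0 (ler0n _ _) (ltW d0)).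
  rewrite ler_pdivlMr //; apply: le_trans nl.
  have -> : 2 * D ^+ 8 * D = 2 * D ^+ 9 by ring.
  have -> : D ^+ 16 = D ^+ 7 * D ^+ 9 by ring.
  apply: ler_wpM2r; first exact: (exprn_ge0 9 (ltW d0)).
  by apply: le_trans (pw 6%N); lra.
have -> : n ^+ j.+1 / D ^+ (j + 3) = (n / D) ^+ j.+1 / D ^+ 2.
  have -> : (j + 3 = j.+1 + 2)%N by rewrite addSnnS.
  by rewrite exprD invfM mulrA expr_div_n.
rewrite ler_pdivlMr ?exprn_gt0 //; apply: le_trans e1.
rewrite exprMn; set p := 2 ^+ j.+1.
have -> : 512 * (4 * D) * p * D ^+ 2 = p * (512 * 4 * D ^+ 3) by ring.
apply: ler_wpM2l; first exact: exprn_ge0.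
apply: (@le_trans _ _ (D ^+ 8)); last first.
  rewrite [leRHS]exprS; apply: (ler_peMr (exprn_ge0 8 (ltW d0))); apply: exprn_ege1; exact: (exprn_ege1 8 d1).
have -> : D ^+ 8 = D ^+ 5 * D ^+ 3 by ring.
apply: ler_wpM2r; first exact: (exprn_ge0 3 (ltW d0)).
by apply: le_trans (pw 4%N); lra.
Qed.

Lemma typ_start (r Nr m0 b0 m1 : R) : 10 ^+ 4 <= r -> 0 <= Nr ->
  3 / 8 * Nr <= r * (m0 + b0) -> 256 * (r * r) * b0 <= Nr -> m0 <= m1 + 8 * r * b0 ->
  Nr * (1 + 1 / 4) <= 4 * (r * m1).
Proof.
move=> r1 N0 h1 h2 h3; have r0 : 0 < r by lra.
have h3' : r * m0 <= r * m1 + 8 * (r * r) * b0.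
  have := ler_wpM2l (ltW r0) h3; rewrite mulrDr; set a := r * m1 ; have -> : r * (8 * r * b0) = 8 * (r * r) * b0 by ring.
  by [].
rewrite mulrDr in h1.
have h4 : 256 * 10 ^+ 4 * (r * b0) <= Nr.
  have [b0n|b0p] := ltP b0 0; first by have := ler_wpM2l (ltW r0) (ltW b0n); rewrite mulr0; lra.
  apply: le_trans h2; have := ler_wpM2r (mulr_ge0 (ltW r0) b0p) r1.
  have -> : r * (r * b0) = r * r * b0 by ring.
  lra.
have e2 : 256 * (r * r) * b0 = 32 * (8 * (r * r) * b0) by ring.
rewrite e2 in h2.
move: h1 h2 h3' h4; set p := r * m0; set q := r * b0; set s := r * m1; set t := 8 * (r * r) * b0.
lra.
Qed.

(** One level of the induction in [many_bad]: the margin [c] by which a type exceeds the proportion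
    [1 / (4 * sqrt d)] may be halved at each level, because [ell] grows geometrically ([ell_geom])
    and the bad boxes become correspondingly rarer. *)
Lemma typ_next (r Nr l c mj bj mj1 dd : R) : 0 < r -> 0 <= Nr -> 0 < c -> 0 < l ->
  r * r = dd -> 32 * (32 * dd) <= l * c ->
  Nr * (1 + c) <= 4 * (r * mj) -> bj <= 4 / l * Nr -> mj <= mj1 + 8 * r * bj ->
  Nr * (1 + c / 2) <= 4 * (r * mj1).
Proof.
move=> r0 N0 c0 l0 rr lc h1 h2 h3.
have h4 : 32 * dd * bj <= Nr * (c / 8).
  have dd0 : 0 < dd by rewrite -rr mulr_gt0.
  have := ler_wpM2l (ltW dd0) h2; have -> : dd * (4 / l * Nr) = dd / l * (4 * Nr) by ring.
  have e : 32 * (32 * (dd / l)) <= c by rewrite !mulrA ler_pdivrMr // [c * l]mulrC -mulrA.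
  have := ler_wpM2r N0 e; set y := dd * bj; have -> : dd / l * (4 * Nr) = 4 * (dd / l * Nr) by ring.
  have -> : 32 * (32 * (dd / l)) * Nr = 32 * (32 * (dd / l * Nr)) by ring.
  have -> : 32 * dd * bj = 32 * y by rewrite /y; ring.
  have -> : Nr * (c / 8) = c * Nr / 8 by ring.
  set z := dd / l * Nr; set x := c * Nr; lra.
have h3' : 4 * (r * mj) <= 4 * (r * mj1) + 32 * dd * bj.
  have := ler_wpM2l (ltW r0) h3; have -> : r * (mj1 + 8 * r * bj) = r * mj1 + 8 * dd * bj by rewrite -rr; ring.
  set p := r * mj; set q := r * mj1; have -> : 32 * dd * bj = 4 * (8 * dd * bj) by ring.
  set s := 8 * dd * bj; lra.
have e : 0 <= Nr * c by rewrite mulr_ge0 // ltW.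
have e1 : Nr * (1 + c) = Nr + Nr * c by ring.
have e2 : Nr * (1 + c / 2) = Nr + Nr * c / 2 by ring.
have e3 : Nr * (c / 8) = Nr * c / 8 by ring.
rewrite e2; rewrite e1 in h1; rewrite e3 in h4.
move: h1 h3' h4 e; set t := Nr * c; set y := 32 * dd * bj; set p := r * mj; set q := r * mj1; lra.
Qed.

Lemma typ_end (r Nr l m m' bad dd : R) : 10 ^+ 4 <= r -> 0 < Nr -> 0 < l -> r * r = dd ->
  Nr <= 4 * (r * m) -> Nr <= 4 * (r * m') -> m + m' <= Nr ->
  m * (Nr - m) <= l * Nr * (r * bad) -> Nr / (8 * dd * l) <= bad.
Proof.
move=> r1 N0 l0 rr h1 h2 h3 h4; have r0 : 0 < r by lra.
have dd0 : 0 < dd by rewrite -rr mulr_gt0.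
rewrite ler_pdivrMr ?mulr_gt0 //.
pose x := r * m; pose y := r * (Nr - m).
have hy : Nr <= 4 * y.
  apply: le_trans h2 _; rewrite ler_pM2l // /y ler_pM2l //; lra.
have sxy : x + y = r * Nr by rewrite /x /y; ring.
have key : Nr * (r * Nr) <= 8 * (x * y).
  rewrite -sxy; have hx : Nr <= 4 * x by [].
  have := ler_wpM2r (_ : 0 <= y) hx; have := ler_wpM2r (_ : 0 <= x) hy.
  have y0 : 0 <= y by lra.
  have x0 : 0 <= x by lra.
  move=> /(_ x0) a1 /(_ y0) a2; lra.
have xy : x * y <= r * r * (l * Nr * (r * bad)).
  have -> : x * y = r * r * (m * (Nr - m)) by rewrite /x /y; ring.
  by rewrite ler_wpM2l // mulr_ge0 // ltW.
have : Nr * (r * Nr) <= r * Nr * (8 * (dd * (l * bad))).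
  apply: le_trans key _; have -> : r * Nr * (8 * (dd * (l * bad))) = 8 * (r * r * (l * Nr * (r * bad))).
    by rewrite -rr; ring.
  by rewrite ler_pM2l.
rewrite mulrC ler_pM2l ?mulr_gt0 // => e; apply: le_trans e _.
by rewrite le_eqVlt; apply/orP; left; apply/eqP; ring.
Qed.

(* If both parities carry many points and bad boxes are rare below level [J + 1], then both types
   still occupy a [1 / (4 sqrt d)] proportion at level [J + 1], and the interface between them
   consists of bad boxes. *)
Lemma many_bad J I :
  (forall b, N%:R / (4 * w ^+ 4) < #|[set x in I | tpar x == b]|%:R) ->
  (nbad k I 0)%:R < N%:R / (256 * D) ->
  (forall j, (j < J)%N -> (nbad k I j.+1)%:R < 4 / ell j * N%:R) ->
  N%:R / (8 * D * L%:R) <= (nbad k I J.+1)%:R :> R.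
Proof.
move=> hI h0 hj; have [r1 rr] := w4_large; have r0 : 0 < w ^+ 4 by lra.
have N0 : 0 < N%:R :> R by rewrite ltr0n expn_gt0.
have sq := sqrt_d reg; have d0 := d_pos reg.
have D0 : 0 < D by rewrite ltr0n.
have start b : N%:R * (1 + 1 / 4) <= 4 * (w ^+ 4 * (ntyp k I 1 b)%:R).
  apply: (typ_start (m0 := (ntyp k I 0 b)%:R) (b0 := (nbad k I 0)%:R) r1 (ltW N0)).
  - have := side_total L_even h_ge2 d0 k I (~~ b); rewrite negbK.
    rewrite -(ler_nat R) natrD !natrM natrD; have := hI (~~ b).
    set s : R := #|_|%:R => hs.
    have n2 : n = 2 * (2 ^ d.-1)%:R by rewrite -natrM -expnS prednK.
    have [kn _] := kP; have w1 : 0 < 4 * w ^+ 4 by lra.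
    rewrite ltr_pdivrMr // in hs.
    have kN : k%:R * N%:R <= n * (N%:R / (16 * w ^+ 4)) 
      by have := ler_wpM2r (ltW N0) kn; rewrite mulrAC -mulrA.
    move=> st; have {}st := le_trans st (lerD kN (lexx _)); move: st.
    rewrite n2; set g : R := (2 ^ d.-1)%:R; have g0 : 0 < g by rewrite ltr0n expn_gt0.
    set mb : R := (ntyp k I 0 b)%:R + _; have -> : 2 * g * s = g * (2 * s) by ring.
    have -> : 2 * g * (N%:R / (16 * w ^+ 4)) + g * mb = g * (N%:R / (8 * w ^+ 4) + mb) by field; rewrite gt_eqF // (w_gt0 reg).
    rewrite ler_pM2l // => st; have {}st := ler_wpM2l (ltW r0) st; move: st.
    have -> : w ^+ 4 * (N%:R / (8 * w ^+ 4) + mb) = N%:R / 8 + w ^+ 4 * mb by field; rewrite gt_eqF // (w_gt0 reg).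
    have es : s * (4 * w ^+ 4) = 4 * (w ^+ 4 * s) by ring.
    rewrite es in hs.
    have -> : w ^+ 4 * (2 * s) = 2 * (w ^+ 4 * s) by ring.
    move: hs; set u := w ^+ 4 * s; set y := w ^+ 4 * mb; set NN : R := N%:R; lra.
  - have D1 : 0 < 256 * D by lra.
    by move/ltW: h0; rewrite rr ler_pdivlMr // mulrC.
  - by have := ntyp_step L_even h_ge2 k I R 0 b; rewrite sq.
have inv b j : (j <= J)%N -> N%:R * (1 + 2 ^- (j + 2)) <= 4 * (w ^+ 4 * (ntyp k I j.+1 b)%:R).
  elim: j => [_|j IH jJ].
    by apply: le_trans (start b); rewrite ler_wpM2l // lerD2l; lra.
  have -> : (2 ^- (j.+1 + 2) = 2 ^- (j + 2) / 2 :> R) by rewrite addSn exprSr invfM.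
  have l0 : 0 < ell j by have [_ e] := ell_ge reg j; exact: lt_le_trans e.
  apply: (typ_next (l := ell j) (mj := (ntyp k I j.+1 b)%:R) (bj := (nbad k I j.+1)%:R) r0 (ltW N0) _ l0 rr) => //.
  - rewrite ler_pdivlMr ?exprn_gt0 //; apply: le_trans (ell_geom j).
    rewrite addn2 [2 ^+ j.+2]exprS; set p := 2 ^+ j.+1.
    by have -> : 32 * (32 * D) * (2 * p) = 512 * (4 * D) * p by ring.
  - exact: IH (ltnW jJ).
  - exact: ltW (hj j jJ).
  - by have := ntyp_step L_even h_ge2 k I R j.+1 b; rewrite sq.
have fin b : N%:R <= 4 * (w ^+ 4 * (ntyp k I J.+1 b)%:R).
  apply: le_trans (inv b J (leqnn J)); apply: (ler_peMr (ltW N0)); rewrite lerDl.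
  by rewrite invr_ge0 exprn_ge0.
apply: (typ_end r1 N0 _ rr (fin true) (fin false)); first exact: ltr0Sn.
  by rewrite -natrD ler_nat; exact: (ntyp_disjoint d0 k I J.+1).
by have := final_boundary L_even h_ge2 k I R J.+1; rewrite sq.
Qed.

End BalancedRare.

Lemma pred_split4 d : (8 <= d)%N -> d.-1 = (d - 4 + 3)%N.
Proof. lia. Qed.

Lemma double_sub4 d : (8 <= d)%N -> (d <= 2 * (d - 4))%N.
Proof. lia. Qed.

Lemma exponent_room j : (2 + (j + 3) <= 8 * j.+1)%N.
Proof. lia. Qed.

Lemma exponent_double j : (8 * j.+1 + 8 * j.+1 = 16 * j.+1)%N.
Proof. lia. Qed.

Lemma exponent_succ j : (0 < j)%N -> (2 + j <= 8 * j)%N.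
Proof. lia. Qed.

Lemma ord_mid (J c : nat) : (c < J.+2)%N -> c != 0%N -> c != J.+1 -> (c.-1 < J)%N.
Proof. lia. Qed.

Section BalancedRareBound.
Variables (d L' h : nat).
Hypotheses (L_even : L'.+2 = h.*2) (h_ge2 : (2 <= h)%N).
Local Notation L := L'.+2.
Local Notation T := {ffun 'I_d -> 'I_L'.+2}.
Local Notation N := (L ^ d)%N.
Variables (R : realType) (lambda w v : R) (k : nat).
Hypothesis reg : regime d lambda w v.
Hypothesis kP : k%:R <= (2 ^ d)%:R / (16 * w ^+ 4) /\ (2 ^ d)%:R / (16 * w ^+ 4) < k.+1%:R.
Local Notation n := ((2 ^ d)%:R : R).
Local Notation Z := (hc_total d L' lambda).
Local Notation ell := (ell d w).
Local Notation D := (d%:R : R).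
Local Notation LR := (L%:R : R).
Local Notation nu := (log_side L' R).
Local Notation X := (bottleneck d L' R).
Implicit Types (I : {set T}) (b : bool).

Lemma LR_ge4 : 4 <= LR.
Proof. by rewrite ler_nat L_even -mul2n (leq_mul2l 2 2). Qed.

Lemma ln2_ge_half : 2^-1 <= ln 2 :> R.
Proof.
have := le_ln1Dx (x := - 2^-1 : R); rewrite (_ : 1 + - 2^-1 = 2^-1); last by field.
by rewrite lnV ?posrE ?ltr0n //; move=> h1; have := h1 _; lra.
Qed.

Lemma nu_ge1 : 1 <= nu.
Proof.
have l4 : ln (2 * 2 : R) <= nu.
  have L4 := LR_ge4; rewrite /log_side ler_ln ?posrE; lra.
rewrite lnM ?posrE ?ltr0n // in l4; have := ln2_ge_half; lra.
Qed.

Lemma nu_le : nu <= LR.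
Proof.
have L4 := LR_ge4; have := le_ln1Dx (x := LR - 1); rewrite (_ : 1 + (LR - 1) = LR); last by ring.
move=> h1.
by have := h1 _; rewrite /log_side; lra.
Qed.

Lemma X_eq : N%:R = X * (D ^+ 4 * nu ^+ 2 * LR) :> R.
Proof.
have n1 := nu_ge1; have d0 : 0 < D by rewrite ltr0n (d_pos reg).
rewrite /bottleneck mulrA divfK; last first.
  by apply: lt0r_neq0; apply: mulr_gt0; [apply: exprn_gt0|apply: exprn_gt0; lra].
by rewrite -exprSr prednK ?(d_pos reg) // natrX.
Qed.

(** Room for the union bounds: the exponent dominates [ln N + ln L]. *)
Lemma X_big : 1 + (D + 1) * nu <= X.
Proof.
have n1 := nu_ge1; have nL := nu_le; have L4 := LR_ge4; have dl := d_large reg.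
have nl := n_large reg; have d0 : 0 < D by lra.
have d8 : (8 <= d)%N by rewrite -(ler_nat R); lra.
have d1 : 1 <= D by lra.
have n0 : 0 < nu by lra.
rewrite /bottleneck ler_pdivlMr; last first.
  by apply: mulr_gt0; apply: exprn_gt0.
have a1 : 1 + (D + 1) * nu <= 2 * D * nu.
  have -> : (D + 1) * nu = D * nu + nu by ring.
  have -> : 2 * D * nu = D * nu + D * nu by ring.
  have : 2 * nu <= D * nu by rewrite ler_pM2r //; lra.
  by lra.
have x0 : 0 <= D ^+ 4 * nu ^+ 2 by apply: mulr_ge0; apply: exprn_ge0; exact: ltW.
apply: le_trans (ler_wpM2r x0 a1) _.
have -> : 2 * D * nu * (D ^+ 4 * nu ^+ 2) = 2 * D ^+ 5 * nu ^+ 3 by ring.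
have dE := pred_split4 d8.
rewrite dE exprD; apply: ler_pM.
- by apply: mulr_ge0 => //; apply: exprn_ge0; exact: ltW.
- by apply: exprn_ge0; exact: ltW.
- have b1 : 4 ^+ (d - 4) <= LR ^+ (d - 4) by apply: lerXn2r; rewrite ?nnegrE; lra.
  apply: le_trans b1; have b2 : n <= 4 ^+ (d - 4).
    have -> : 4 = 2 ^+ 2 :> R by ring.
    by rewrite -exprM natrX; apply: ler_weXn2l; [lra|exact: double_sub4].
  apply: le_trans b2; apply: le_trans nl.
  have -> : D ^+ 16 = D ^+ 11 * D ^+ 5 by ring.
  apply: ler_wpM2r; first by apply: exprn_ge0; exact: ltW.
  by rewrite exprS; apply: le_trans (ler_peMr (ltW d0) (exprn_ege1 10 d1)); lra.
- by apply: lerXn2r; rewrite ?nnegrE //; lra.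
Qed.

(* Levels before the last one exist only when [log L] is much larger than [n ^ j], so rounding
   [L / 2 ^ j] is harmless there; at level 1 the evenness of [L] makes the grid exact. *)
Lemma small_level j : ell j < 2 * D * nu -> D ^+ (8 * j.+1) <= nu /\ n ^+ j.+1 <= nu ^+ 2.
Proof.
move=> small; have [le _] := ell_ge reg j.
have dl := d_large reg; have d0 : 0 < D by lra.
have nl := n_large reg; have d1 : 1 <= D by lra.
have n1 := nu_ge1; have n0 : 0 < nu by lra.
pose E := D ^+ (8 * j.+1); have E0 : 0 < E by apply: exprn_gt0.
have up : n ^+ j.+1 <= E * nu.
  have := le_lt_trans le small; rewrite ltr_pdivrMr ?exprn_gt0 // => /ltW up.
  apply: le_trans up _; rewrite mulrAC; apply: ler_wpM2r; first exact: ltW.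
  apply: (@le_trans _ _ (D ^+ (2 + (j + 3)))).
    rewrite [leRHS]exprD; apply: ler_wpM2r; first by apply: exprn_ge0; exact: ltW.
    have D2 : 2 <= D by lra.
    by rewrite expr2; exact: (ler_wpM2r (ltW d0) D2).
  exact: (ler_weXn2l d1 (exponent_room j)).
have lo : E * E <= n ^+ j.+1.
  have -> : E * E = (D ^+ 16) ^+ j.+1 by rewrite /E -exprD -exprM; rewrite exponent_double.
  by apply: lerXn2r; rewrite ?nnegrE ?ler0n //; apply: exprn_ge0; exact: ltW.
have En : E <= nu by have := le_trans lo up; rewrite ler_pM2l.
split=> //; apply: le_trans up _; rewrite expr2; apply: ler_wpM2r => //; exact: ltW.
Qed.

Lemma ell_step j : n * (ell j / D) <= ell j.+1.
Proof.
have [_ ge] := ell_ge reg j; have [r1 rr] := w4_large reg.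
have dl := d_large reg; have d0 : 0 < D by lra.
have n0 : 0 < n by rewrite ltr0n expn_gt0.
rewrite /= ler_pM2l //; have l2 : ln 2 <= 1 :> R.
  have := le_ln1Dx (x := 1 : R); rewrite (_ : 1 + 1 = 2 :> R); last by ring.
  by move=> h1; apply: h1; lra.
have r0 : 0 < w ^+ 4 by lra.
have p_ge : 2 / D <= dens w.
  have w20 : 0 < 20 * w ^+ 4 by lra.
  rewrite /dens ler_pdivlMr // mulrAC ler_pdivrMr // mul1r -rr.
  by rewrite mulrA; apply: ler_wpM2r; lra.
have a1 : 1 <= ell j / D by rewrite ler_pdivlMr // mul1r.
have l0 : 0 <= ell j by apply: le_trans ge; exact: ltW.
have a2 : 2 / D * ell j <= dens w * ell j by rewrite ler_wpM2r.
have a3 : 2 / D * ell j = 2 * (ell j / D) by ring.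
rewrite a3 in a2; lra.
Qed.

(** Better than [ell_ge] by a factor of order [sqrt d], which the power [d ^ 4] in [bottleneck]
    requires at the last level. *)
Lemma ell_ge40 j : n ^+ j.+1 / (40 * w ^+ 4 * D ^+ (j + 2)) <= ell j.
Proof.
have [r1 rr] := w4_large reg; have r0 : 0 < w ^+ 4 by lra.
have d0 : 0 < D by rewrite ltr0n (d_pos reg).
have n0 : 0 < n by rewrite ltr0n expn_gt0.
elim: j => [|j IH].
  rewrite le_eqVlt; apply/orP; left; apply/eqP; rewrite /= /dens add0n.
  by field; rewrite !gt_eqF // (w_gt0 reg).
apply: le_trans (ell_step j).
have -> : n ^+ j.+2 / (40 * w ^+ 4 * D ^+ (j.+1 + 2))
   = n * (n ^+ j.+1 / (40 * w ^+ 4 * D ^+ (j + 2)) / D).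
  have -> : D ^+ (j.+1 + 2) = D * D ^+ (j + 2) by rewrite addSn exprS.
  rewrite [n ^+ j.+2]exprS; set p := D ^+ (j + 2); set q := n ^+ j.+1.
  have p0 : 0 < p by apply: exprn_gt0.
  by field; rewrite !gt_eqF // (w_gt0 reg).
by rewrite ler_pM2l // ler_wpM2r // invr_ge0 ltW.
Qed.

Lemma one_sub_exp (y : R) q : 0 <= y <= 1 -> 1 - q%:R * y <= (1 - y) ^+ q.
Proof.
case/andP => y0 y1; elim: q => [|q IH]; first by rewrite mul0r subr0 expr0.
rewrite exprS -natr1; have y2 : 0 <= 1 - y by lra.
apply: le_trans (ler_wpM2l y2 IH).
have : 0 <= q%:R * y * y by apply: mulr_ge0 => //; exact: mulr_ge0.
have -> : (1 - y) * (1 - q%:R * y) = 1 - (q%:R + 1) * y + q%:R * y * y by ring.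
lra.
Qed.

Lemma grid_size J j : (J == 0)%N || (D ^+ (8 * J) <= nu) -> (j <= J)%N ->
  exists2 m, (m * 2 ^ j.+1 <= L)%N & N%:R <= 2 * n ^+ j.+1 * (m ^ d)%:R :> R.
Proof.
case: J => [_|J /= hJ jJ].
  rewrite leqn0 => /eqP ->; exists h; first by rewrite L_even expn1 muln2.
  rewrite L_even -mul2n expnMn natrM expr1; apply: ler_wpM2r => //.
  have : 0 <= n by []. lra.
have dl := d_large reg; have d0 : 0 < D by lra.
have d1 : 1 <= D by lra.
have nL := nu_le; have L4 := LR_ge4; have L0 : 0 < LR by lra.
pose a := (2 ^ j.+1)%N; exists (L %/ a)%N; first exact: leq_trunc_div.
(* This makes [(1 - a / L) ^ d] at least one half, so that rounding [L / a] down costs at most a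
   factor 2 in [m ^ d]. *)
have aD : 2 * D * a%:R <= LR.
  apply: le_trans nL; apply: le_trans hJ.
  apply: (@le_trans _ _ (D ^+ (2 + J.+1))); last exact: (ler_weXn2l d1 (exponent_succ (ltn0Sn J))).
  rewrite exprD /a expnS natrM natrX.
  have -> : 2 * D * (2 * 2 ^+ j) = 4 * D * 2 ^+ j by ring.
  apply: ler_pM.
  - by apply: mulr_ge0; lra.
  - exact: exprn_ge0.
  - have D4 : 4 <= D by lra.
    by rewrite expr2; exact: (ler_wpM2r (ltW d0) D4).
  - apply: (@le_trans _ _ (2 ^+ J.+1)); first by apply: ler_weXn2l => //; lra.
    by apply: lerXn2r; rewrite ?nnegrE; lra.
have a0 : 0 < a%:R :> R by rewrite ltr0n expn_gt0.
pose y := a%:R / LR.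
have dy : D * y <= 2^-1.
  by rewrite /y mulrA ler_pdivrMr // mulrC; lra.
have y01 : 0 <= y <= 1.
  have yp : 0 <= y by rewrite divr_ge0 // ltW.
  rewrite yp /=; have : y <= D * y by rewrite ler_peMl.
  by lra.
have half := one_sub_exp d y01.
pose m := (L %/ a)%N; have ma : LR - a%:R <= m%:R * a%:R.
  have := ltn_ceil L (_ : (0 < a)%N); rewrite expn_gt0 => /(_ isT) /ltnW.
  by rewrite -(ler_nat R) mulSn natrD natrM; rewrite -/m; lra.
have Ly : LR * (1 - y) = LR - a%:R by rewrite /y; field; rewrite gt_eqF.
have Ly0 : 0 <= LR * (1 - y) by apply: mulr_ge0; [exact: ltW|lra].
have pw : LR ^+ d * (1 - y) ^+ d <= (m%:R * a%:R) ^+ d.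
  by rewrite -exprMn; apply: lerXn2r; rewrite ?nnegrE; [exact: Ly0|exact: mulr_ge0|rewrite Ly].
have Ld : 0 <= LR ^+ d by apply: exprn_ge0; exact: ltW.
have pw2 : LR ^+ d * 2^-1 <= LR ^+ d * (1 - y) ^+ d by apply: ler_wpM2l => //; lra.
have aE : a%:R ^+ d = n ^+ j.+1 :> R.
  by rewrite /a !natrX -!exprM mulnC.
have := le_trans pw2 pw; rewrite exprMn aE -/m (natrX R L d) (natrX R m d).
set p := LR ^+ d; set q := m%:R ^+ d; have -> : 2 * n ^+ j.+1 * q = 2 * (q * n ^+ j.+1) by ring.
lra.
Qed.

Lemma X_gt1 : 1 <= X.
Proof.
have := X_big; have n1 := nu_ge1; have d0 : 0 <= D by rewrite ler0n.
have : 0 <= (D + 1) * nu by apply: mulr_ge0; lra.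
lra.
Qed.

Lemma exp_N : N%:R = expR (D * nu) :> R.
Proof. by rewrite expRM_natl /log_side lnK ?natrX // posrE ltr0n. Qed.

Lemma final_exponent (e : R) : e <= 1 + D * nu - 3 * X -> e <= - (2 * X) - nu.
Proof.
have := X_big; have -> : (D + 1) * nu = D * nu + nu by ring.
lra.
Qed.

Lemma event_zero : wt lambda (fun I => N%:R / (256 * D) <= (nbad k I 0)%:R)
  <= Z * expR (- (2 * X) - nu).
Proof.
have Z0 : 0 <= Z by apply: sumr_ge0 => I _; rewrite exprn_ge0 // ltW // (lambda_pos reg).
have dl := d_large reg; have d0 : 0 < D by lra.
apply: le_trans (bad_chernoff L_even h_ge2 reg kP (S := [set: T]) (a := N%:R / (256 * D)) _) _.
  move=> I le; apply: le_trans le _; rewrite ler_nat setIT.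
  by apply: subset_leq_card; apply/subsetP => x; rewrite !inE; exact: badl0.
rewrite ler_wpM2l // ler_expR; apply: final_exponent.
have -> : #|[set: T]| = N by rewrite cardsT card_ffun !card_ord.
have n1 := nu_ge1; have L4 := LR_ge4; have x1 := X_gt1.
rewrite X_eq; pose Q := D * nu ^+ 2 * LR.
have -> : X * (D ^+ 4 * nu ^+ 2 * LR) * (2 / D ^+ 5) - X * (D ^+ 4 * nu ^+ 2 * LR) / (256 * D) / D ^+ 2
  = - (X * (Q * (256^-1 - 2 / D ^+ 2))).
  by rewrite /Q; field; rewrite gt_eqF.
have Q1 : D <= Q.
  have q1 : 1 <= nu ^+ 2 * LR.
    by rewrite -[1]mulr1; apply: ler_pM => //; [rewrite exprn_ege1|lra].
  by rewrite /Q -mulrA; exact: (ler_peMr (ltW d0) q1).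
have D2 : 2 / D ^+ 2 <= 512^-1.
  have d1 : 1 <= D by lra.
  rewrite ler_pdivrMr ?exprn_gt0 //; have := ler_wpM2l (ltW d0) d1; rewrite -expr2 mulr1; lra.
have g : 3 <= Q * (256^-1 - 2 / D ^+ 2).
  have c1 : 512^-1 <= 256^-1 - 2 / D ^+ 2 :> R by lra.
  have Q0 : 0 <= Q by lra.
  apply: le_trans (ler_wpM2l Q0 c1); lra.
have X0 : 0 <= X by lra.
have := ler_wpM2l X0 g; have : 0 <= D * nu by apply: mulr_ge0; lra.
set u := X * (Q * _); lra.
Qed.

(** The density [4 / ell j] turns the decay in [grid_tail] into [2 * m ^ d], twice the entropy of
    the subset of the grid; and [m ^ d] exceeds [3 * X] because [nu ^ 2] in [X] pays for
    [n ^ j.+1]. *)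
Lemma event_middle J j : D ^+ (8 * J) <= nu -> (j < J)%N -> n ^+ j.+1 <= nu ^+ 2 ->
  wt lambda (fun I => 4 / ell j * N%:R <= (nbad k I j.+1)%:R) <= Z * expR (- (2 * X) - nu).
Proof.
move=> hJ jJ nj.
have Z0 : 0 <= Z by apply: sumr_ge0 => I _; rewrite exprn_ge0 // ltW // (lambda_pos reg).
have dl := d_large reg; have d0 : 0 < D by lra.
have n1 := nu_ge1; have L4 := LR_ge4; have x1 := X_gt1.
have hJ' : (J == 0)%N || (D ^+ (8 * J) <= nu) by rewrite hJ orbT.
have [m mL mN] := grid_size hJ' (ltnW jJ).
have l0 : 0 < ell j by have [_ e] := ell_ge reg j; exact: lt_le_trans e.
have t0 : 0 <= 4 / ell j by rewrite divr_ge0 // ltW.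
apply: le_trans (grid_tail L_even h_ge2 reg kP mL t0) _.
rewrite exp_N -expRD ler_wpM2l // ler_expR; apply: final_exponent.
have -> : ell j * (4 / ell j) * (m ^ d)%:R / 2 = 2 * (m ^ d)%:R by field; rewrite gt_eqF.
have e1 : expR (- (ell j / 2)) <= 1 by rewrite -expR0 ler_expR oppr_le0 divr_ge0 // ltW.
have m0 : 0 <= (m ^ d)%:R :> R by [].
have := ler_wpM2l m0 e1; rewrite mulr1.
have big : 3 * X <= (m ^ d)%:R.
  have nu2 : 0 < nu ^+ 2 by apply: exprn_gt0; lra.
  rewrite -(ler_pM2r nu2); apply: (@le_trans _ _ (N%:R / 2)); last first.
    rewrite ler_pdivrMr //; apply: le_trans mN _.
    have := ler_wpM2r m0 nj; set q : R := (m ^ d)%:R; set p := n ^+ j.+1 * q.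
    have -> : 2 * n ^+ j.+1 * q = 2 * p by rewrite /p; ring.
    have -> : q * nu ^+ 2 * 2 = 2 * (nu ^+ 2 * q) by ring.
    lra.
  rewrite X_eq.
  have -> : X * (D ^+ 4 * nu ^+ 2 * LR) / 2 = X * nu ^+ 2 * (D ^+ 4 * LR / 2) by ring.
  have -> : 3 * X * nu ^+ 2 = X * nu ^+ 2 * 3 by ring.
  apply: ler_wpM2l; first by apply: mulr_ge0; [lra|exact: ltW].
  have d4 : 1 <= D ^+ 3 by apply: exprn_ege1; lra.
  have d5 : D <= D ^+ 4 by rewrite exprS; exact: (ler_peMr (ltW d0) d4).
  have := ler_pM (ltW d0) _ d5 L4; have : 0 <= 4 :> R by []. move=> h4 /(_ h4); lra.
have : 0 <= D * nu by apply: mulr_ge0; lra.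
lra.
Qed.

(** The bound on [ell J] makes the entropy term [m ^ d * exp (- ell J / 2)] at most
    [N * exp (- d * ln L) = 1], so any density is allowed, in particular [1 / (8 * d * L)] from the
    isoperimetric inequality. *)
Lemma event_last J : (J == 0)%N || (D ^+ (8 * J) <= nu) -> 2 * D * nu <= ell J ->
  wt lambda (fun I => N%:R / (8 * D * LR) <= (nbad k I J.+1)%:R) <= Z * expR (- (2 * X) - nu).
Proof.
move=> hJ lJ; have [m mL mN] := grid_size hJ (leqnn J).
have Z0 : 0 <= Z by apply: sumr_ge0 => I _; rewrite exprn_ge0 // ltW // (lambda_pos reg).
have dl := d_large reg; have d0 : 0 < D by lra.
have n1 := nu_ge1; have L4 := LR_ge4; have x1 := X_gt1.
have [r1 rr] := w4_large reg; have r0 : 0 < w ^+ 4 by lra.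
have L0 : 0 < LR by lra.
pose t := (8 * D * LR)^-1; have t0 : 0 <= t.
  by rewrite invr_ge0; apply: mulr_ge0; [lra|exact: ltW].
have := grid_tail L_even h_ge2 reg kP mL t0; rewrite /t [_^-1 * N%:R]mulrC => le.
apply: le_trans le _.
rewrite {1}exp_N -expRD ler_wpM2l // ler_expR; apply: final_exponent.
have m0 : 0 <= (m ^ d)%:R :> R by [].
have small : (m ^ d)%:R * expR (- (ell J / 2)) <= 1.
  apply: (@le_trans _ _ (N%:R * expR (- (D * nu)))).
    apply: ler_pM; rewrite ?expR_ge0 ?ler0n //.
      rewrite ler_nat leq_exp2r ?(d_pos reg) //; apply: leq_trans mL.
      by rewrite leq_pmulr // expn_gt0.
    by rewrite ler_expR; lra.
  by rewrite exp_N -expRD subrr expR0.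
have key : 3 * X <= ell J * (8 * D * LR)^-1 * (m ^ d)%:R / 2.
  have n0 : 0 < n ^+ J.+1 by rewrite exprn_gt0 // ltr0n expn_gt0.
  have low := ell_ge40 J.
  set p := D ^+ (J + 2) in low; have p0 : 0 < p by apply: exprn_gt0.
  have prod : N%:R / (80 * w ^+ 4 * p) <= ell J * (m ^ d)%:R.
    apply: le_trans (ler_wpM2r m0 low).
    have -> : N%:R / (80 * w ^+ 4 * p) = N%:R / 2 / (40 * w ^+ 4 * p).
      by field; rewrite !gt_eqF // (w_gt0 reg).
    rewrite [leRHS]mulrAC; apply: ler_wpM2r; last by rewrite ler_pdivrMr //; move: mN; set q : R := (m ^ d)%:R; lra.
    by rewrite invr_ge0; apply: mulr_ge0; [lra|exact: ltW].
  have c0 : 0 <= (16 * D * LR)^-1 by rewrite invr_ge0; apply: mulr_ge0; [lra|exact: ltW].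
  have := ler_wpM2r c0 prod.
  have -> : ell J * (m ^ d)%:R * (16 * D * LR)^-1 = ell J * (8 * D * LR)^-1 * (m ^ d)%:R / 2.
    by field; rewrite !gt_eqF.
  apply: le_trans; rewrite X_eq.
  have -> : X * (D ^+ 4 * nu ^+ 2 * LR) / (80 * w ^+ 4 * p) * (16 * D * LR)^-1
    = X * (D ^+ 3 * nu ^+ 2 / (80 * 16 * w ^+ 4 * p)).
    by field; rewrite !gt_eqF // (w_gt0 reg).
  rewrite [3 * X]mulrC; apply: ler_wpM2l; first by lra.
  have den0 : 0 < 80 * 16 * w ^+ 4 * p by apply: mulr_gt0 => //; lra.
  rewrite ler_pdivlMr //.
  have DJ : D ^+ J <= nu ^+ 2.
    have d1 : 1 <= D by lra.
    case/orP: hJ => [/eqP ->|hJ]; first by rewrite expr0 exprn_ege1.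
    apply: le_trans (_ : nu <= _); last by rewrite expr2; apply: ler_peMr; lra.
    by apply: le_trans hJ; apply: (ler_weXn2l d1); exact: leq_pmull.
  have -> : 3 * (80 * 16 * w ^+ 4 * p) = 3 * 80 * 16 * w ^+ 4 * D ^+ 2 * D ^+ J by rewrite /p exprD; ring.
  have -> : D ^+ 3 * nu ^+ 2 = w ^+ 4 * w ^+ 4 * D ^+ 2 * nu ^+ 2 by rewrite rr; ring.
  apply: ler_pM => //.
    by apply: mulr_ge0; [lra|apply: exprn_ge0; exact: ltW].
  apply: ler_wpM2r; first by apply: exprn_ge0; exact: ltW.
  by apply: ler_wpM2r; lra.
set s := ell J * _ * _ / 2 in key *; set u := _ * expR _ in small *; lra.
Qed.

Lemma balanced_rare :
  wt lambda (fun I : {set T} => [forall b : bool, N%:R / (4 * w ^+ 4) < #|[set x in I | tpar x == b]|%:R :> R])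
  <= Z * expR (- (2 * X)).
Proof.
have Z0 : 0 <= Z by apply: sumr_ge0 => I _; rewrite exprn_ge0 // ltW // (lambda_pos reg).
have dl := d_large reg; have d0 : 0 < D by lra.
have n1 := nu_ge1; have nL := nu_le; have L4 := LR_ge4.
have exJ : exists J, 2 * D * nu <= ell J.
  exists L; apply: le_trans (ell_geom reg L); apply: ler_pM; [lra|lra|lra|].
  apply: le_trans nL _; rewrite -natrX ler_nat; apply: ltnW; apply: ltnW; exact: ltn_expl.
(* The first level at which the cost of a bad box exceeds the entropy of its position; minimality
   makes all earlier levels small compared with [ln L]. *)
pose J := ex_minn exJ; have [lJ minJ] : 2 * D * nu <= ell J /\ forall j, (j < J)%N -> ell j < 2 * D * nu.
  rewrite /J; case: ex_minnP => q lq mq; split=> // j; rewrite ltNge; apply: contraL => /mq.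
  by rewrite leqNgt.
have hJ : (J == 0)%N || (D ^+ (8 * J) <= nu).
  case: (J) minJ => // J' minJ; have [-> //] := small_level (minJ J' (ltnSn _)).
pose Q (c : 'I_J.+2) (I : {set T}) := if c == 0 :> nat then N%:R / (256 * D) <= (nbad k I 0)%:R
  else if c == J.+1 :> nat then N%:R / (8 * D * LR) <= (nbad k I J.+1)%:R
  else 4 / ell c.-1 * N%:R <= (nbad k I c.-1.+1)%:R.
apply: le_trans (wt_union (D := xpredT) (Q := Q) reg _) _.
  move=> I /forallP both.
  have [c Qc] : exists c, Q c I.
    apply/existsP; apply: contraT; rewrite negb_exists => /forallP none; exfalso.
    have c0 := none ord0; rewrite /Q /= -ltNge in c0.
    have cJ := none ord_max; rewrite /Q /= eqxx -ltNge in cJ.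
    suff : N%:R / (8 * D * LR) <= (nbad k I J.+1)%:R by rewrite leNgt cJ.
    apply: (many_bad L_even h_ge2 reg kP both c0) => j jJ.
    have jJ2 : (j.+1 < J.+2)%N by rewrite ltnS ltnW.
    have := none (Ordinal jJ2); rewrite /Q /= eqSS (ltn_eqF jJ) -ltNge; exact: id.
  by exists c.
have each c : wt lambda (Q c) <= Z * expR (- (2 * X) - nu).
  rewrite /Q; case: (eqVneq (c : nat) 0%N) => [_|c0]; first exact: event_zero.
  case: (eqVneq (c : nat) J.+1) => [_|cJ]; first exact: event_last hJ lJ.
  have cJ' : (c.-1 < J)%N := ord_mid (ltn_ord c) c0 cJ.
  have J0 : D ^+ (8 * J) <= nu by case/orP: hJ => // /eqP J0; have := leq_trans cJ' (eq_leq J0).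
  have [_ nj] := small_level (minJ _ cJ').
  exact: (event_middle J0 cJ' nj).
apply: le_trans (ler_sum _ (fun c _ => each c)) _.
rewrite sumr_const card_ord -[leLHS]mulr_natl expRD mulrCA ler_wpM2l // mulrCA.
rewrite -[leRHS]mulr1 ler_wpM2l ?expR_ge0 // expRN.
have -> : expR nu = LR by rewrite /log_side lnK // posrE ltr0n.
(* The extra [- nu] in each event is there for this: it leaves room for [L] events, and there are
   [J + 2]. *)
rewrite ler_pdivrMr ?ltr0n // mul1r ler_nat.
case/orP: hJ => [/eqP -> //|hJ].
case: (posnP J) => [-> //|J0].
rewrite -(ler_nat R); apply: le_trans nL; apply: le_trans hJ.
have d2 : 2 <= D by lra.
apply: (@le_trans _ _ (2 ^+ J.+1)).
  by rewrite -natrX ler_nat; exact: ltn_expl.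
apply: (@le_trans _ _ (D ^+ J.+1)); first by apply: lerXn2r; rewrite ?nnegrE; lra.
apply: ler_weXn2l; first by lra.
apply: leq_trans (exponent_succ J0); exact: leqnSn.
Qed.

End BalancedRareBound.

(** * Markov chains and the bottleneck *)

Section MarkovBottleneck.
Variables (R : realType) (S : finType) (P : S -> S -> R) (pi : S -> R).
Hypotheses (P_stoch : stochastic P) (pi_stat : stationary P pi) (pi_ge0 : forall x, 0 <= pi x)
  (pi_sum : \sum_x pi x = 1).

Lemma step_prob_ge0 t x y : 0 <= step_prob P t x y.
Proof.
elim: t x => [|t IH] x /=; first by case: eqP.
by apply: sumr_ge0 => z _; apply: mulr_ge0; [exact: (proj1 P_stoch)|exact: IH].
Qed.

Lemma step_prob_sum t x : \sum_y step_prob P t x y = 1.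
Proof.
elim: t x => [|t IH] x /=.
  by rewrite (bigD1 x) //= eqxx big1 ?addr0 // => y; rewrite eq_sym => /negPf ->.
rewrite exchange_big /= -[RHS](proj2 P_stoch x); apply: eq_bigr => z _.
by rewrite -mulr_sumr IH mulr1.
Qed.

Lemma step_prob_le1 (A : pred S) t x : \sum_(y | A y) step_prob P t x y <= 1.
Proof.
rewrite -(step_prob_sum t x) [leRHS](bigID A) /= lerDl.
by apply: sumr_ge0 => y _; exact: step_prob_ge0.
Qed.

(** Split on the first step. The part of the mass that stays in [A] is dominated by [pi] there, by
    stationarity, and falls under the induction; the part that leaves lands in [B] and has mass at
    most [pi B]. *)
Lemma escape_mass (A B : pred S) t :
  (forall x y, A x -> ~~ A y -> P x y != 0 -> B y) ->
  \sum_(x | A x) pi x * \sum_(y | ~~ A y) step_prob P t x y <= t%:R * \sum_(y | B y) pi y.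
Proof.
move=> exitB; elim: t => [|t IH].
  rewrite mul0r big1 // => x Ax; rewrite big1 ?mulr0 // => y nAy /=.
  by case: eqP => // e; rewrite -e Ax in nAy.
pose f z := \sum_(y | ~~ A y) step_prob P t z y.
have f0 z : 0 <= f z by apply: sumr_ge0 => y _; exact: step_prob_ge0.
have f1 z : f z <= 1 by exact: (step_prob_le1 (fun y => ~~ A y)).
have P0 x z : 0 <= P x z := proj1 P_stoch x z.
have stepE x : \sum_(y | ~~ A y) step_prob P t.+1 x y = \sum_z P x z * f z.
  by rewrite /= exchange_big /=; apply: eq_bigr => z _; rewrite mulr_sumr.
under eq_bigr => x _ do rewrite stepE mulr_sumr.
rewrite exchange_big /= (bigID A) /= -natr1 mulrDl mul1r; apply: lerD.
  apply: le_trans IH; apply: ler_sum => z _.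
  rewrite -/(f z) -[X in _ <= X * _](pi_stat z) mulr_suml [leRHS](bigID A) /= -[leLHS]addr0; apply: lerD.
    by apply: ler_sum => x _; rewrite mulrA.
  by apply: sumr_ge0 => x _; apply: mulr_ge0 => //; exact: mulr_ge0.
rewrite [leLHS]big_mkcond [leRHS]big_mkcond /=; apply: ler_sum => z _.
case: (boolP (A z)) => [_|nAz] /=; first by case: ifP.
case: (boolP (B z)) => [_|nBz].
  rewrite -[leRHS](pi_stat z) [leRHS](bigID A) /= -[leLHS]addr0; apply: lerD.
    apply: ler_sum => x _; apply: ler_wpM2l => //.
    by rewrite -[leRHS]mulr1; apply: ler_wpM2l.
  by apply: sumr_ge0 => x _; exact: mulr_ge0.
rewrite big1 // => x Ax; have -> : P x z = 0; last by rewrite mul0r mulr0.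
by apply/eqP; apply: contraNT nBz; exact: exitB.
Qed.

Lemma mixed_escape (A : pred S) (eps : R) t x :
  2^-1 * \sum_y `|step_prob P t x y - pi y| <= eps ->
  \sum_(y | A y) pi y - eps <= \sum_(y | A y) step_prob P t x y.
Proof.
move=> tv; suff : 2 * (\sum_(y | A y) pi y - \sum_(y | A y) step_prob P t x y)
   <= \sum_y `|step_prob P t x y - pi y|.
  by move: tv; set s := \sum_y _; set a := \sum_(y | _) _; set b := \sum_(y | _) _; lra.
have e1 := step_prob_sum t x; have e2 := pi_sum.
rewrite (bigID A) /= in e1; rewrite (bigID A) /= in e2.
rewrite [leRHS](bigID A) /=.
have h1 : \sum_(y | A y) pi y - \sum_(y | A y) step_prob P t x y
    <= \sum_(y | A y) `|step_prob P t x y - pi y|.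
  rewrite -sumrB; apply: ler_sum => y _; rewrite distrC; exact: ler_norm.
have h2 : \sum_(y | ~~ A y) step_prob P t x y - \sum_(y | ~~ A y) pi y
    <= \sum_(y | ~~ A y) `|step_prob P t x y - pi y|.
  by rewrite -sumrB; apply: ler_sum => y _; exact: ler_norm.
move: h1 h2 e1 e2.
set a := \sum_(y | A y) pi y; set b := \sum_(y | A y) step_prob P t x y.
set a' := \sum_(y | ~~ A y) pi y; set b' := \sum_(y | ~~ A y) step_prob P t x y.
set u := \sum_(y | A y) _; set u' := \sum_(y | ~~ A y) _; lra.
Qed.

Lemma mixed_at (y : R) : (mixing_time P pi < y%:E)%E ->
  exists2 t : nat, t%:R <= y + 1 &
    forall x, 2^-1 * \sum_z `|step_prob P t x z - pi z| <= (expR 1)^-1.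
Proof.
move=> lt; have [x0|none] := pickP (fun _ : S => true); last first.
  by exists 0%N => [|x]; [move: pi_sum; rewrite big_pred0 // => /eqP; rewrite eq_sym oner_eq0|have := none x].
have ex x : exists2 t0 : nat, t0%:R < y & mixed_from P pi x t0.
  have : (ereal_inf [set (t0%:R)%:E | t0 in [set t0 | mixed_from P pi x t0]]%classic < y%:E)%E.
    apply: le_lt_trans lt; exact: (le_bigmax _ (fun x => ereal_inf [set (t0%:R)%:E | t0 in [set t0 | mixed_from P pi x t0]]%classic)).
  move=> /ereal_inf_lt [_ /= [t0 mt0 <-]]; rewrite lte_fin => ly; by exists t0.
have y0 : 0 <= y by have [t0 h _] := ex x0; apply: le_trans (ltW h).
(* [mixed_from] speaks of times strictly after [t0]. All these [t0] lie below [y], so one integer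
   [m >= y] serves every initial state. *)
have [m [m1 m2]] := nat_ceil y0.
exists m => // x; have [t0 h mt] := ex x; apply: mt; rewrite -(ltr_nat R); exact: lt_le_trans m1.
Qed.

End MarkovBottleneck.

(* Chernoff bound: multiply each term by [theta ^ (#|A| - x #|S|)] with
   [theta = x / ((1 - x) lambda) <= 1]. *)
Lemma entropy_sum (R : realType) (V : finType) (S : {set V}) (lambda x : R) :
  0 < lambda -> 0 < x -> x <= lambda / (1 + lambda) ->
  \sum_(A : {set V} | (A \subset S) && (#|A|%:R <= x * #|S|%:R)) lambda ^+ #|A|
  <= expR (#|S|%:R * (binary_entropy x * ln 2 + x * ln lambda)).
Proof.
move=> l0 x0 xl; have l1 : 0 < 1 + lambda by lra.
have x1 : x < 1 by apply: le_lt_trans xl _; rewrite ltr_pdivrMr //; lra.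
have y0 : 0 < 1 - x by lra.
have xl' : x <= (1 - x) * lambda.
  by move: xl; rewrite ler_pdivlMr // mulrDr mulr1 mulrBl mul1r; lra.
pose a := ln x - ln (1 - x) - ln lambda.
have a0 : a <= 0.
  have : ln x <= ln ((1 - x) * lambda) by rewrite ler_ln ?posrE //; exact: mulr_gt0.
  by rewrite lnM ?posrE // /a; lra.
have l2 : ln 2 != 0 :> R by rewrite gt_eqF // ln_gt0 // ltr1n.
have entE : binary_entropy x * ln 2 = - x * ln x - (1 - x) * ln (1 - x).
  by rewrite /binary_entropy /log2; field.
set M := #|S|%:R.
apply: (@le_trans _ _ (\sum_(A : {set V} | A \subset S) expR (- (a * (x * M))) * (x / (1 - x)) ^+ #|A|)).
  rewrite big_mkcondr /=; apply: ler_sum => A _; case: ifP => [le|_]; last first.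
    by rewrite mulr_ge0 ?expR_ge0 // exprn_ge0 // divr_ge0 // ltW.
  have -> : lambda ^+ #|A| = expR (#|A|%:R * ln lambda) by rewrite expRM_natl lnK // posrE.
  have -> : (x / (1 - x)) ^+ #|A| = expR (#|A|%:R * (ln x - ln (1 - x))).
    by rewrite expRM_natl expRB !lnK ?posrE.
  rewrite -expRD ler_expR; have := ler_wnM2l a0 le; rewrite /a; set c : R := #|A|%:R.
  move: (ln x) (ln (1 - x)) (ln lambda) (x * M) => p q r s; nra.
rewrite -mulr_sumr sum_subsets_pow.
have -> : 1 + x / (1 - x) = expR (- ln (1 - x)).
  by rewrite expRN lnK ?posrE //; field; rewrite gt_eqF.
rewrite -expRM_natl -expRD ler_expR le_eqVlt; apply/orP; left; apply/eqP.
by rewrite entE /a -/M; ring.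
Qed.

(** [a], [a'], [b] are the masses of one side, of its complement and of the middle band, and [ie] is
    [1 / e]. The two sides have mass close to one half, which exceeds [4 / 9], so at least [1 / 45]
    must have escaped, far more than [tb] allows. *)
Lemma escape_contradiction (R : realFieldType) (a a' b tb ie E : R) :
  a * (a' - ie) <= tb -> a + a' = 1 -> b <= 3 * (E * E) -> a' <= a + b -> a <= a' -> 0 <= b ->
  tb <= 3 * E + 3 * (E * E) -> ie <= 4 / 9 -> 0 < E -> 10 ^+ 3 * E <= 1 -> False.
Proof.
move=> h1 h2 h3 h4 h5 h6 h7 h8 E0 E1.
have EE : E * E <= E by rewrite -[leRHS]mulr1 ler_pM2l //; lra.
have a1 : 2 / 5 <= a by lra.
have a2 : 1 / 18 <= a' - ie by lra.
have p1 : 0 <= 2 / 5 :> R by lra.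
have p2 : 0 <= 1 / 18 :> R by lra.
have := ler_pM p1 p2 a1 a2; lra.
Qed.

(** * The bottleneck between even and odd independent sets *)

Section TorusMixing.
Variables (d L' h : nat).
Hypotheses (L_even : L'.+2 = h.*2) (h_ge2 : (2 <= h)%N).
Local Notation L := L'.+2.
Local Notation T := {ffun 'I_d -> 'I_L'.+2}.
Local Notation tadj := (@torus_adj L'.+2 d).
Local Notation N := (L ^ d)%N.
Variables (R : realType) (lambda w v : R) (k : nat).
Hypothesis reg : regime d lambda w v.
Hypothesis kP : k%:R <= (2 ^ d)%:R / (16 * w ^+ 4) /\ (2 ^ d)%:R / (16 * w ^+ 4) < k.+1%:R.
Local Notation Z := (hc_total d L' lambda).
Local Notation D := (d%:R : R).
Local Notation nu := (log_side L' R).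
Local Notation X := (bottleneck d L' R).
Implicit Types (I J : {set T}) (b : bool).

Lemma sum_indep (Q : pred {set T}) (F : {set T} -> R) :
  \sum_(x : torus_indep L d | Q (val x)) F (val x)
  = \sum_(I : {set T} | independent tadj I && Q I) F I.
Proof.
have i0 : independent tadj (finset.set0 : {set T}) by apply/forall_inP => x; rewrite inE.
pose x0 : torus_indep L d := exist _ finset.set0 i0.
rewrite [RHS](reindex (fun x : torus_indep L d => val x)) /=.
  by apply: eq_bigl => x; rewrite (valP x).
exists (fun A => insubd x0 A) => [x _|A]; first exact: valKd.
by rewrite inE => /andP[iA _]; exact: insubdK.
Qed.

Lemma hc_total_gt0 : 0 < Z.
Proof.
apply: lt_le_trans (hc_total_ge L_even h_ge2 (lambda_pos reg) (d_pos reg)).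
by apply: exprn_gt0; apply: addr_gt0 => //; exact: lambda_pos reg.
Qed.

Lemma hardcore_wt (Q : pred {set T}) :
  \sum_(x : torus_indep L d | Q (val x)) hardcore lambda x = wt lambda Q / Z.
Proof.
rewrite /hardcore -mulr_suml (sum_indep Q (fun I => lambda ^+ #|I|)); congr (_ / _).
rewrite /hardcore_partition (sum_indep xpredT (fun I => lambda ^+ #|I|)).
by apply: eq_bigl => I; rewrite andbT.
Qed.

Definition parity_part I b := [set x in I | tpar x == b].
Definition imbalance I : R := #|parity_part I false|%:R - #|parity_part I true|%:R.

Lemma parity_part_diff I J b :
  (#|parity_part I b| <= #|parity_part J b| + #|parity_part (I :\: J) b|)%N.
Proof.
apply: leq_trans (leq_card_setU _ _); apply: subset_leq_card; apply/subsetP => x.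
by rewrite !inE; case: (x \in I); case: (x \in J); case: (tpar x == b).
Qed.

Lemma imbalance_lip I J : imbalance I - imbalance J <= #|(I :\: J) :|: (J :\: I)|%:R.
Proof.
have h1 := parity_part_diff I J false; have h2 := parity_part_diff J I true.
have h3 : (#|parity_part (I :\: J) false| + #|parity_part (J :\: I) true|
    <= #|(I :\: J) :|: (J :\: I)|)%N.
  rewrite -(cardsID [set x | tpar x == false] ((I :\: J) :|: (J :\: I))); apply: leq_add; apply: subset_leq_card;
    apply/subsetP => x; rewrite !inE; case: (tpar x);
    by case: (x \in I); case: (x \in J).
move: h1 h2 h3; rewrite -!(ler_nat R) !natrD /imbalance; lra.
Qed.

Section Shift.
Variable i0 : 'I_d.
(** A unit translation preserves the weights and exchanges the parities, so the two sides of the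
    bottleneck weigh the same. *)
Definition shift I : {set T} := [set x : T | x + unitv L' i0 \in I].

Lemma shift_inj : injective shift.
Proof.
move=> I J /setP e; apply/setP => y; have := e (y - unitv L' i0).
by rewrite !inE subrK.
Qed.

Lemma card_shift I : #|shift I| = #|I|.
Proof.
rewrite -(card_imset _ (@addIr T (unitv L' i0))); apply: eq_card => y; apply/imsetP/idP.
  by case=> x; rewrite inE => xI ->.
by move=> yI; exists (y - unitv L' i0); rewrite ?inE subrK.
Qed.

Lemma torus_adj_shift x y : tadj (x + unitv L' i0) (y + unitv L' i0) = tadj x y.
Proof.
apply/torus_adjP/torus_adjP => -[i hi]; exists i; move: hi.
  by rewrite !(addrAC _ (unitv L' i0)); case=> /addIr ->; [left|right].
by case=> ->; [left|right]; rewrite addrAC.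
Qed.

Lemma shift_indep I : independent tadj (shift I) = independent tadj I.
Proof.
apply/forall_inP/forall_inP => ind x xI; apply/forall_inP => y yI.
  rewrite -(subrK (unitv L' i0) x) -(subrK (unitv L' i0) y) torus_adj_shift.
  have xS : x - unitv L' i0 \in shift I by rewrite inE subrK.
  have yS : y - unitv L' i0 \in shift I by rewrite inE subrK.
  exact: (forall_inP (ind _ xS) _ yS).
move: xI yI; rewrite !inE => xI yI.
by rewrite -torus_adj_shift; exact: (forall_inP (ind _ xI) _ yI).
Qed.

Lemma shift_parity I b : #|parity_part (shift I) b| = #|parity_part I (~~ b)|.
Proof.
rewrite -[RHS]card_shift; apply: eq_card => x; rewrite !inE (tpar_unitv L_even h_ge2).
by case: (tpar x); case: b.
Qed.

Lemma shift_imbalance I : imbalance (shift I) = - imbalance I.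
Proof. by rewrite /imbalance !shift_parity opprB. Qed.

Lemma wt_shift (Q : pred {set T}) : wt lambda (fun I => Q (shift I)) = wt lambda Q.
Proof.
rewrite /wt [RHS](reindex_inj shift_inj) /=; apply: eq_big => [I|I _].
  by rewrite shift_indep.
by rewrite card_shift.
Qed.

End Shift.

(** Independence between the two parts is simply dropped, which makes the sum a product. *)
Lemma wt_small b (p q : R) :
  wt lambda (fun I => (#|parity_part I b|%:R <= p) && (#|parity_part I (~~ b)|%:R <= q))
  <= (\sum_(A : {set T} | (A \subset [set x | tpar x == b]) && (#|A|%:R <= p)) lambda ^+ #|A|)
   * (\sum_(A : {set T} | (A \subset [set x | tpar x == ~~ b]) && (#|A|%:R <= q)) lambda ^+ #|A|).
Proof.
have l0 := ltW (lambda_pos reg).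
set E := [set x | tpar x == b]; set E' := [set x | tpar x == ~~ b].
have dis : [disjoint E & E'].
  rewrite -setI_eq0; apply/eqP/setP => x; rewrite !inE; case: (tpar x); case: (b) => //.
have cov : E :|: E' = [set: T] by apply/setP => x; rewrite !inE; case: (tpar x); case: (b).
pose F I : R := if (#|parity_part I b|%:R <= p) && (#|parity_part I (~~ b)|%:R <= q)
  then lambda ^+ #|I| else 0.
apply: (@le_trans _ _ (\sum_(I : {set T} | I \subset E :|: E') F I)).
  rewrite /wt big_mkcond [leRHS]big_mkcond cov; apply: ler_sum => I _; rewrite subsetT /F.
  case: (independent _ _) => /=; first by case: ifP.
  by case: ifP => _; rewrite ?exprn_ge0.
rewrite sum_subsetsU // [X in _ <= X * _]big_mkcondr [X in _ <= _ * X]big_mkcondr big_distrlr /=.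
apply: ler_sum => A AE; apply: ler_sum => B BE; rewrite /F.
have pA : parity_part (A :|: B) b = A.
  apply/setP => x; rewrite !inE; apply/andP/idP => [[/orP[//|xB] /eqP e]|xA].
    by have := subsetP BE x xB; rewrite inE e; case: (b).
  by split; [rewrite xA|have := subsetP AE x xA; rewrite inE].
have pB : parity_part (A :|: B) (~~ b) = B.
  apply/setP => x; rewrite !inE; apply/andP/idP => [[/orP[xA|//] /eqP e]|xB].
    by have := subsetP AE x xA; rewrite inE e; case: (b).
  by split; [rewrite xB orbT|have := subsetP BE x xB; rewrite inE].
have dAB : A :&: B = finset.set0.
  by apply: disjoint_setI0; exact: disjointWl AE (disjointWr BE dis).
rewrite pA pB cardsU dAB cards0 subn0 exprD.
by case: (_ <= p); case: (_ <= q); rewrite /= ?mulr0 ?mul0r.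
Qed.

Section Entropy.
Variable rho : R.
Let s : R := (2 * Num.sqrt D)^-1.
Hypothesis rho_ge0 : 0 <= rho.
Hypothesis rho_le : rho + s <= lambda / (1 + lambda).
Hypothesis ent : binary_entropy s + binary_entropy (rho + s)
  + ((Num.sqrt D)^-1 + rho) * log2 lambda + 10 / (D ^+ 4 * L%:R * ln L%:R ^+ 2)
  <= log2 (1 + lambda).

Lemma half_card b : #|[set x : T | tpar x == b]| = (N %/ 2)%N /\ (N %/ 2)%:R = N%:R / 2 :> R.
Proof.
have e := card_tpar L_even h_ge2 b (d_pos reg).
split; first by rewrite -e mulKn.
by rewrite -e mulKn // natrM mulrAC mulfV ?mul1r.
Qed.

Lemma s_eq : s * (N%:R / 2) = N%:R / (4 * w ^+ 4) /\ 0 < s /\ 2 * s = (Num.sqrt D)^-1.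
Proof.
have [r1 _] := w4_large reg; have r0 : 0 < w ^+ 4 by lra.
rewrite /s (sqrt_d reg); split; first by field; rewrite gt_eqF // (w_gt0 reg).
split; first by rewrite invr_gt0; lra.
by field; rewrite gt_eqF // (w_gt0 reg).
Qed.

Lemma one_side_small b :
  wt lambda (fun I => (#|parity_part I b|%:R <= s * (N%:R / 2))
    && (#|parity_part I (~~ b)|%:R <= (rho + s) * (N%:R / 2)))
  <= Z * expR (- (2 * X)).
Proof.
have l0 := lambda_pos reg; have [_ [s0 s2]] := s_eq.
have l1 : 0 < 1 + lambda by lra.
have sl : s <= lambda / (1 + lambda) by apply: le_trans rho_le; rewrite lerDr.
have rs0 : 0 < rho + s by have := rho_ge0; lra.
have [c1 M1] := half_card b; have [c2 _] := half_card (~~ b).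
have := wt_small b (s * (N%:R / 2)) ((rho + s) * (N%:R / 2)).
have e1 := @entropy_sum R _ [set x : T | tpar x == b] lambda s l0 s0 sl.
have e2 := @entropy_sum R _ [set x : T | tpar x == ~~ b] lambda (rho + s) l0 rs0 rho_le.
rewrite c1 M1 in e1; rewrite c2 M1 in e2.
move/le_trans; apply; apply: le_trans (ler_pM _ _ e1 e2) _.
- by apply: sumr_ge0 => A _; rewrite exprn_ge0 // ltW.
- by apply: sumr_ge0 => A _; rewrite exprn_ge0 // ltW.
have Zge := hc_total_ge L_even h_ge2 l0 (d_pos reg).
apply: le_trans (ler_wpM2r (expR_ge0 _) Zge).
have -> : (1 + lambda) ^+ (N %/ 2) = expR (N%:R / 2 * ln (1 + lambda)).
  by rewrite -M1 expRM_natl lnK // posrE.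
rewrite -!expRD ler_expR.
have l2 := ln2_ge_half R; have l20 : 0 < ln 2 :> R by lra.
have M0 : 0 <= N%:R / 2 :> R by rewrite divr_ge0.
have lg (y : R) : log2 y * ln 2 = ln y by rewrite /log2 divfK // gt_eqF.
have x1 := X_gt1 L_even h_ge2 reg.
(* The last term of the entropy hypothesis is designed for this: its contribution is [5 * X * ln 2],
   and [ln 2 >= 1/2]. *)
have tail : 2 * X <= N%:R / 2 * (10 / (D ^+ 4 * L%:R * ln L%:R ^+ 2) * ln 2).
  have d0 : 0 < D by rewrite ltr0n (d_pos reg).
  have n1 := nu_ge1 L_even h_ge2 R; have n0 : 0 < nu by lra.
  have -> : N%:R / 2 * (10 / (D ^+ 4 * L%:R * ln L%:R ^+ 2) * ln 2) = 5 * X * ln 2.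
    rewrite (X_eq L_even h_ge2 reg) -/nu; field.
    by rewrite !gt_eqF // ltr0n.
  have x0 : 0 <= 5 * X by lra.
  by have := ler_wpM2l x0 l2; lra.
have ent' := ent; rewrite -s2 in ent'.
have := ler_wpM2l M0 (ler_wpM2r (ltW l20) ent'); rewrite lg; move: tail.
set tl := 10 / _; set M := N%:R / 2; rewrite -(lg lambda).
set H1 := binary_entropy s; set H2 := binary_entropy (rho + s); set g := log2 lambda => tail.
have -> : M * ((H1 + H2 + (2 * s + rho) * g + tl) * ln 2)
  = M * (H1 * ln 2 + s * (g * ln 2)) + M * (H2 * ln 2 + (rho + s) * (g * ln 2)) + M * (tl * ln 2).
  by ring.
lra.
Qed.

(** Either both parts exceed [N / (4 * sqrt d) = s * N / 2], which is [balanced_rare], or one is at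
    most that and the other exceeds it by at most the imbalance, which is [one_side_small]. *)
Lemma middle_rare : wt lambda (fun I => `|imbalance I| <= rho * (N%:R / 2))
  <= Z * (3 * expR (- (2 * X))).
Proof.
have [sE _] := s_eq.
pose Q (c : option bool) I := match c with
  | None => [forall b : bool, N%:R / (4 * w ^+ 4) < #|[set x in I | tpar x == b]|%:R :> R]
  | Some b => (#|parity_part I b|%:R <= s * (N%:R / 2))
    && (#|parity_part I (~~ b)|%:R <= (rho + s) * (N%:R / 2)) end.
apply: le_trans (wt_union (D := xpredT) (Q := Q) reg _) _.
  move=> I ex; case: (boolP (Q None I)) => [h1|]; first by exists None.
  rewrite /Q negb_forall => /existsP[b]; rewrite -leNgt -sE => small.
  exists (Some b) => //; rewrite /= small /=.
  move: ex small; rewrite ler_norml /imbalance mulrDl => /andP[].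
  by rewrite /parity_part; case: b => /=;
    set p : R := #|_|%:R; set q : R := #|[set x in I | tpar x == true]|%:R;
    set u := rho * _; set y := s * _; lra.
rewrite [leLHS](_ : _ = wt lambda (Q None) + (wt lambda (Q (Some true)) + wt lambda (Q (Some false)))).
  have h1 := balanced_rare L_even h_ge2 reg kP.
  have h2 := one_side_small true; have h3 := one_side_small false.
  have -> : Z * (3 * expR (- (2 * X))) = Z * expR (- (2 * X)) + (Z * expR (- (2 * X)) + Z * expR (- (2 * X))) by ring.
  by apply: lerD => //; apply: lerD.
rewrite (bigD1 None) //= (bigD1 (Some true)) //= (bigD1 (Some false)) //= big1 ?addr0 //.
by case=> [[]|].
Qed.

Lemma torus_mixing (P : torus_indep L d -> torus_indep L d -> R) :
  stochastic P -> local_chain rho P -> stationary P (hardcore lambda (e := tadj)) ->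
  ((expR X)%:E <= mixing_time P (hardcore lambda (e := tadj)))%E.
Proof.
move=> P_st P_loc P_stat; rewrite leNgt; apply/negP => lt.
have l0 := lambda_pos reg; have Zp := hc_total_gt0.
pose thr := rho * (N%:R / 2).
have total : \sum_(x : torus_indep L d) hardcore lambda x = 1.
  have -> : \sum_(x : torus_indep L d) hardcore lambda x = wt lambda xpredT / Z := hardcore_wt xpredT.
  rewrite /wt (eq_bigl (fun I => independent tadj I)); last by move=> I; rewrite andbT.
  by rewrite divff // gt_eqF.
have [t tX mixed] := mixed_at total lt.
have pi0 (x : torus_indep L d) : 0 <= hardcore lambda x.
  apply: divr_ge0; first by apply: exprn_ge0; exact: ltW.
  by apply: sumr_ge0 => y _; apply: exprn_ge0; exact: ltW.
pose A (x : torus_indep L d) := thr < imbalance (val x).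
pose B (x : torus_indep L d) := `|imbalance (val x)| <= thr.
(* A step changes the imbalance by at most [rho * N], the width of the band, so the band cannot be
   jumped over. *)
have exitB x y : A x -> ~~ A y -> P x y != 0 -> B y.
  rewrite /A /B -leNgt => Ax Ay /P_loc; rewrite card_ffun !card_ord => hl.
  have := imbalance_lip (val x) (val y).
  rewrite ler_norml Ay andbT; move: Ax hl; rewrite /thr.
  set u := imbalance _; set y' := imbalance _; set c : R := #|_|%:R; set NN : R := N%:R; lra.
have esc := escape_mass P_st P_stat pi0 t exitB.
have low x : A x -> hardcore lambda x * (\sum_(y | ~~ A y) hardcore lambda y - (expR 1)^-1)
    <= hardcore lambda x * \sum_(y | ~~ A y) step_prob P t x y.
  by move=> _; apply: ler_wpM2l => //; exact: (mixed_escape P_st total (fun y => ~~ A y) (mixed x)).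
have {}esc := le_trans (ler_sum _ low) esc; rewrite -mulr_suml in esc.
have splitA : \sum_(x | A x) hardcore lambda x + \sum_(y | ~~ A y) hardcore lambda y = 1.
  by rewrite -total [RHS](bigID A).
have pB : \sum_(y | B y) hardcore lambda y <= 3 * expR (- (2 * X)).
  by rewrite /B (hardcore_wt (fun I => `|imbalance I| <= thr)) ler_pdivrMr // mulrC; exact: middle_rare.
have i0 := Ordinal (d_pos reg).
have sym : \sum_(y | ~~ A y) hardcore lambda y <= \sum_(x | A x) hardcore lambda x + \sum_(y | B y) hardcore lambda y.
  rewrite /A /B (hardcore_wt (fun I => ~~ (thr < imbalance I))) (hardcore_wt (fun I => thr < imbalance I))
    (hardcore_wt (fun I => `|imbalance I| <= thr)) -mulrDl.
  apply: ler_wpM2r; first by rewrite invr_ge0 ltW.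
  rewrite -(wt_shift i0 (fun I => thr < imbalance I)).
  pose Q (c : bool) I := if c then thr < imbalance (shift i0 I) else `|imbalance I| <= thr.
  apply: le_trans (wt_union (D := xpredT) (Q := Q) reg _) _.
    move=> I; rewrite -leNgt => le; case: (boolP (Q true I)) => [h1|]; first by exists true.
    rewrite /Q shift_imbalance -leNgt => le2; exists false => //.
    by rewrite ler_norml le andbT lerNl.
  by rewrite (bigD1 true) //= (bigD1 false) //= big1 ?addr0 // => -[].
have A_le : \sum_(x | A x) hardcore lambda x <= \sum_(y | ~~ A y) hardcore lambda y.
  rewrite /A (hardcore_wt (fun I => ~~ (thr < imbalance I))) (hardcore_wt (fun I => thr < imbalance I)).
  apply: ler_wpM2r; first by rewrite invr_ge0 ltW.
  rewrite -(wt_shift i0 (fun I => thr < imbalance I)); apply: (wt_mono reg) => I.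
  rewrite shift_imbalance -leNgt => hh; have thr0 : 0 <= thr by rewrite mulr_ge0 // divr_ge0.
  by lra.
have Xb : 10 ^+ 3 <= X.
  have := X_big L_even h_ge2 reg; have n1 := nu_ge1 L_even h_ge2 R; have dl := d_large reg.
  have D0 : 0 <= D + 1 by lra.
  by have := ler_wpM2l D0 n1; lra.
have pB0 : 0 <= \sum_(y | B y) hardcore lambda y by apply: sumr_ge0.
have e1 : (expR 1)^-1 <= 4 / 9 :> R.
  have h1 := expR_ge1Dx (2^-1 : R).
  have h2 : expR 1 = expR 2^-1 * expR 2^-1 :> R by rewrite -expRD; congr expR; field.
  have h3 : 9 / 4 <= expR 1 :> R by rewrite h2; nra.
  by rewrite -[4 / 9]invrK lef_pV2 ?posrE ?expR_gt0 ?invf_div //; lra.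
pose E := expR (- X).
have E2 : expR (- (2 * X)) = E * E by rewrite /E -expRD; congr expR; ring.
have E0 : 0 < E := expR_gt0 _.
have EX : E * expR X = 1 by rewrite /E -expRD addNr expR0.
have Es : 10 ^+ 3 * E <= 1.
  have h1 := expR_ge1Dx X; have h2 : 10 ^+ 3 <= expR X by lra.
  by have := ler_wpM2l (ltW E0) h2; rewrite EX mulrC.
rewrite E2 in pB.
have tE : t%:R * \sum_(y | B y) hardcore lambda y <= 3 * E + 3 * (E * E).
  apply: (@le_trans _ _ ((expR X + 1) * (3 * (E * E)))); first exact: ler_pM.
  rewrite le_eqVlt; apply/orP; left; apply/eqP.
  by rewrite mulrDl mul1r mulrCA [expR X * _]mulrCA mulrA [expR X * E]mulrC EX mulr1; ring.
exact: (escape_contradiction esc splitA pB sym A_le pB0 tE e1 E0 Es).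
Qed.

End Entropy.
End TorusMixing.

Lemma regime_intro (R : realType) (d : nat) (lambda : R) :
  (2 * 10 ^+ 4) ^+ 8 <= d%:R :> R -> 0 < lambda ->
  10 ^+ 4 * d%:R `^ (- 4^-1) * ln d%:R `^ (3 / 4) <= lambda ->
  regime d lambda (expR (ln d%:R / 8)) (expR (ln (ln d%:R) / 2)).
Proof.
set D : R := d%:R => dl l0 hl; set w := expR _; set v := expR _.
have c0 : 1 <= 2 * 10 ^+ 4 :> R by lra.
have D1 : 2 * 10 ^+ 4 <= D.
  have c1 : 0 <= 2 * 10 ^+ 4 :> R by lra.
  by apply: le_trans dl; rewrite [leRHS]exprS; exact: (ler_peMr c1 (exprn_ege1 7 c0)).
have D0 : 0 < D by lra.
have w0 : 0 < w := expR_gt0 _.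
have w8 : w ^+ 8 = D.
  by rewrite /w -expRM_natl mulrC divfK // lnK.
have w_ge : 2 * 10 ^+ 4 <= w.
  by rewrite -(ler_pXn2r (n := 8)) ?w8 // nnegrE; lra.
have lnw : ln D = 8 * ln w by rewrite /w expRK; field.
have lnw_le : ln w <= w.
  have := le_ln1Dx (x := w - 1); rewrite (_ : 1 + (w - 1) = w); last by ring.
  by move=> h1; have := h1 _; lra.
have lnD1 : 1 <= ln D.
  have h2 := ln2_ge_half R.
  have : ln (2 * 2) <= ln D by rewrite ler_ln ?posrE; lra.
  by rewrite lnM ?posrE //; lra.
have v2 : v ^+ 2 = ln D.
  by rewrite /v -expRM_natl mulrC divfK // lnK // posrE; lra.
split.
- by split.
- by rewrite /v -expR0 ler_expR divr_ge0 // ln_ge0.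
- by rewrite v2 lnw; lra.
- split=> //.
  have DE : D `^ (- 4^-1) = (w ^+ 2)^-1.
    rewrite /powR gt_eqF // /w -expRM_natl -expRN; congr expR; lra.
  pose u := ln D `^ (3 / 4); have uE : u ^+ 2 = v ^+ 3.
    rewrite /u /powR gt_eqF; last by lra.
    by rewrite /v -!expRM_natl; congr expR; lra.
  have u0 : 0 <= u := powR_ge0 _ _.
  have w2 : 0 < w ^+ 2 by apply: exprn_gt0.
  have hl2 : 10 ^+ 4 * u <= lambda * w ^+ 2.
    by rewrite -ler_pdivrMr //; move: hl; rewrite DE -/u mulrAC.
  have c1 : 0 <= 10 ^+ 4 * u by apply: mulr_ge0 => //; lra.
  have := ler_pM c1 c1 hl2 hl2.
  have -> : 10 ^+ 4 * u * (10 ^+ 4 * u) = 10 * (10 ^+ 7 * v ^+ 3) by rewrite -uE; ring.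
  have -> : lambda * w ^+ 2 * (lambda * w ^+ 2) = lambda ^+ 2 * w ^+ 4 by ring.
  have : 0 <= 10 ^+ 7 * v ^+ 3 by apply: mulr_ge0; [lra|apply: exprn_ge0; exact: expR_ge0].
  lra.
rewrite -(ler_nat R) (natrX R d 16) (natrX R 2 d) -/D.
have -> : D ^+ 16 = expR (16 * ln D) by rewrite expRM_natl lnK.
have -> : 2 ^+ d = expR (D * ln 2) :> R by rewrite expRM_natl lnK // posrE ltr0n.
rewrite ler_expR lnw; have h2 := ln2_ge_half R.
have w1 : 1 <= w by lra.
have w7 : 256 <= w ^+ 7.
  by rewrite exprS; apply: le_trans (ler_peMr (ltW w0) (exprn_ege1 6 w1)); lra.
have : 256 * w <= D by rewrite -w8 exprSr; apply: ler_wpM2r => //; exact: ltW.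
have := ler_wpM2l (ltW D0) h2; set y := D * ln 2; lra.
Qed.

Theorem theorem1p3 (R : realType) :
  exists c d0 : R, [/\ 0 < c, 0 < d0 &
    forall (d L : nat) (lambda rho : R),
      d0 <= d%:R ->
      (4 <= L)%N -> ~~ odd L ->
      0 < lambda ->
      c * d%:R `^ (- 4^-1) * ln d%:R `^ (3 / 4) <= lambda ->
      0 <= rho ->
      rho + (2 * Num.sqrt d%:R)^-1 <= lambda / (1 + lambda) ->
      binary_entropy (2 * Num.sqrt d%:R)^-1
        + binary_entropy (rho + (2 * Num.sqrt d%:R)^-1)
        + ((Num.sqrt d%:R)^-1 + rho) * log2 lambda
        + 10 / (d%:R ^+ 4 * L%:R * ln L%:R ^+ 2)
        <= log2 (1 + lambda) ->
      forall P : torus_indep L d -> torus_indep L d -> R,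
        stochastic P ->
        ergodic P ->
        local_chain rho P ->
        stationary P (hardcore lambda (e := @torus_adj L d)) ->
        ((expR (L%:R ^+ d.-1 / (d%:R ^+ 4 * ln L%:R ^+ 2)))%:E
           <= mixing_time P (hardcore lambda (e := @torus_adj L d)))%E].
Proof.
exists (10 ^+ 4), ((2 * 10 ^+ 4) ^+ 8); split.
- by rewrite exprn_gt0.
- by rewrite exprn_gt0 // mulr_gt0 // exprn_gt0.
move=> d L lambda rho dl L4 L_ev l0 hl rho0 rs ent P P_st _ P_loc P_stat.
have reg := regime_intro dl l0 hl; set w := expR _ in reg; set v := expR _ in reg.
have y0 : 0 <= (2 ^ d)%:R / (16 * w ^+ 4) :> R by rewrite divr_ge0 // mulr_ge0 // exprn_ge0 // expR_ge0.
have kP : (Num.truncn ((2 ^ d)%:R / (16 * w ^+ 4)))%:R <= (2 ^ d)%:R / (16 * w ^+ 4)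
    /\ (2 ^ d)%:R / (16 * w ^+ 4) < (Num.truncn ((2 ^ d)%:R / (16 * w ^+ 4))).+1%:R.
  by apply/andP; exact: Num.Theory.truncn_itv.
have L_half : L = L./2.*2 by rewrite -[LHS]odd_double_half (negPf L_ev).
have h2 : (2 <= L./2)%N by rewrite -leq_double -L_half.
case: L L4 L_ev L_half h2 ent P P_st P_loc P_stat => [|[|L']] // _ _ L_half h2 ent P P_st P_loc P_stat.
exact: (torus_mixing L_half h2 reg kP rho0 rs ent P_st P_loc P_stat).
Qed.
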